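(* Assume the following. (A1) $Y$ is closed and convex, and for every $x\in X$ the functions $f(x,\cdot)$, $g_i(x,\cdot)$ ($i=1,\dots,l$) are convex on $Y$. (A2) $X$ is convex, each $g_i$ is convex on $X\times Y$, and $f$ is $\rho_f$-weakly convex on $C$. (A3) There is an open convex set $\mathcal{O}\supseteq X$ such that each $g_i$ is convex on $\mathcal{O}\times Y$, $\mathcal{F}(x)\neq\emptyset$ for all $x\in\mathcal{O}$, and $f$ is $\rho_f$-weakly convex on $D=\{(x,y)\in\mathcal{O}\times Y: g(x,y)\le0\}$; and either $\rho_f>0$ and $\gamma\in(0,1/\rho_f)$, or $\rho_f=0$ and $\gamma=\infty$. (A4) $F=F_1-F_2$ with $F_1,F_2$ $\rho_F$-weakly convex on $X\times Y$. Let $\{(x^k,y^k)\}$ and $\{\beta_k\}$ be generated by the algorithm iP-DwCA (described in the context) with $\epsilon\ge0$, and assume (A5) $\mathcal{M}_\gamma(x^k,y^k,\tilde y^k)\ne\emptyset$ for each $k=0,1,\dots$. Suppose $F$ is bounded below on $C$, that $F_1,F_2,f$ are locally Lipschitz on $C$, and that the sequence $\{(x^k,y^k)\}$ is bounded. Then: (1) If $\{\beta_k\}$ is bounded, every accumulation point of $\{(x^k,y^k)\}$ is a KKT point of $\mathrm{DwC}$-$(\mathrm{VP})_\gamma^\epsilon$. (2) If $\{\beta_k\}$ is bounded and the merit function $E_\beta$ is a KL function, then the sequence $\{(x^k,y^k)\}$ converges. (3) If $\epsilon>0$ and either $\gamma=\infty$, or $\gamma\ne\infty$ and $y\mapsto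 f(\bar x,y)+\delta_C(\bar x,y)$ is strictly convex for every accumulation point $\bar x$ of $\{x^k\}$, then $\{\beta_k\}$ is bounded.
   Context: Setting. $X\subseteq\mathbb{R}^n$, $Y\subseteq\mathbb{R}^m$, $F,f$ real-valued, $g=(g_1,\dots,g_l)$ $\mathbb{R}^l$-valued (inequalities componentwise). $\mathcal{F}(x)=\{y\in Y:g(x,y)\le0\}$, $C=\{(x,y)\in X\times Y:y\in\mathcal{F}(x)\}$, which is assumed closed; $\delta_C$ is its indicator function; $S(x)=\operatorname{argmin}_{y\in\mathcal{F}(x)}f(x,y)$, assumed nonempty for every $x\in X$. For $\gamma\in(0,\infty)$, $$v_\gamma(x,y)=\inf_{w\in\mathcal{F}(x)}\{f(x,w)+\tfrac1{2\gamma}\|w-y\|^2\},\quad S_\gamma(x,y)=\operatorname*{argmin}_{w\in\mathcal{F}(x)}\{f(x,w)+\tfrac1{2\gamma}\|w-y\|^2\},\quad (x,y)\in\mathcal{O}\times\mathbb{R}^m;$$ for $\gamma=\infty$ the same formulas are used with $1/\gamma=0$ (so $v_\infty(x,y)=\inf_{w\in\mathcal{F}(x)}f(x,w)$, $S_\infty(x,y)=S(x)$). A function $\phi$ is $\rho$-weakly convex ($\rho\ge0$) on a convex set $U$ if $\phi+\frac\rho2\|\cdot\|^2$ is convex on $U$. $\partial\varphi(\bar z)=\{v:\varphi(z)\ge\varphi(\bar z)+\langle v,z-\bar z\rangle+o(\|z-\bar z\|)\ \forall z\}$ is the Fréchet (regular) subdifferential (equal to the convex one for convex functions); $\partial_x,\partial_y$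 are the partial ones; $\mathcal{N}_U=\partial\delta_U$ is the normal cone of a convex set. ''Locally Lipschitz on $C$'' means Lipschitz continuous in a neighborhood of each point of $C$; accordingly $F_1,F_2,f$ are understood to be defined and weakly convex ($F_1,F_2$ with modulus $\rho_F$, and $f$ with modulus $\rho_f$) on an open convex set containing $C$, with subdifferentials taken there. Problem $\mathrm{DwC}$-$(\mathrm{VP})^\epsilon_\gamma$: minimize over $(x,y)\in C$ the function $F_1(x,y)+\frac{\rho_F}2\|(x,y)\|^2-\big(F_2(x,y)+\frac{\rho_F}2\|(x,y)\|^2\big)$ subject to $f(x,y)+\frac{\rho_v}2\|(x,y)\|^2-\big(v_\gamma(x,y)+\frac{\rho_v}2\|(x,y)\|^2\big)\le\epsilon$, where $\rho_v\ge\frac{\rho_f}{1-\gamma\rho_f}$ (and $\rho_v\ge0$ if $\rho_f=0$). A point $(\bar x,\bar y)\in C$ is a KKT point if there is $\lambda\ge0$ with $$0\in\partial F_1(\bar x,\bar y)-\partial F_2(\bar x,\bar y)+\lambda\,\partial f(\bar x,\bar y)-\lambda\,\partial v_\gamma(\bar x,\bar y)+\mathcal{N}_C(\bar x,\bar y),$$ $f(\bar x,\bar y)-v_\gamma(\bar x,\bar y)-\epsilon\le0$ and $\lambda\,(f(\bar x,\bar y)-v_\gamma(\bar x,\bar y)-\epsilon)=0$. Algorithm iP-DwCA. Parameters: $(x^0,y^0)\in C$; $\beta_0,\delta_\beta,\alpha,c_\beta>0$; $\epsilon\ge0$; $\rho_F\ge0$ (the weak convexity modulus of $F_1,F_2$);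 $\gamma\in(0,1/\rho_f)$ and $\rho_v\ge\frac{\rho_f}{1-\gamma\rho_f}$ if $\rho_f>0$, or $\gamma=\infty$ and $\rho_v\ge0$ if $\rho_f=0$. For $k=0,1,\dots$: take $\tilde y^k\in S_\gamma(x^k,y^k)$ and $\eta^k\in\mathcal{M}_\gamma(x^k,y^k,\tilde y^k)$, where $$\mathcal{M}_\gamma(x,y,\tilde y)=\Big\{\eta\in\mathbb{R}^l_+:0\in\partial_yf(x,\tilde y)+\tfrac1\gamma(\tilde y-y)+\sum_{i=1}^l\eta_i\partial_yg_i(x,\tilde y)+\mathcal{N}_Y(\tilde y),\ \sum_{i=1}^l\eta_ig_i(x,\tilde y)=0\Big\};$$ choose $\xi_0^k\in\partial F_2(x^k,y^k)$ and $\xi_1^k\in\partial_xf(x^k,\tilde y^k)+\sum_i\eta_i^k\partial_xg_i(x^k,\tilde y^k)$. It is assumed that the partial derivative formulas $\partial f=\partial_xf\times\partial_yf$ and $\partial g_i=\partial_xg_i\times\partial_yg_i$ hold at $(x^k,\tilde y^k)$. Put $$V_k(x,y)=v_\gamma(x^k,y^k)+\tfrac{\rho_v}2\|(x^k,y^k)\|^2+\langle\xi_1^k+\rho_vx^k,x-x^k\rangle+\langle(y^k-\tilde y^k)/\gamma+\rho_vy^k,y-y^k\rangle,$$ $$\varphi_k(x,y)=F_1(x,y)+\tfrac{\rho_F}2\|(x,y)\|^2-\langle\xi_0^k+\rho_F(x^k,y^k),(x,y)\rangle+\beta_k\max\{f(x,y)+\tfrac{\rho_v}2\|(x,y)\|^2-V_k(x,y)-\epsilon,0\}+\tfrac\alpha2\|(x,y)-(x^k,y^k)\|^2.$$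 Choose $(x^{k+1},y^{k+1})\in C$ with $$\mathrm{dist}\big(0,\partial\varphi_k(x^{k+1},y^{k+1})+\mathcal{N}_C(x^{k+1},y^{k+1})\big)\le\tfrac{\sqrt2}2\alpha\|(x^k,y^k)-(x^{k-1},y^{k-1})\|$$ (for $k=0$, $(x^{-1},y^{-1})$ is an arbitrary fixed vector). With $t^{k+1}=\max\{f(x^{k+1},y^{k+1})+\frac{\rho_v}2\|(x^{k+1},y^{k+1})\|^2-V_k(x^{k+1},y^{k+1})-\epsilon,0\}$, set $\beta_{k+1}=\beta_k+\delta_\beta$ if $\max\{\beta_k,1/t^{k+1}\}<c_\beta\|(x^{k+1},y^{k+1})-(x^k,y^k)\|^{-1}$ and $\beta_{k+1}=\beta_k$ otherwise ($1/0=+\infty$). The algorithm is considered without its stopping test. Merit function: with $z=(x,y)$, $g_0=F_1+\frac{\rho_F}2\|\cdot\|^2$, $h_0=F_2+\frac{\rho_F}2\|\cdot\|^2$, $\hat g_1=f+\frac{\rho_v}2\|\cdot\|^2$, $h_1=v_\gamma+\frac{\rho_v}2\|\cdot\|^2+\epsilon$, $$E_\beta(z,z_0,(\zeta_0,\zeta_1))=g_0(z)-\langle\zeta_0,z\rangle+h_0^*(\zeta_0)+\delta_C(z)+\beta\max\{\hat g_1(z)-\langle\zeta_1,z\rangle+h_1^*(\zeta_1),0\}+\tfrac\alpha4\|z-z_0\|^2,$$ where $h^*(\zeta)=\sup_z\{\langle\zeta,z\rangle-h(z)\}$. ''$E_\beta$ is a KL function'' is understood for every $\beta>0$. KL function: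 for $\eta\in(0,+\infty]$ let $\Phi_\eta$ be the set of concave continuous $\phi:[0,\eta)\to[0,+\infty)$ with $\phi(0)=0$, $\phi\in C^1(0,\eta)$, $\phi'>0$ on $(0,\eta)$. A proper lower semicontinuous $\sigma$ is a KL function if for each $\bar u$ with $\partial\sigma(\bar u)\ne\emptyset$ there exist $\eta\in(0,+\infty]$, a neighborhood $\mathcal{Z}$ of $\bar u$ and $\phi\in\Phi_\eta$ with $\phi'(\sigma(u)-\sigma(\bar u))\,\mathrm{dist}(0,\partial\sigma(u))\ge1$ for all $u\in\mathcal{Z}$ with $\sigma(\bar u)<\sigma(u)<\sigma(\bar u)+\eta$. *)

(* Defs.v *)
From HB Require Import structures.
From mathcomp Require Import all_boot all_order all_algebra.
From mathcomp Require Import all_classical all_reals all_analysis.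

Set Implicit Arguments.
Unset Strict Implicit.
Unset Printing Implicit Defensive.

Import Order.TTheory GRing.Theory Num.Theory.
Import numFieldNormedType.Exports.

Local Open Scope classical_set_scope.
Local Open Scope ring_scope.

(* The library norm on 'rV[R]_n and on products is the sup norm.  It only serves
   to provide the topology, boundedness and Lipschitz continuity, which do not
   depend on the choice of an equivalent norm; every norm written in a formula
   below is the Euclidean one, [enorm]. *)
HB.mixin Record NormedModule_isInner (R : realType) E
    of NormedModule R E := {
  dot : E -> E -> R ;
  dotC : forall u v, dot u v = dot v u ;
  dotDl : forall u v w, dot (u + v) w = dot u w + dot v w ;
  dotZl : forall a u v, dot (a *: u) v = a * dot u v ;
  dot_gt0 : forall u, u != 0 -> 0 < dot u u
}.

#[short(type="innerType")]
HB.structure Definition Inner (R : realType) :=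
  { E of NormedModule R E & NormedModule_isInner R E }.

Section inner_rV.
Variables (R : realType) (n : nat).
Implicit Types u v w : 'rV[R]_n.

Definition dot_rV u v : R := \sum_i u 0 i * v 0 i.

Lemma dot_rVC u v : dot_rV u v = dot_rV v u.
Proof. by apply: eq_bigr => i _; rewrite mulrC. Qed.

Lemma dot_rVDl u v w : dot_rV (u + v) w = dot_rV u w + dot_rV v w.
Proof. by rewrite -big_split; apply: eq_bigr => i _; rewrite mxE mulrDl. Qed.

Lemma dot_rVZl a u v : dot_rV (a *: u) v = a * dot_rV u v.
Proof. by rewrite mulr_sumr; apply: eq_bigr => i _; rewrite mxE mulrA. Qed.

Lemma dot_rV_gt0 u : u != 0 -> 0 < dot_rV u u.
Proof.
move=> u0; have sq i : 0 <= u 0 i * u 0 i by rewrite -expr2 sqr_ge0.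
rewrite lt_neqAle (sumr_ge0 _ (fun i _ => sq i)) andbT eq_sym.
apply: contra u0 => /eqP /psumr_eq0P h; apply/eqP/rowP => i.
by rewrite mxE; apply/eqP; have /eqP := h (fun i _ => sq i) i isT; rewrite mulf_eq0 orbb.
Qed.

HB.instance Definition _ := NormedModule_isInner.Build R 'rV[R]_n
  dot_rVC dot_rVDl dot_rVZl dot_rV_gt0.
End inner_rV.

Section inner_prod.
Variables (R : realType) (E F : innerType R).
Implicit Types u v w : (E * F)%type.

Definition dot_prod u v : R := dot u.1 v.1 + dot u.2 v.2.

Lemma dot_prodC u v : dot_prod u v = dot_prod v u.
Proof. by rewrite /dot_prod dotC [dot u.2 _]dotC. Qed.

Lemma dot_prodDl u v w : dot_prod (u + v) w = dot_prod u w + dot_prod v w.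
Proof. by rewrite /dot_prod /= !dotDl addrACA. Qed.

Lemma dot_prodZl a u v : dot_prod (a *: u) v = a * dot_prod u v.
Proof. by rewrite /dot_prod /= !dotZl mulrDr. Qed.

Lemma dot_ge0 (G : innerType R) (u : G) : 0 <= dot u u.
Proof.
have [->|/dot_gt0/ltW//] := eqVneq u 0.
by rewrite -[X in dot X _](scale0r 0) dotZl mul0r.
Qed.

Lemma dot_prod_gt0 u : u != 0 -> 0 < dot_prod u u.
Proof.
case: u => a b; rewrite /dot_prod /=.
have [->|a0 _] := eqVneq a 0; last by rewrite ltr_pwDl ?dot_gt0 ?dot_ge0.
have [->|b0 _] := eqVneq b 0; first by rewrite eqxx.
by rewrite ltr_wpDl ?dot_gt0 ?dot_ge0.
Qed.

HB.instance Definition _ := NormedModule_isInner.Build R (E * F)%type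
  dot_prodC dot_prodDl dot_prodZl dot_prod_gt0.
End inner_prod.

Section variational.
Variables (R : realType) (E : innerType R).
Implicit Types (u v z zbar zeta : E) (A B D : set E).

Definition enorm u : R := Num.sqrt (dot u u).

Definition dist0 A : \bar R := ereal_inf [set (enorm u)%:E | u in A].

Definition mink_sum A B : set E := [set u + v | u in A & v in B].

(* The indicator function delta_A of convex analysis. *)
Definition set_indic A z : \bar R := if `[< A z >] then 0%E else +oo%E.

(* The term o(||z - zbar||) is unfolded.  The subdifferential is local, so the
   values of [phi] away from [zbar] are irrelevant, and it is empty where [phi]
   is not finite. *)
Definition subdiff (phi : E -> \bar R) zbar : set E :=
  [set v | phi zbar \is a fin_num /\
    forall e : R, 0 < e -> \forall z \near zbar,
      (phi zbar + (dot v (z - zbar) - e * enorm (z - zbar))%:E <= phi z)%E].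

Definition rsubdiff (phi : E -> R) : E -> set E := subdiff (EFin \o phi).

Definition normal_cone A : E -> set E := subdiff (set_indic A).

Definition weakly_convex (rho : R) D (phi : E -> R) : Prop :=
  0 <= rho /\
  convex_function D (fun z => phi z + rho / 2 * enorm z ^+ 2).

Definition strictly_convex (phi : E -> \bar R) : Prop :=
  forall z1 z2 (t : R), z1 != z2 -> 0 < t < 1 ->
    (phi z1 < +oo)%E -> (phi z2 < +oo)%E ->
    (phi (t *: z1 + (1 - t) *: z2)%R < t%:E * phi z1 + (1 - t)%:E * phi z2)%E.

(* Lipschitz continuity on a full (not relative to [A]) neighborhood of each
   point of [A]. *)
Definition locally_lipschitz A (phi : E -> R) : Prop :=
  forall z, A z -> exists2 N, nbhs z N & [lipschitz (phi u : R^o) | u in N].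

(* Fenchel conjugate of a function with domain [D]. *)
Definition conjugate D (h : E -> \bar R) zeta : \bar R :=
  ereal_sup [set ((dot zeta z)%:E - h z)%E | z in D].

Definition proper (sigma : E -> \bar R) : Prop :=
  (forall u, sigma u != -oo%E) /\ exists u, (sigma u < +oo)%E.

(* Only the values of [phi] on [0, eta[ matter; concavity of [phi] is convexity
   of its opposite. *)
Definition desingularizing (eta : \bar R) (phi : R -> R) : Prop :=
  let I := [set s : R | 0 <= s /\ (s%:E < eta)%E] in
  let I' := [set s : R | 0 < s /\ (s%:E < eta)%E] in
  [/\ {within I, continuous phi},
      (forall s, I s -> 0 <= phi s),
      convex_function (I : set R^o) (fun s => - phi s),
      phi 0 = 0 &
      forall s, I' s ->
        [/\ derivable phi s 1, {for s, continuous (derive1 phi)} & 0 < derive1 phi s]].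

Definition KL_function (sigma : E -> \bar R) : Prop :=
  [/\ proper sigma, lower_semicontinuous sigma &
    forall ubar, subdiff sigma ubar !=set0 ->
      exists (eta : \bar R) (Z : set E) (phi : R -> R),
        [/\ (0 < eta)%E, nbhs ubar Z, desingularizing eta phi &
          forall u, Z u ->
            (sigma ubar < sigma u)%E -> (sigma u < sigma ubar + eta)%E ->
            (1 <= (derive1 phi (fine (sigma u - sigma ubar)))%:E
                    * dist0 (subdiff sigma u))%E]].

End variational.

Definition argmin_on (R : realType) (T : Type) (A : set T) (h : T -> R) : set T :=
  [set w | A w /\ forall w', A w' -> h w <= h w'].

(* [udom] is the open convex set containing C on which F1, F2 and f are defined
   and weakly convex; [odom] is the open convex set O containing X.  All the
   functions are total here.  Only the germs of F1, F2 and f at points of [udom]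
   enter their subdifferentials, so their values outside their domains play no
   role; the g_i are taken real-valued on the whole space. *)
Record problem (R : realType) (n m l : nat) := Problem {
  xdom : set 'rV[R]_n ;
  ydom : set 'rV[R]_m ;
  odom : set 'rV[R]_n ;
  udom : set ('rV[R]_n * 'rV[R]_m) ;
  objF : 'rV[R]_n * 'rV[R]_m -> R ;
  objF1 : 'rV[R]_n * 'rV[R]_m -> R ;
  objF2 : 'rV[R]_n * 'rV[R]_m -> R ;
  lowf : 'rV[R]_n * 'rV[R]_m -> R ;
  lowg : 'I_l -> 'rV[R]_n * 'rV[R]_m -> R ;
  rhoF : R ;
  rhof : R ;
  rhov : R ;
  gam : \bar R ;
  eps : R
}.

Section reformulation.
Variables (R : realType) (n m l : nat) (P : problem R n m l).
Local Notation E := ('rV[R]_n * 'rV[R]_m)%type.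

Definition feas (x : 'rV[R]_n) : set 'rV[R]_m :=
  [set y | ydom P y /\ forall i, lowg P i (x, y) <= 0].

Definition Cset : set E := [set z | xdom P z.1 /\ ydom P z.2 /\ feas z.1 z.2].

Definition Dset : set E :=
  [set z | odom P z.1 /\ ydom P z.2 /\ forall i, lowg P i z <= 0].

(* 1 / gamma, equal to 0 for gamma = +oo. *)
Definition invgam : R := fine (gam P)^-1%E.

Definition moreau_obj (z : E) (w : 'rV[R]_m) : R :=
  lowf P (z.1, w) + invgam / 2 * enorm (w - z.2) ^+ 2.

Definition vgam (z : E) : \bar R :=
  ereal_inf [set (moreau_obj z w)%:E | w in feas z.1].

Definition Sgam (z : E) : set 'rV[R]_m := argmin_on (feas z.1) (moreau_obj z).

Definition Slow (x : 'rV[R]_n) : set 'rV[R]_m :=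
  argmin_on (feas x) (fun y => lowf P (x, y)).

Definition subdiff_x (phi : E -> R) (z : E) : set 'rV[R]_n :=
  rsubdiff (fun x => phi (x, z.2)) z.1.

Definition subdiff_y (phi : E -> R) (z : E) : set 'rV[R]_m :=
  rsubdiff (fun y => phi (z.1, y)) z.2.

Definition partial_formula (phi : E -> R) (z : E) : Prop :=
  rsubdiff phi z = subdiff_x phi z `*` subdiff_y phi z.

Definition multipliers (z : E) (yt : 'rV[R]_m) : set ('I_l -> R) :=
  [set eta | [/\ (forall i, 0 <= eta i),
     \sum_i eta i * lowg P i (z.1, yt) = 0 &
     exists (a : 'rV[R]_m) (b : 'I_l -> 'rV[R]_m) (c : 'rV[R]_m),
       [/\ subdiff_y (lowf P) (z.1, yt) a,
           (forall i, subdiff_y (lowg P i) (z.1, yt) (b i)),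
           normal_cone (ydom P) yt c &
           0 = a + invgam *: (yt - z.2) + \sum_i eta i *: b i + c]]].

(* Range of gamma (the two alternatives of the standing assumption), together
   with the corresponding lower bound on rho_v. *)
Definition moduli_range : Prop :=
  (0 < rhof P /\ (0 < gam P)%E /\ (gam P < (rhof P)^-1%:E)%E /\
     rhof P / (1 - fine (gam P) * rhof P) <= rhov P) \/
  (rhof P = 0 /\ gam P = +oo%E /\ 0 <= rhov P).

Definition KKT_point (z : E) : Prop :=
  Cset z /\ exists lam : R,
    [/\ 0 <= lam,
        (exists a b c d e : E,
          [/\ rsubdiff (objF1 P) z a /\ rsubdiff (objF2 P) z b,
              rsubdiff (lowf P) z c, subdiff vgam z d, normal_cone Cset z e &
              0 = a - b + lam *: c - lam *: d + e]),
        ((lowf P z)%:E - vgam z - (eps P)%:E <= 0)%E &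
        (lam%:E * ((lowf P z)%:E - vgam z - (eps P)%:E) = 0)%E].

(* [vgam zk] is finite on C, so [fine] loses nothing. *)
Definition Vlin (zk : E) (ytk : 'rV[R]_m) (xi1 : 'rV[R]_n) (z : E) : R :=
  fine (vgam zk) + rhov P / 2 * enorm zk ^+ 2
  + dot (xi1 + rhov P *: zk.1) (z.1 - zk.1)
  + dot (invgam *: (zk.2 - ytk) + rhov P *: zk.2) (z.2 - zk.2).

Definition tres (V : E -> R) (z : E) : R :=
  Num.max (lowf P z + rhov P / 2 * enorm z ^+ 2 - V z - eps P) 0.

Definition phisub (alpha betak : R) (zk xi0 : E) (V : E -> R) (z : E) : R :=
  objF1 P z + rhoF P / 2 * enorm z ^+ 2 - dot (xi0 + rhoF P *: zk) z
  + betak * tres V z + alpha / 2 * enorm (z - zk) ^+ 2.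

(* [zm1] is the arbitrary vector (x^{-1}, y^{-1}). *)
Definition zprev (zm1 : E) (z : nat -> E) (k : nat) : E :=
  if k is j.+1 then z j else zm1.

(* In [\bar R] the library sets 0^-1 = +oo. *)
Record iP_DwCA (alpha dbeta cbeta : R) (zm1 : E) (z : nat -> E)
    (beta : nat -> R) (yt : nat -> 'rV[R]_m) (eta : nat -> 'I_l -> R)
    (xi0 : nat -> E) (xi1 : nat -> 'rV[R]_n) : Prop := {
  algo_params :
    [/\ 0 < beta 0%N, 0 < dbeta, 0 < alpha, 0 < cbeta & 0 <= eps P] ;
  algo_feasible : forall k, Cset (z k) ;
  algo_yt : forall k, Sgam (z k) (yt k) ;
  algo_eta : forall k, multipliers (z k) (yt k) (eta k) ;
  algo_xi0 : forall k, rsubdiff (objF2 P) (z k) (xi0 k) ;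
  algo_xi1 : forall k, exists (a : 'rV[R]_n) (b : 'I_l -> 'rV[R]_n),
    [/\ subdiff_x (lowf P) ((z k).1, yt k) a,
        (forall i, subdiff_x (lowg P i) ((z k).1, yt k) (b i)) &
        xi1 k = a + \sum_i eta k i *: b i] ;
  algo_step : forall k,
    let phik :=
      phisub alpha (beta k) (z k) (xi0 k) (Vlin (z k) (yt k) (xi1 k)) in
    (dist0 (mink_sum (rsubdiff phik (z k.+1)) (normal_cone Cset (z k.+1)))
     <= (Num.sqrt 2 / 2 * alpha * enorm (z k - zprev zm1 z k))%:E)%E ;
  algo_beta : forall k,
    let t := tres (Vlin (z k) (yt k) (xi1 k)) (z k.+1) in
    beta k.+1 =
      if (maxe (beta k)%:E (t%:E)^-1
            < cbeta%:E * ((enorm (z k.+1 - z k))%:E)^-1)%E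
      then beta k + dbeta else beta k
}.

(* The conjugates are taken over the domains of h0 (that of F2) and of h1
   (that of v_gamma, i.e. O x R^m). *)
Definition merit (alpha beta : R) (u : (E * E) * (E * E)) : \bar R :=
  let: ((z, z0), (zeta0, zeta1)) := u in
  let h0 (w : E) : \bar R := (objF2 P w + rhoF P / 2 * enorm w ^+ 2)%:E in
  let h1 (w : E) : \bar R :=
    (vgam w + (rhov P / 2 * enorm w ^+ 2 + eps P)%:E)%E in
  ((objF1 P z + rhoF P / 2 * enorm z ^+ 2 - dot zeta0 z)%:E
   + conjugate (udom P) h0 zeta0
   + set_indic Cset z
   + beta%:E *
       maxe ((lowf P z + rhov P / 2 * enorm z ^+ 2 - dot zeta1 z)%:E
             + conjugate (odom P `*` setT) h1 zeta1) 0
   + (alpha / 4 * enorm (z - z0) ^+ 2)%:E)%E.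

End reformulation.

(* Main.v *)
(** The algorithm linearizes v_gamma + rho_v/2 |.|^2, a convex function on
    O x R^m: combining the multipliers with the weak convexity of f and the
    convexity of the g_i shows directly that (xi_1 + rho_v x, (y - yt)/gamma +
    rho_v y) is one of its subgradients at the current iterate. A separation
    argument turns the inexact optimality condition of each subproblem into
    p - zeta_0 + lambda (q - zeta_1) + nu + alpha (z' - z) = e
    with p, q, nu, lambda subgradients of F1, f, delta_C and beta max(., 0), up
    to the quadratic terms, which yields the descent of an energy by
    alpha/4 |z' - z|^2 as long as beta is constant.

    (1) If beta is bounded it is eventually constant, the steps tend to 0, and
    the relation above passes to the limit. (2) The energy is the value of E_beta
    at (z_(k+1), z_k, zeta_k), where E_beta has a subgradient of the order of the
    last two steps, so the KL inequality gives a finite length. (3) If beta is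
    unbounded, dividing the relation by beta along the increments gives a limit
    point minimizing f + rho_v/2 |.|^2 - <zeta_1, .> over C with
    f - v_gamma >= eps > 0; strict convexity in y forces y = yt there, hence
    f = v_gamma, a contradiction.

    All limits are taken along ultrafilters on nat, along which every bounded
    sequence converges. *)

Require Import Defs.
From HB Require Import structures.
From mathcomp Require Import all_boot all_order all_algebra.
From mathcomp Require Import all_classical all_reals all_analysis.
From mathcomp Require Import ring lra.

Set Implicit Arguments.
Unset Strict Implicit.
Unset Printing Implicit Defensive.

Import Order.TTheory GRing.Theory Num.Theory.
Import numFieldNormedType.Exports.

Local Open Scope classical_set_scope.
Local Open Scope ring_scope.

(** * Subgradients in inner product spaces *)

(** Frechet subgradients are only local and do not pass to limits, so the estimates are written with
    [csub], the global subgradient inequality on a set, for functions made convex by [sqhat]. This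
    condition is stable under limits, and Frechet subgradients come back only where a conclusion
    asks for them.

    No regularity of v_gamma is given. Its finiteness on O comes from the affine minorant at the
    first iterate, its continuity on C from the local boundedness of subgradients of a convex
    function.

    The constant sqrt 2 / 2 of the inexactness test is the one for which sqrt 2 / 2 * D * d <= D^2 /
    4 + d^2 / 2, with d the new step and D the previous one. Of the gain alpha d^2, half survives,
    against a loss alpha / 4 D^2; the energy stores alpha / 4 d^2 to pay for the next loss.

    Normal vectors nu have no a priori bound, so their limits are read off from the optimality
    relation instead of being extracted. Along one ultrafilter all the other sequences converge at
    once, without nested subsequences. *)

Section inner_algebra.
Variables (R : realType) (E : innerType R).
Implicit Types u v w : E.

Lemma dotDr u v w : dot u (v + w) = dot u v + dot u w.
Proof. by rewrite !(dotC u) dotDl. Qed.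

Lemma dotZr a u v : dot u (a *: v) = a * dot u v.
Proof. by rewrite !(dotC u) dotZl. Qed.

Lemma dotNl u v : dot (- u) v = - dot u v.
Proof. by rewrite -scaleN1r dotZl mulN1r. Qed.

Lemma dotNr u v : dot u (- v) = - dot u v.
Proof. by rewrite !(dotC u) dotNl. Qed.

Lemma dot0l u : dot 0 u = 0.
Proof. by rewrite -(scale0r 0) dotZl mul0r. Qed.

Lemma dot0r u : dot u 0 = 0.
Proof. by rewrite dotC dot0l. Qed.

Definition dotE := (@dotDl R E, dotDr, dotNl, dotNr, @dotZl R E, dotZr, dot0l, dot0r).

Lemma enorm_sq u : enorm u ^+ 2 = dot u u.
Proof. by rewrite sqr_sqrtr ?dot_ge0. Qed.

Lemma enorm_ge0 u : 0 <= enorm u.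
Proof. exact: sqrtr_ge0. Qed.

Lemma enormZ a u : enorm (a *: u) = `|a| * enorm u.
Proof. by rewrite /enorm dotZl dotZr mulrA -expr2 sqrtrM ?sqr_ge0// sqrtr_sqr. Qed.

Lemma enormN u : enorm (- u) = enorm u.
Proof. by rewrite /enorm dotNl dotNr opprK. Qed.

Lemma enorm0 : enorm (0 : E) = 0.
Proof. by rewrite /enorm dot0l sqrtr0. Qed.

Lemma enorm_distC u v : enorm (u - v) = enorm (v - u).
Proof. by rewrite -enormN opprB. Qed.

Lemma enorm_sqD u v : enorm (u + v) ^+ 2 = enorm u ^+ 2 + 2 * dot u v + enorm v ^+ 2.
Proof. by rewrite !enorm_sq !dotE (dotC v u); ring. Qed.

Lemma enorm_sqB u v : enorm (u - v) ^+ 2 = enorm u ^+ 2 - 2 * dot u v + enorm v ^+ 2.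
Proof. by rewrite !enorm_sq !dotE (dotC v u); ring. Qed.

Lemma dot_le_enorm u v : dot u v <= enorm u * enorm v.
Proof.
have [->|v0] := eqVneq v 0; first by rewrite dot0r enorm0 mulr0.
apply: le_trans (ler_norm _) _.
rewrite -ler_sqr ?nnegrE ?mulr_ge0 ?enorm_ge0// -normrX ger0_norm ?sqr_ge0//.
rewrite exprMn !enorm_sq.
have := dot_ge0 (dot v v *: u - dot u v *: v).
have vv := dot_gt0 _ v0.
rewrite !dotE (dotC v u).
move=> H; rewrite -subr_ge0 -(pmulr_rge0 _ vv); lra.
Qed.

Lemma norm_dot_le u v : `|dot u v| <= enorm u * enorm v.
Proof.
by rewrite ler_norml dot_le_enorm andbT lerNl -dotNl -(enormN u) dot_le_enorm.
Qed.

Lemma ler_enormD u v : enorm (u + v) <= enorm u + enorm v.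
Proof.
rewrite -ler_sqr ?nnegrE ?addr_ge0 ?enorm_ge0// enorm_sqD.
by have := dot_le_enorm u v; rewrite sqrrD; lra.
Qed.

Lemma ler_enormB u v : enorm (u - v) <= enorm u + enorm v.
Proof. by rewrite -(enormN v) ler_enormD. Qed.

End inner_algebra.

Section convexity.
Variables (R : realType) (E : lmodType R).
Implicit Types (D : set E) (h k : E -> R).

Lemma convex_setP D : convex_set D <->
  forall x y (t : R), D x -> D y -> 0 <= t <= 1 -> D (t *: x + (1 - t) *: y).
Proof.
split=> [cD x y t Dx Dy /andP[t0 t1]|cD x y t /set_mem Dx /set_mem Dy].
  by apply: set_mem; apply: (cD x y (Itv01 t0 t1)); exact: mem_set.
apply/mem_set/cD => //; apply/andP; split; [exact: ge0|exact: le1].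
Qed.

Lemma convex_functionP D h : convex_function D h <->
  forall x y (t : R), D x -> D y -> 0 <= t <= 1 ->
    h (t *: x + (1 - t) *: y) <= t * h x + (1 - t) * h y.
Proof.
split=> [cD x y t Dx Dy /andP[t0 t1]|cD t x y /set_mem Dx /set_mem Dy].
  by apply: (cD (Itv01 t0 t1)); exact: mem_set.
apply: cD => //; apply/andP; split; [exact: ge0|exact: le1].
Qed.

Lemma convex_functionD D h k : convex_function D h -> convex_function D k ->
  convex_function D (fun z => h z + k z).
Proof.
move=> /convex_functionP ch /convex_functionP ck.
apply/convex_functionP => x y t Dx Dy t01.
by have := ch _ _ _ Dx Dy t01; have := ck _ _ _ Dx Dy t01; lra.
Qed.

Lemma convex_function_sub D D' h : D `<=` D' -> convex_function D' h ->
  convex_function D h.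
Proof.
move=> DD' /convex_functionP ch; apply/convex_functionP => x y t Dx Dy t01.
by apply: ch => //; exact: DD'.
Qed.

Lemma convex_function_eq D h k : h =1 k -> convex_function D h ->
  convex_function D k.
Proof. by move=> /funext ->. Qed.

Lemma maxr0_conv (b t u v : R) : 0 <= b -> 0 <= t <= 1 ->
  b * Num.max (t * u + (1 - t) * v) 0 <=
  t * (b * Num.max u 0) + (1 - t) * (b * Num.max v 0).
Proof.
move=> b0 /andP[t0 t1]; rewrite !(mulrCA _ b) -mulrDr ler_wpM2l// ge_max.
apply/andP; split.
  by apply: lerD; rewrite ler_wpM2l ?subr_ge0// le_max lexx.
by apply: addr_ge0; apply: mulr_ge0; rewrite ?subr_ge0// le_max lexx orbT.
Qed.

Lemma convex_maxr0 D h (b : R) : 0 <= b -> convex_function D h ->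
  convex_function D (fun z => b * Num.max (h z) 0).
Proof.
move=> b0 /convex_functionP ch; apply/convex_functionP => x y t Dx Dy t01.
apply: le_trans (maxr0_conv _ _ b0 t01); rewrite ler_wpM2l// ge_max !le_max.
by rewrite ch// lexx orbT.
Qed.

End convexity.

Section subgradients.
Variables (R : realType) (E : innerType R).
Implicit Types (D U W : set E) (h : E -> R) (z v : E).

Lemma enorm_sq_conv (x y : E) (t : R) :
  enorm (t *: x + (1 - t) *: y) ^+ 2 =
  t * enorm x ^+ 2 + (1 - t) * enorm y ^+ 2 - t * (1 - t) * enorm (x - y) ^+ 2.
Proof. by rewrite !enorm_sq !dotE (dotC y x); ring. Qed.

Lemma convex_quad D (a : R) (z0 : E) : 0 <= a ->
  convex_function D (fun z => a * enorm (z - z0) ^+ 2).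
Proof.
move=> a0; apply/convex_functionP => x y t Dx Dy /andP[t0 t1].
have -> : t *: x + (1 - t) *: y - z0 = t *: (x - z0) + (1 - t) *: (y - z0).
  by rewrite !scalerBr addrACA -opprD -scalerDl subrKC scale1r.
rewrite enorm_sq_conv.
have : 0 <= a * (t * (1 - t) * enorm (x - z0 - (y - z0)) ^+ 2).
  by rewrite mulr_ge0// mulr_ge0 ?sqr_ge0// mulr_ge0// subr_ge0.
lra.
Qed.

Lemma convex_affine D (c : R) (v z0 : E) :
  convex_function D (fun z => c + dot v (z - z0)).
Proof.
by apply/convex_functionP => x y t Dx Dy _; rewrite !dotE; lra.
Qed.

Definition csub D h z v := forall w, D w -> h z + dot v (w - z) <= h w.

Definition sqhat (rho : R) h z := h z + rho / 2 * enorm z ^+ 2.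

Lemma weakly_convex_hat rho D h : weakly_convex rho D h ->
  convex_function D (sqhat rho h).
Proof. by case. Qed.

Lemma weakly_convexW rho rho' D h : rho <= rho' ->
  weakly_convex rho D h -> weakly_convex rho' D h.
Proof.
move=> rr [r0 ch]; split; first exact: le_trans rr.
have /convex_functionD : convex_function D (fun z => (rho' - rho) / 2 * enorm (z - 0) ^+ 2).
  by apply: convex_quad; lra.
move=> /(_ _ ch); apply: convex_function_eq => z /=; rewrite subr0; lra.
Qed.

(** Completing the square: the quadratic term and its linearization at [z] differ by rho / 2 |w -
    z|^2. Subgradients of [sqhat rho h] are thus those of [h] up to this defect, shifted by
    [rho *: z]. *)
Lemma csub_hatP rho D h z v : csub D (sqhat rho h) z (v + rho *: z) <->
  forall w, D w -> h z + dot v (w - z) - rho / 2 * enorm (w - z) ^+ 2 <= h w.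
Proof.
have E1 w : sqhat rho h z + dot (v + rho *: z) (w - z) - sqhat rho h w =
    h z + dot v (w - z) - rho / 2 * enorm (w - z) ^+ 2 - h w.
  by rewrite /sqhat enorm_sqB !enorm_sq !dotE (dotC w z); field.
by split=> H w Dw; have := H w Dw; have := E1 w; lra.
Qed.

(** By convexity along the segment from [z] to [w], a first-order estimate at one parameter [t]
    already gives the estimate at [w]. Here [t] may depend on the error [e], which then tends to
    0. *)
Lemma csub_segment D h z v : convex_set D -> convex_function D h -> D z ->
  (forall w, D w -> forall e : R, 0 < e -> exists2 t : R, 0 < t <= 1 &
     h z + t * dot v (w - z) - e * t <= h (z + t *: (w - z))) ->
  csub D h z v.
Proof.
move=> /convex_setP cD /convex_functionP ch Dz H w Dw.
apply/ler_addgt0Pr => e e0; have [t /andP[t0 t1] Ht] := H w Dw e e0.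
have t01 : 0 <= t <= 1 by rewrite t1 ltW.
have := ch _ _ _ Dw Dz t01.
have -> : t *: w + (1 - t) *: z = z + t *: (w - z).
  by rewrite scalerBl scalerBr scale1r addrCA.
move=> h1; rewrite -(ler_pM2l t0); lra.
Qed.

(** A quadratic defect is of second order along a segment, so convexity removes it. This is how
    proximal and weak convexity terms are taken out of subgradient inequalities. *)
Lemma csub_quad D h (rho : R) z v : convex_set D -> convex_function D h -> D z ->
  (forall w, D w -> h z + dot v (w - z) - rho * enorm (w - z) ^+ 2 <= h w) ->
  csub D h z v.
Proof.
move=> cD ch Dz H; apply: csub_segment => // w Dw e e0.
pose c := `|rho| * enorm (w - z) ^+ 2.
have c0 : 0 <= c by rewrite mulr_ge0 ?sqr_ge0.
have ce : 0 < e + c by rewrite ltr_pwDl.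
(* As [c] bounds the defect at [w], this parameter satisfies t <= 1 and t * c <= e. *)
exists (e / (e + c)).
  by rewrite divr_gt0//= ler_pdivrMr// mul1r lerDl.
set t := e / (e + c).
have t0 : 0 < t by rewrite divr_gt0.
have t1 : t <= 1 by rewrite ler_pdivrMr// mul1r lerDl.
have tc : t * c <= e.
  rewrite /t mulrAC ler_pdivrMr// ler_wpM2l ?(ltW e0)//; lra.
have Dt : D (z + t *: (w - z)).
  move/convex_setP: cD => /(_ w z t Dw Dz).
  rewrite scalerBl scale1r scalerBr addrCA; apply; rewrite t1 ltW//.
have := H _ Dt; have -> : z + t *: (w - z) - z = t *: (w - z) by rewrite addrC addKr.
rewrite dotZr enormZ exprMn (gtr0_norm t0).
have : rho * (t ^+ 2 * enorm (w - z) ^+ 2) <= t ^+ 2 * c.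
  rewrite mulrCA ler_wpM2l ?sqr_ge0// /c ler_wpM2r ?sqr_ge0// ler_norm//.
have : t ^+ 2 * c <= e * t by rewrite expr2 -mulrA mulrC ler_wpM2r// ltW.
lra.
Qed.

End subgradients.

(** * Finite-dimensional Euclidean spaces *)

(* What the argument uses of finite-dimensional Euclidean spaces; it is
   inherited by products. *)
Record euclidean (R : realType) (E : innerType R) : Prop := {
  norm_le_enorm : forall u : E, `|u| <= enorm u ;
  enorm_le_norm : exists2 C : R, 0 < C & forall u : E, enorm u <= C * `|u| ;
  cball_compact : forall M : R, compact [set u : E | `|u| <= M] ;
  riesz : forall f : E -> R, (forall u v, f (u + v) = f u + f v) ->
    (forall a u, f (a *: u) = a * f u) -> exists v, forall u, f u = dot v u ;
  finite_span : exists s : seq E, forall V : set E, V 0 ->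
    (forall u v, V u -> V v -> V (u + v)) -> (forall a u, V u -> V (a *: u)) ->
    (forall e, e \in s -> V e) -> forall u, V u }.

Lemma rV_normP (R : realType) n (u : 'rV[R]_n) (M : R) : 0 <= M ->
  `|u| <= M <-> forall i, `|u 0 i| <= M.
Proof.
move=> M0; have -> : `|u| = \big[Num.max/0]_ij `|u ij.1 ij.2| := mx_normrE u.
split=> [H i|H]; first by have /bigmax_leP[_ /(_ (0, i) isT)] := H.
by apply: bigmax_le => // -[i j] _ /=; rewrite (ord1 i).
Qed.

Lemma rV_euclidean (R : realType) n : euclidean ('rV[R]_n : innerType R).
Proof.
have coord_le (u : 'rV[R]_n) i : `|u 0 i| <= enorm u.
  rewrite -ler_sqr ?nnegrE ?enorm_ge0// -normrX ger0_norm ?sqr_ge0// enorm_sq.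
  rewrite /dot/= /dot_rV (bigD1 i)//= -expr2 lerDl.
  by apply: sumr_ge0 => j _; rewrite -expr2 sqr_ge0.
split.
- by move=> u; apply/rV_normP => //; exact: enorm_ge0.
- exists (n%:R + 1) => [|u]; first by rewrite ltr_wpDl.
  rewrite -ler_sqr ?nnegrE ?mulr_ge0 ?enorm_ge0 ?addr_ge0// enorm_sq.
  apply: (@le_trans _ _ (\sum_(i < n) `|u| ^+ 2)).
    apply: ler_sum => i _; rewrite -expr2 -[leLHS]ger0_norm ?sqr_ge0// normrX.
    by rewrite ler_sqr ?nnegrE//; move: i; apply/rV_normP.
  rewrite sumr_const card_ord -[leLHS]mulr_natl exprMn ler_wpM2r ?sqr_ge0//.
  by rewrite sqrrD expr1n; have : 0 <= n%:R :> R by []; nra.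
- move=> M; apply: bounded_closed_compact.
    exists M; split; first exact: num_real.
    by move=> x Mx u /= /le_trans; apply; exact: ltW.
  have -> : [set u : 'rV[R]_n | `|u| <= M] = Num.norm @^-1` [set x | x <= M] by [].
  by apply: closed_comp => [u _|]; [exact: norm_continuous|exact: closed_le].
- move=> f fD fZ; exists (\row_i f (delta_mx 0 i)) => u.
  have f0 : f 0 = 0 by rewrite -(scale0r 0) fZ mul0r.
  rewrite {1}(row_sum_delta u) (big_morph f fD f0).
  by apply: eq_bigr => i _; rewrite fZ mxE mulrC.
- exists [seq delta_mx 0 i | i <- enum 'I_n] => V V0 VD VZ Vs u.
  rewrite (row_sum_delta u); elim/big_ind: _ => // i _; apply: VZ; apply: Vs.
  by apply/mapP; exists i => //; rewrite mem_enum.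
Qed.

Lemma prod_euclidean (R : realType) (E F : innerType R) :
  euclidean E -> euclidean F -> euclidean ((E * F)%type : innerType R).
Proof.
move=> hE hF.
have E2 (u : E * F) : enorm u ^+ 2 = enorm u.1 ^+ 2 + enorm u.2 ^+ 2.
  by rewrite !enorm_sq.
split.
- move=> u; rewrite prod_normE ge_max; apply/andP; split.
    apply: le_trans (norm_le_enorm hE _) _.
    by rewrite -ler_sqr ?nnegrE ?enorm_ge0// E2 lerDl sqr_ge0.
  apply: le_trans (norm_le_enorm hF _) _.
  by rewrite -ler_sqr ?nnegrE ?enorm_ge0// E2 lerDr sqr_ge0.
- have [C C0 hC] := enorm_le_norm hE; have [C' C'0 hC'] := enorm_le_norm hF.
  exists (C + C') => [|u]; first by rewrite addr_gt0.
  apply: (@le_trans _ _ (enorm u.1 + enorm u.2)).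
    rewrite -ler_sqr ?nnegrE ?addr_ge0 ?enorm_ge0// E2 sqrrD.
    by have := mulr_ge0 (enorm_ge0 u.1) (enorm_ge0 u.2); lra.
  rewrite mulrDl; apply: lerD.
    by apply: le_trans (hC _) _; rewrite ler_pM2l// prod_normE le_max lexx.
  by apply: le_trans (hC' _) _; rewrite ler_pM2l// prod_normE le_max lexx orbT.
- move=> M; have := compact_setX (cball_compact hE (M := M)) (cball_compact hF (M := M)).
  congr compact; apply/seteqP; split=> u /=; rewrite prod_normE ge_max.
    by case=> -> ->.
  by case/andP.
- move=> f fD fZ.
  have [|a u|v1 h1] := riesz hE (f := fun x => f (x, 0)).
  + by move=> u v; rewrite -fD; congr f; congr (_, _); rewrite addr0.
  + by rewrite -fZ; congr f; congr (_, _); rewrite scaler0.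
  have [|a u|v2 h2] := riesz hF (f := fun x => f (0, x)).
  + by move=> u v; rewrite -fD; congr f; congr (_, _); rewrite addr0.
  + by rewrite -fZ; congr f; congr (_, _); rewrite scaler0.
  exists (v1, v2) => -[x y].
  rewrite /dot/= /dot_prod/= -h1 -h2 -fD; congr f.
  by congr (_, _); rewrite ?addr0 ?add0r.
- have [s hs] := finite_span hE; have [t ht] := finite_span hF.
  exists ([seq (x, 0) | x <- s] ++ [seq (0, y) | y <- t]) => V V0 VD VZ Vs [x y].
  have -> : (x, y) = (x, 0) + (0, y) :> E * F.
    by congr (_, _); rewrite ?addr0 ?add0r.
  apply: (VD).
    apply: (hs [set x | V (x, 0)]) => //=.
    + by move=> u v Vu Vv; have := VD _ _ Vu Vv; congr V; congr (_, _); rewrite addr0.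
    + by move=> a u /(VZ a); congr V; congr (_, _); rewrite scaler0.
    + by move=> e es; apply: Vs; rewrite mem_cat map_f.
  apply: (ht [set x | V (0, x)]) => //=.
  + by move=> u v Vu Vv; have := VD _ _ Vu Vv; congr V; congr (_, _); rewrite addr0.
  + by move=> a u /(VZ a); congr V; congr (_, _); rewrite scaler0.
  + by move=> e es; apply: Vs; rewrite mem_cat map_f// orbT.
Qed.

Lemma cvg_ler (T : Type) (G : set_system T) {GF : ProperFilter G} (R : realType)
    (f g : T -> R) (a b : R) : f @ G --> a -> g @ G --> b ->
  (\forall k \near G, f k <= g k) -> a <= b.
Proof.
move=> fa gb fg; rewrite -subr_ge0; apply: (cvgr_to_ge (cvgB gb fa)).
by apply: filterS fg => k; rewrite subr_ge0.
Qed.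

Section limits.
Variables (R : realType) (E : innerType R).
Hypothesis hE : euclidean E.

Lemma near_enorm (z : E) (e : R) : 0 < e -> \forall w \near z, enorm (w - z) < e.
Proof.
move=> e0; have [C C0 hC] := enorm_le_norm hE.
have eC : 0 < e / C by rewrite divr_gt0.
near=> w; apply: le_lt_trans (hC _) _.
rewrite mulrC -ltr_pdivlMr//; near: w.
Unshelve. all: by end_near. Qed.

Lemma near_segment (z d : E) (A : set E) : nbhs z A ->
  exists2 t : R, 0 < t <= 1 & A (z + t *: d).
Proof.
move=> /nbhs_normP[r /= r0 rA].
have d1 : 0 < 1 + `|d| by rewrite ltr_pwDl.
have [rd|rd] := leP r (1 + `|d|).
  exists (r / (2 * (1 + `|d|))).
    rewrite divr_gt0 ?mulr_gt0//= ler_pdivrMr ?mulr_gt0// mul1r; lra.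
  apply: rA => /=; rewrite opprD addrA subrr sub0r normrN normrZ ger0_norm.
    by rewrite mulrAC ltr_pdivrMr ?mulr_gt0// ltr_pM2l//; have := normr_ge0 d; lra.
  by rewrite divr_ge0 ?mulr_ge0// ltW.
exists 1; first by rewrite ltr01 lexx.
by apply: rA => /=; rewrite scale1r opprD addrA subrr sub0r normrN; lra.
Qed.

Section filter.
Variables (T : Type) (G : set_system T).
Context {GF : Filter G}.
Implicit Types u v : T -> E.

Lemma cvg_enorm_dist u ub : u @ G --> ub -> enorm (u k - ub) @[k --> G] --> (0 : R).
Proof.
move=> uub; apply/cvgr0Pnorm_lt => e e0.
have : \forall k \near G, enorm (u k - ub) < e := uub _ (near_enorm ub e0).
by apply: filterS => k /=; rewrite ger0_norm ?enorm_ge0.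
Qed.

Lemma enorm_dist_cvg u ub : enorm (u k - ub) @[k --> G] --> (0 : R) -> u @ G --> ub.
Proof.
move=> /cvgr0Pnorm_lt H; apply/cvgrPdist_lt => e e0.
have := H _ e0; apply: filterS => k; apply: le_lt_trans.
by rewrite ger0_norm ?enorm_ge0// -normrN opprB norm_le_enorm.
Qed.

Lemma cvg_dot u v ub vb : u @ G --> ub -> v @ G --> vb ->
  dot (u k) (v k) @[k --> G] --> dot ub vb.
Proof.
move=> uub vvb; apply/subr_cvg0.
have : enorm (u k - ub) * enorm (v k - vb) + enorm (u k - ub) * enorm vb
    + enorm ub * enorm (v k - vb) @[k --> G] --> 0 * 0 + 0 * enorm vb + enorm ub * 0.
  by apply: cvgD; [apply: cvgD|]; apply: cvgM; (exact: cvg_enorm_dist || exact: cvg_cst).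
rewrite !mul0r mulr0 !addr0 => H.
apply/cvgr0Pnorm_lt => e e0; move/cvgr0Pnorm_lt : H => /(_ _ e0).
apply: filterS => k; apply: le_lt_trans.
rewrite [leRHS]ger0_norm; last by rewrite !addr_ge0// mulr_ge0 ?enorm_ge0.
have -> : dot (u k) (v k) - dot ub vb =
  dot (u k - ub) (v k - vb) + dot (u k - ub) vb + dot ub (v k - vb).
  by rewrite !dotE; ring.
apply: le_trans (ler_normD _ _) _; apply: lerD; last exact: norm_dot_le.
by apply: le_trans (ler_normD _ _) _; apply: lerD; exact: norm_dot_le.
Qed.

Lemma cvg_enorm_sq u ub : u @ G --> ub ->
  enorm (u k) ^+ 2 @[k --> G] --> enorm ub ^+ 2.
Proof.
move=> uub; rewrite enorm_sq; under eq_fun do rewrite enorm_sq.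
exact: cvg_dot.
Qed.

Lemma cvg_enorm u ub : u @ G --> ub -> enorm (u k) @[k --> G] --> enorm ub.
Proof.
move=> uub.
apply: (@continuous_cvg _ _ _ _ _ (fun k => dot (u k) (u k)) Num.sqrt (dot ub ub)).
  exact: sqrt_continuous.
exact: cvg_dot.
Qed.

End filter.

Lemma fmap_ultra (T U : Type) (G : set_system T) (u : T -> U) :
  UltraFilter G -> UltraFilter (u @ G).
Proof.
move=> GU; split=> [|H PH GH]; first exact: fmap_proper_filter.
apply/seteqP; split=> // A HA /=.
have [//|nA] := in_ultra_setVsetC (u @^-1` A) GU.
by have /filter_ex [? []] : H (A `&` ~` A) by apply: filterI => //; exact: GH.
Qed.

Lemma ultra_cvg (T : Type) (G : set_system T) (u : T -> E) (B : R) :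
  UltraFilter G -> (\forall k \near G, enorm (u k) <= B) -> exists ub : E, u @ G --> ub.
Proof.
move=> GU uB; have := cball_compact hE (M := B); rewrite compact_ultra => /(_ (u @ G)).
case=> [||ub [_ ?]]; [exact: fmap_ultra| |by exists ub].
by apply: filterS uB => k; apply: le_trans; exact: norm_le_enorm.
Qed.

Lemma ultra_cvgR (T : Type) (G : set_system T) (u : T -> R) (B : R) :
  UltraFilter G -> (\forall k \near G, `|u k| <= B) -> exists ub : R, u @ G --> ub.
Proof.
move=> GU uB; have := @segment_compact R (- B) B; rewrite compact_ultra => /(_ (u @ G)).
case=> [||ub [_ ?]]; [exact: fmap_ultra| |by exists ub].
by apply: filterS uB => k; rewrite /= in_itv/= ler_norml.
Qed.

End limits.

Section frechet.
Variables (R : realType) (E : innerType R).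
Implicit Types (D U W : set E) (h : E -> R) (z v : E).

Lemma rsubdiff_nbhs h z v (e : R) : rsubdiff h z v -> 0 < e ->
  \forall w \near z, h z + dot v (w - z) - e * enorm (w - z) <= h w.
Proof.
move=> [_ H] e0; have := H _ e0; apply: filterS => w /=.
by rewrite -EFinD lee_fin addrA.
Qed.

(** The local inequality is tested only on segments inside [D], so [z] may lie on the boundary of
    [D]. This matters for [Dset] and for O x Y, where the points (x, yt) may be boundary points. *)
Lemma rsubdiff_csub (rho : R) D h z v : convex_set D -> weakly_convex rho D h ->
  D z -> rsubdiff h z v -> csub D (sqhat rho h) z (v + rho *: z).
Proof.
move=> cD wh Dz hv; apply: csub_segment => // [|w Dw e e0].
  exact: weakly_convex_hat.
set d := w - z.
pose e' := e / (1 + enorm d).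
have d0 : 0 < 1 + enorm d by rewrite ltr_pwDl ?enorm_ge0.
have e'0 : 0 < e' by rewrite divr_gt0.
have [t /andP[t0 t1] Ht] := near_segment d (rsubdiff_nbhs hv e'0).
exists t; first by rewrite t0.
move: Ht; have -> : z + t *: d - z = t *: d by rewrite addrC addKr.
rewrite dotZr enormZ gtr0_norm// => Ht.
have [r0 _] := wh.
have : e' * enorm d <= e.
  rewrite /e' mulrAC ler_pdivrMr// ler_wpM2l ?(ltW e0)//; lra.
move=> /(ler_wpM2l (ltW t0)) He.
rewrite /sqhat enorm_sqD dotZr dotDl dotZl enormZ exprMn.
have : 0 <= rho / 2 * (`|t| ^+ 2 * enorm d ^+ 2).
  by apply: mulr_ge0; [lra|rewrite mulr_ge0 ?sqr_ge0].
lra.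
Qed.

Lemma csub_rsubdiff (rho : R) D h z v : euclidean E -> nbhs z D ->
  csub D (sqhat rho h) z (v + rho *: z) -> rsubdiff h z v.
Proof.
move=> hE zD /csub_hatP H; split=> // e e0.
have r0 : 0 < 1 + `|rho| by rewrite ltr_pwDl.
near=> w; rewrite /= -EFinD lee_fin.
have Dw : D w by near: w.
have := H w Dw; suff : rho / 2 * enorm (w - z) ^+ 2 <= e * enorm (w - z) by lra.
rewrite expr2 mulrA ler_wpM2r ?enorm_ge0//.
have : enorm (w - z) < e / (1 + `|rho|) by near: w; apply: near_enorm; rewrite ?divr_gt0.
rewrite ltr_pdivlMr// => /ltW; apply: le_trans.
rewrite mulrC ler_wpM2l ?enorm_ge0//; have := ler_norm rho; have := normr_ge0 rho; lra.
Unshelve. all: by end_near. Qed.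

Lemma normal_coneP D z v : convex_set D -> D z ->
  normal_cone D z v <-> forall w, D w -> dot v (w - z) <= 0.
Proof.
move=> cD Dz; split=> [[_ H] w Dw|H]; last first.
  split; first by rewrite /set_indic; case: asboolP.
  move=> e e0; near=> w; rewrite /set_indic.
  case: (asboolP (D z)) => // _; case: asboolP => Dw; last by rewrite leey.
  rewrite add0e lee_fin; have := H _ Dw.
  by have := mulr_ge0 (ltW e0) (enorm_ge0 (w - z)); lra.
apply/ler_addgt0Pr => e e0; rewrite add0r.
pose e' := e / (1 + enorm (w - z)).
have d0 : 0 < 1 + enorm (w - z) by rewrite ltr_pwDl ?enorm_ge0.
have e'0 : 0 < e' by rewrite divr_gt0.
have [t /andP[t0 t1]] := near_segment (w - z) (H _ e'0).
have Dt : D (z + t *: (w - z)).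
  move/convex_setP: cD => /(_ w z t Dw Dz).
  rewrite scalerBl scale1r scalerBr addrCA; apply; rewrite t1 ltW//.
rewrite /set_indic; case: asboolP => // _; case: asboolP => // _.
rewrite add0e lee_fin; have -> : z + t *: (w - z) - z = t *: (w - z) by rewrite addrC addKr.
rewrite dotZr enormZ gtr0_norm// mulrCA -mulrBr pmulr_rle0// subr_le0 => /le_trans; apply.
by rewrite /e' mulrAC ler_pdivrMr// ler_wpM2l ?(ltW e0)//; lra.
Unshelve. all: by end_near. Qed.

End frechet.

Section subgradient_limits.
Variables (R : realType) (E : innerType R).
Hypothesis hE : euclidean E.
Variables (T : Type) (G : set_system T).
Hypothesis GU : UltraFilter G.
Implicit Types (D : set E) (h : E -> R) (z zeta : T -> E).

(* Test points in the direction of a limit of zeta / (1 + |zeta|) show that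
   subgradients of a function bounded below along z stay bounded. *)
Lemma csub_bounded D h z zeta (zb : E) (c : R) : nbhs zb D -> z @ G --> zb ->
  (\forall k \near G, csub D h (z k) (zeta k)) ->
  (\forall k \near G, c <= h (z k)) ->
  exists zetab : E, zeta @ G --> zetab.
Proof.
move=> Dzb zzb hz hc.
suff [B HB] : exists B : R, \forall k \near G, enorm (zeta k) <= B.
  exact: ultra_cvg HB.
apply: contrapT => nB.
(* An ultrafilter decides every set of indices: a norm with no eventual bound tends to infinity
   along it. *)
have big (B : R) : \forall k \near G, B < enorm (zeta k).
  have [gB|] := in_ultra_setVsetC [set k | enorm (zeta k) <= B] GU.
    by exfalso; apply: nB; exists B.
  by apply: filterS => k /= /negP; rewrite -ltNge.
pose s k := (1 + enorm (zeta k))^-1.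
have s0 k : 0 < s k by rewrite invr_gt0 ltr_pwDl ?enorm_ge0.
have scvg : s @ G --> (0 : R).
  apply/cvgr0Pnorm_lt => e e0; have := big e^-1; apply: filterS => k He.
  rewrite gtr0_norm// /s -[ltRHS]invrK ltf_pV2 ?posrE ?invr_gt0//; last first.
    by rewrite ltr_pwDl ?enorm_ge0.
  by apply: lt_trans He _; rewrite ltrDr.
pose u k := s k *: zeta k.
have un k : enorm (u k) = 1 - s k.
  rewrite enormZ gtr0_norm// /s; field.
  by rewrite gt_eqF// ltr_pwDl ?enorm_ge0.
have [ub uub] : exists ub : E, u @ G --> ub.
  apply: (ultra_cvg hE (B := 1)) => //; near=> k; rewrite un.
  by have := s0 k; lra.
have ub1 : enorm ub ^+ 2 = 1.
  have : enorm (u k) ^+ 2 @[k --> G] --> ((1 - 0) * (1 - 0) : R).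
    under eq_fun do rewrite un expr2.
    by apply: cvgM; apply: cvgB => //; exact: cvg_cst.
  rewrite subr0 mulr1.
  by apply: cvg_unique => //; exact: cvg_enorm_sq.
have [t /andP[t0 t1] Dt] := near_segment ub Dzb.
have H1 : dot (u k) (zb + t *: ub - z k) @[k --> G] --> dot ub (t *: ub).
  have E1 : zb + t *: ub - zb = t *: ub by rewrite addrC addKr.
  rewrite -[X in _ --> dot ub X]E1.
  by apply: cvg_dot => //; exact: (cvgB (cvg_cst _) zzb).
pose M := h (zb + t *: ub) - c.
have H2 : s k * M @[k --> G] --> 0 * M by apply: cvgM => //; exact: cvg_cst.
(* The inequality tested at the fixed point zb + t ub and multiplied by [s k] has a right-hand side
   tending to 0, while the left-hand side tends to t |ub|^2 = t > 0. *)
have : dot ub (t *: ub) <= 0 * M.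
  apply: (cvg_ler H1 H2); near=> k.
  rewrite dotZl ler_wpM2l ?(ltW (s0 k))// /M.
  have hk : csub D h (z k) (zeta k) by near: k.
  have ck : c <= h (z k) by near: k.
  have := hk _ Dt; lra.
by rewrite dotZr -enorm_sq ub1; lra.
Unshelve. all: by end_near. Qed.

Lemma csub_limit D h z zeta (zb zetab : E) (c : R) : z @ G --> zb -> zeta @ G --> zetab ->
  h (z k) @[k --> G] --> c -> (\forall k \near G, csub D h (z k) (zeta k)) ->
  forall w, D w -> c + dot zetab (w - zb) <= h w.
Proof.
move=> zzb zz hc hz w Dw.
have H : h (z k) + dot (zeta k) (w - z k) @[k --> G] --> c + dot zetab (w - zb).
  apply: cvgD => //; by apply: cvg_dot => //; exact: (cvgB (cvg_cst _) zzb).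
apply: (cvg_ler H (cvg_cst (h w))); near=> k.
have hk : csub D h (z k) (zeta k) by near: k.
exact: hk.
Unshelve. all: by end_near. Qed.

Lemma csub_cvg D h z zeta (zb : E) : nbhs zb D -> z @ G --> zb ->
  h (z k) @[k --> G] --> h zb -> (\forall k \near G, csub D h (z k) (zeta k)) ->
  exists zetab : E, zeta @ G --> zetab /\ csub D h zb zetab.
Proof.
move=> Dzb zzb hzb hz.
have hlow : \forall k \near G, h zb - 1 <= h (z k).
  move/cvgrPdist_lt : hzb => /(_ _ ltr01); apply: filterS => k.
  by rewrite ltr_norml => /andP[_]; lra.
have [zetab zz] := csub_bounded Dzb zzb hz hlow.
by exists zetab; split=> //; exact: csub_limit zzb zz hzb hz.
Qed.

(** The subgradient at [zb] bounds h (z k) from below; the subgradients at [z k], bounded by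
    [csub_bounded], bound it from above. It gives the continuity of v_gamma along the iterates. *)
Lemma csub_continuous D h z zeta (zb zetab : E) : nbhs zb D -> z @ G --> zb ->
  csub D h zb zetab -> (\forall k \near G, D (z k) /\ csub D h (z k) (zeta k)) ->
  h (z k) @[k --> G] --> h zb.
Proof.
move=> Dzb zzb hzb hz.
have c1 : h zb + dot zetab (z k - zb) @[k --> G] --> h zb + dot zetab (zb - zb).
  apply: cvgD; first exact: cvg_cst.
  by apply: cvg_dot => //; [exact: cvg_cst|exact: (cvgB zzb (cvg_cst _))].
rewrite subrr dot0r addr0 in c1.
have hz' : \forall k \near G, csub D h (z k) (zeta k) by apply: filterS hz => k [].
have hlow : \forall k \near G, h zb - 1 <= h (z k).
  move/cvgrPdist_lt : c1 => /(_ _ ltr01); apply: filterS2 hz => k [Dk _].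
  by rewrite ltr_norml => /andP[_]; have := hzb _ Dk; lra.
have [zeta' zz] := csub_bounded Dzb zzb hz' hlow.
have c2 : h zb - dot (zeta k) (zb - z k) @[k --> G] --> h zb - dot zeta' (zb - zb).
  apply: cvgB; first exact: cvg_cst.
  by apply: cvg_dot => //; exact: (cvgB (cvg_cst _) zzb).
rewrite subrr dot0r subr0 in c2.
apply: (squeeze_cvgr _ c1 c2); apply: filterS hz => k [Dk hk].
by rewrite (hzb _ Dk)/=; have := hk _ (nbhs_singleton Dzb); lra.
Qed.

End subgradient_limits.

(** * Separation and the max rule *)

Section hahn_banach.
Variables (R : realType) (E : innerType R).
Implicit Types (p : E -> R) (S : E -> set R).

Definition sublinear p := [/\ p 0 = 0, (forall u v, p (u + v) <= p u + p v) &
  forall a u, 0 < a -> p (a *: u) <= a * p u].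

(** The infimum over [S d] is finite: the sum of an element of [S d] and one of [S (- d)] dominates
    an element of [S 0], which is nonnegative. *)
Lemma inf_sublinear S : (forall d, S d !=set0) -> S 0 0 ->
  (forall c, S 0 c -> 0 <= c) ->
  (forall d d' c c', S d c -> S d' c' -> exists2 c'', S (d + d') c'' & c'' <= c + c') ->
  (forall a d c, 0 < a -> S d c -> S (a *: d) (a * c)) ->
  (forall d c, S d c -> inf (S d) <= c) /\ sublinear (fun d => inf (S d)).
Proof.
move=> Sne S0 S0_ge0 SD SZ.
have Slb d : has_lbound (S d).
  have [c' Sc'] := Sne (- d); exists (- c') => c Sc.
  have [c''] := SD _ _ _ _ Sc Sc'; rewrite subrr => /S0_ge0; lra.
have Sinf d c : S d c -> inf (S d) <= c by move=> Sc; apply: ge_inf.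
split=> //; split.
- apply/eqP; rewrite eq_le Sinf//=; apply: lb_le_inf => // c; exact: S0_ge0.
- move=> u v /=; rewrite -lerBlDr; apply: lb_le_inf => // c Sc.
  rewrite lerBlDr -lerBlDl; apply: lb_le_inf => // c' Sc'.
  have [c'' Sc'' c''le] := SD _ _ _ _ Sc Sc'.
  by have := Sinf _ _ Sc''; lra.
- move=> a u a0 /=; rewrite mulrC -ler_pdivrMr//; apply: lb_le_inf => // c Sc.
  by rewrite ler_pdivrMr// mulrC; apply: Sinf; exact: SZ.
Qed.

(** One step of Hahn-Banach: taking the infimum over t >= 0 of p (d + t e) - t p e lowers [p] just
    enough to make it odd at [e]. *)
Lemma sublinear_odd_at p (e : E) : sublinear p -> exists2 p',
  sublinear p' & (forall u, p' u <= p u) /\ p' (- e) <= - p e.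
Proof.
move=> [p0 pD pZ].
have pZ' a u : 0 < a -> a * p u <= p (a *: u).
  move=> a0; have ai : 0 < a^-1 by rewrite invr_gt0.
  have := pZ _ (a *: u) ai; rewrite scalerA mulVf ?gt_eqF// scale1r.
  by rewrite mulrC ler_pdivlMr// mulrC.
pose S d := [set c | exists2 t, 0 <= t & c = p (d + t *: e) - t * p e].
have [|||||Sinf Ssub] := @inf_sublinear S.
- by move=> d; exists (p (d + 0 *: e) - 0 * p e); exists 0.
- by exists 0 => //; rewrite scale0r addr0 p0; ring.
- move=> c [t]; rewrite le_eqVlt => /orP[/eqP <-|t0] ->.
    by rewrite scale0r addr0 p0; lra.
  by rewrite add0r subr_ge0 pZ'.
- move=> d d' c c' [t t0 ->] [t' t'0 ->].
  exists (p (d + d' + (t + t') *: e) - (t + t') * p e).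
    by exists (t + t') => //; exact: addr_ge0.
  by rewrite scalerDl addrACA; have := pD (d + t *: e) (d' + t' *: e); lra.
- move=> a d c a0 [t t0 ->]; exists (a * t); first by rewrite mulr_ge0// ltW.
  have -> : a *: d + (a * t) *: e = a *: (d + t *: e) by rewrite scalerDr scalerA.
  by have := pZ' _ (d + t *: e) a0; have := pZ _ (d + t *: e) a0; lra.
exists (fun d => inf (S d)) => //; split.
  by move=> u; apply: Sinf; exists 0 => //; rewrite scale0r addr0; ring.
by apply: Sinf; exists 1 => //; rewrite scale1r addNr p0; ring.
Qed.

(** A finite spanning list replaces Zorn's lemma. Lowering the functional at a new vector keeps
    oddness at the earlier ones, oddness extends to the span by sublinearity, and an odd sublinear
    functional is linear. *)
Lemma hahn_banach p : euclidean E -> sublinear p ->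
  exists v, forall u, dot v u <= p u.
Proof.
move=> hE sp; have [s hs] := finite_span hE.
have [p' [p'0 p'D p'Z] [p'p p'N]] : exists2 p', sublinear p' &
    (forall u, p' u <= p u) /\ (forall e, e \in s -> p' (- e) <= - p' e).
  elim: s {hs} => [|e s [p1 sp1 [p1p p1N]]]; first by exists p.
  have [p2 sp2 [p21 p2N]] := sublinear_odd_at e sp1.
  exists p2 => //; split=> [u|e']; first exact: le_trans (p21 _) (p1p _).
  rewrite inE => /orP[/eqP ->|/p1N H]; first by have := p21 e; lra.
  by have := p21 e'; have := p21 (- e'); lra.
have odd : forall u, p' (- u) <= - p' u.
  apply: hs => [|u v hu hv|a u hu|//]; first by rewrite oppr0 p'0 oppr0.
    by rewrite opprD; have := p'D (- u) (- v); have := p'D u v; lra.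
  have [a0|a0|->] := ltgtP a 0.
  - rewrite -oppr_gt0 in a0.
    have := p'Z _ u a0; have := p'Z _ (- u) a0.
    rewrite scaleNr scalerN scaleNr opprK.
    have : - a * p' (- u) <= - a * - p' u by rewrite ler_wpM2l// ltW.
    lra.
  - have := p'Z _ u a0; have := p'Z _ (- u) a0.
    rewrite scalerN.
    have : a * p' (- u) <= a * - p' u by rewrite ler_wpM2l// ltW.
    lra.
  - by rewrite scale0r oppr0 p'0 oppr0.
have p'Neq u : p' (- u) = - p' u.
  apply/eqP; rewrite eq_le odd/=.
  by have := p'D u (- u); rewrite subrr p'0; lra.
have [||v hv] := @riesz _ _ hE p'.
- move=> u v; apply/eqP; rewrite eq_le p'D/=.
  by have := p'D (- u) (- v); rewrite -opprD !p'Neq; lra.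
- have pos a u : 0 < a -> p' (a *: u) = a * p' u.
    move=> a0; apply/eqP; rewrite eq_le p'Z//=.
    by have := p'Z _ (- u) a0; rewrite scalerN !p'Neq; lra.
  move=> a u; have [a0|a0|->] := ltgtP a 0; last by rewrite scale0r p'0 mul0r.
    by rewrite -[a]opprK scaleNr p'Neq pos ?oppr_gt0//; ring.
  exact: pos.
by exists v => u; rewrite -hv.
Qed.

End hahn_banach.

Section sandwich.
Variables (R : realType) (E : innerType R).
Hypothesis hE : euclidean E.
Implicit Types (U W : set E) (A B r : E -> R) (z v : E).

(** Subadditivity of the perspective of [h], with the weights kept explicit. *)
Lemma convex_combine U h z z' (t t' : R) : convex_set U -> convex_function U h ->
  U z -> U z' -> 0 < t -> 0 < t' ->
  let z'' := (t + t')^-1 *: (t *: z + t' *: z') in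
  U z'' /\ (t + t') * h z'' <= t * h z + t' * h z'.
Proof.
move=> /convex_setP cU /convex_functionP ch Uz Uz' t0 t'0 /=.
have T0 : 0 < t + t' by rewrite addr_gt0.
pose s := t / (t + t').
have s01 : 0 <= s <= 1.
  by rewrite /s divr_ge0 ?(ltW t0) ?(ltW T0)//= ler_pdivrMr// mul1r; lra.
have -> : (t + t')^-1 *: (t *: z + t' *: z') = s *: z + (1 - s) *: z'.
  rewrite scalerDr !scalerA /s; congr (_ *: _ + _ *: _); first exact: mulrC.
  by field; rewrite gt_eqF.
split; first exact: cU.
have := ch _ _ _ Uz Uz' s01; rewrite -(ler_pM2l T0).
suff -> : (t + t') * (s * h z + (1 - s) * h z') = t * h z + t' * h z' by [].
by rewrite /s; field; rewrite gt_eqF.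
Qed.

(* The subadditive function
   d |-> inf { t * (A z1 - A z + (r z2 - r z)) | d = t *: (z1 - z2), t > 0 }
   is finite because it is nonnegative at 0, by minimality of z. *)
Lemma sandwich U W A r z : convex_set U -> convex_set W ->
  convex_function U A -> convex_function W r -> nbhs z U -> W z ->
  (forall w, U w -> W w -> A z + r z <= A w + r w) ->
  exists v, csub U A z v /\ csub W r z (- v).
Proof.
move=> cU cW cA cr zU Wz Hmin.
have Uz : U z := nbhs_singleton zU.
pose S d := [set c | exists (t : R) z1 z2, [/\ 0 < t, U z1, W z2,
   d = t *: (z1 - z2) & c = t * (A z1 - A z + (r z2 - r z))]].
have [|||||Sinf Ssub] := @inf_sublinear R E S.
- move=> d; have [t /andP[t0 _] Ut] := near_segment d zU.
  exists (t^-1 * (A (z + t *: d) - A z + (r z - r z))), t^-1, (z + t *: d), z.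
  split=> //; first by rewrite invr_gt0.
  by rewrite [z + _]addrC addrK scalerA mulVf ?gt_eqF// scale1r.
- by exists 1, z, z; split=> //; [rewrite subrr scaler0|ring].
- move=> c [t [z1 [z2 [t0 Uz1 Wz2 /eqP]]]].
  rewrite eq_sym scaler_eq0 gt_eqF//= subr_eq0 => /eqP z12 ->.
  rewrite mulr_ge0 ?(ltW t0)//; have := Hmin z1 Uz1; rewrite z12 => /(_ Wz2); lra.
- move=> d d' c c' [t [z1 [z2 [t0 Uz1 Wz2 -> ->]]]].
  move=> [t' [z1' [z2' [t'0 Uz1' Wz2' -> ->]]]].
  have T0 : 0 < t + t' by rewrite addr_gt0.
  have [U3 A3] := convex_combine cU cA Uz1 Uz1' t0 t'0.
  have [W3 r3] := convex_combine cW cr Wz2 Wz2' t0 t'0.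
  set z3 := (t + t')^-1 *: (t *: z1 + _) in U3 A3.
  set z4 := (t + t')^-1 *: (t *: z2 + _) in W3 r3.
  exists ((t + t') * (A z3 - A z + (r z4 - r z))); last by lra.
  exists (t + t'), z3, z4; split=> //.
  rewrite /z3 /z4 -scalerBr scalerA mulfV ?gt_eqF// scale1r.
  by rewrite !scalerBr opprD addrACA.
- move=> a d c a0 [t [z1 [z2 [t0 Uz1 Wz2 -> ->]]]].
  by exists (a * t), z1, z2; split; rewrite ?mulr_gt0// ?scalerA ?mulrA.
have [v hv] := hahn_banach hE Ssub.
exists v; split=> w Dw.
  have : S (w - z) (A w - A z).
    by exists 1, w, z; split=> //; [rewrite scale1r|ring].
  by move=> /Sinf; have := hv (w - z); lra.
have : S (z - w) (r w - r z).
  by exists 1, z, w; split=> //; [rewrite scale1r|ring].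
by move=> /Sinf; have := hv (z - w); rewrite dotNl -dotNr opprB; lra.
Qed.

(** Separation from the zero function on the singleton of [z], where minimality is trivial. *)
Lemma csub_ex U A z : convex_set U -> convex_function U A -> nbhs z U ->
  exists v, csub U A z v.
Proof.
move=> cU cA zU.
have c1 : convex_set [set z].
  by apply/convex_setP => x y t -> -> _; rewrite /= -scalerDl subrKC scale1r.
have [|//|//|_ _ ->//|v [hv _]] := @sandwich U [set z] A (fun=> 0) z cU c1 cA.
  by apply/convex_functionP => x y t _ _ _; lra.
by exists v.
Qed.

End sandwich.

Section max_rule.
Variables (R : realType) (E : innerType R).
Hypothesis hE : euclidean E.
Implicit Types (U : set E) (A B : E -> R) (z a : E).

(** The subdifferential of b max(., 0) at [s]: for b >= 0 it is {0}, [0, b] or {b} according to the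
    sign of [s]. *)
Definition maxsub (b s lam : R) :=
  forall s', b * Num.max s 0 + lam * (s' - s) <= b * Num.max s' 0.

Lemma maxsub_range b s lam : 0 <= b -> maxsub b s lam -> 0 <= lam <= b.
Proof.
move=> b0 H; have := H (s - 1); have := H (s + 1).
have /(ler_wpM2l b0) : Num.max (s + 1) 0 <= Num.max s 0 + 1.
  by rewrite ge_max; case: (leP s 0) => h; apply/andP; lra.
have /(ler_wpM2l b0) : Num.max (s - 1) 0 <= Num.max s 0.
  by rewrite ge_max; case: (leP s 0) => h; apply/andP; lra.
by move=> *; apply/andP; lra.
Qed.

Lemma maxsub_pos b s lam : 0 <= b -> 0 < s -> maxsub b s lam -> lam = b.
Proof.
move=> b0 s0 H; have /andP[_ lb] := maxsub_range b0 H.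
apply/eqP; rewrite eq_le lb/= -(ler_pM2r s0).
by have := H 0; rewrite maxxx (max_idPl (ltW s0)); lra.
Qed.

Local Notation F := (E * 'rV[R]_1)%type.

(* Apply sandwich on E x R to (w, s) |-> A w + b * max s 0 - <a, w> and the
   indicator of the epigraph of B. *)
Lemma csub_max_rule U A B (b : R) z a : convex_set U -> nbhs z U -> 0 <= b ->
  convex_function U A -> convex_function U B ->
  csub U (fun w => A w + b * Num.max (B w) 0) z a ->
  exists p q lam, [/\ csub U A z p, csub U B z q, maxsub b (B z) lam &
    a = p + lam *: q].
Proof.
move=> cU zU b0 cA cB Ha.
have Uz := nbhs_singleton zU.
have hF : euclidean (F : innerType R) by exact: prod_euclidean hE (rV_euclidean _ _).
pose A' (u : F) := A u.1 + b * Num.max (u.2 0 0) 0 - dot a u.1.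
pose U' : set F := [set u : F | U u.1].
pose W' : set F := [set u : F | U u.1 /\ B u.1 <= u.2 0 0].
pose z' : F := (z, const_mx (B z)).
have dotF (u v : F) : dot u v = dot u.1 v.1 + u.2 0 0 * v.2 0 0.
  by rewrite /dot/= /dot_prod {2}/dot/= /dot_rV big_ord1.
have [||||||w Uw [_ Bw]|v [hA hW]] := @sandwich R F hF U' W' A' (fun=> 0) z'.
- apply/convex_setP => x y t Ux Uy t01; rewrite /U' /=.
  by move/convex_setP : cU; exact.
- apply/convex_setP => x y t [Ux Bx] [Uy By] t01; split; rewrite /=.
    by move/convex_setP : cU; exact.
  move/convex_functionP : cB => /(_ _ _ _ Ux Uy t01) /le_trans; apply.
  have /andP[t0 t1] := t01.
  by rewrite !mxE; apply: lerD; rewrite ler_wpM2l ?subr_ge0.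
- apply/convex_functionP => x y t Ux Uy t01; rewrite /A' /=.
  move/convex_functionP : cA => /(_ _ _ _ Ux Uy t01).
  have := maxr0_conv (x.2 0 0) (y.2 0 0) b0 t01.
  rewrite !mxE !dotE; lra.
- by apply/convex_functionP => x y t _ _ _; lra.
- by exists (U, setT); [split=> //; exact: filterT|case=> ? ? []].
- by rewrite /W' /= mxE.
- have := Ha _ Uw; rewrite /A' /= mxE dotDr dotNr.
  have : b * Num.max (B w.1) 0 <= b * Num.max (w.2 0 0) 0.
    by rewrite ler_wpM2l// ge_max !le_max Bw lexx orbT.
  lra.
pose lam := v.2 0 0.
have hp : csub U A z (a + v.1).
  move=> w Uw; have := hA (w, const_mx (B z)) Uw.
  rewrite dotF /A' /= !mxE !dotE; lra.
have hlam : maxsub b (B z) lam.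
  move=> s; have := hA (z, const_mx s) Uz.
  rewrite dotF /A' /= !mxE subrr dot0r /lam; lra.
have hq w : U w -> dot (- v.1) (w - z) <= lam * (B w - B z).
  move=> Uw; have : W' (w, const_mx (B w)) by rewrite /W' /= mxE.
  by move=> /hW; rewrite dotF /= !mxE /lam; lra.
have /andP[lam0 _] := maxsub_range b0 hlam.
(* If lam = 0 there is no dividing by it, but then <- v.1, w - z> <= 0 on a neighborhood of [z]
   forces v.1 = 0, and any subgradient of [B] serves as [q]. *)
move: lam0; rewrite le_eqVlt => /orP[/eqP lam0|lam0].
  have [q qs] := csub_ex hE cU cB zU.
  exists (a + v.1), q, lam; split=> //.
  have [t /andP[t0 _] Ut] := near_segment (- v.1) zU.
  have := hq _ Ut; rewrite -lam0 mul0r [z + _]addrC addrK dotZr pmulr_rle0//.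
  have [->|] := eqVneq v.1 0; first by rewrite scale0r !addr0.
  by rewrite -oppr_eq0 => /dot_gt0 /lt_le_trans /[apply]; rewrite ltxx.
exists (a + v.1), (lam^-1 *: (- v.1)), lam; split=> //.
  move=> w Uw; rewrite dotZl -lerBrDl mulrC ler_pdivrMr// mulrC; exact: hq.
by rewrite scalerA mulfV ?gt_eqF// scale1r addrK.
Qed.

End max_rule.

(** * Ultrafilters and real sequences *)

Section ultrafilters.

Lemma ultra_cluster (T : topologicalType) (z : nat -> T) (zb : T) :
  cluster (z @ \oo) zb -> exists G : set_system nat,
    [/\ UltraFilter G, \oo `<=` G & z @ G --> zb].
Proof.
move=> zcl.
(* Generated by the tails and the index sets {k | N (z k)}, for N a neighborhood of [zb]; it is
   proper because [zb] is a cluster point. *)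
pose F : set_system nat :=
  [set A | exists2 N, nbhs zb N & \forall k \near \oo, N (z k) -> A k].
have FF : ProperFilter F.
  apply: Build_ProperFilter_ex => [A [N Nzb NA]|].
    have zA : (z @ \oo) (z @` [set k | N (z k) -> A k]).
      by apply: filterS NA => k hk; exists k.
    by have [_ [[k NAk <-] Nk]] := zcl _ _ zA Nzb; exists k; exact: NAk.
  split.
  - by exists setT; [exact: filterT|near=> k].
  - move=> A B [N Nzb NA] [M Mzb MB]; exists (N `&` M); first exact: filterI.
    by apply: filterS2 NA MB => k hA hB [/hA ? /hB ?].
  - move=> A B AB [N Nzb NA]; exists N => //.
    by apply: filterS NA => k hA /hA /AB.
have [G [GU FG]] := ultraFilterLemma FF.
exists G; split=> //.
  by move=> A oA; apply: FG; exists setT; [exact: filterT|apply: filterS oA].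
by move=> A Azb; apply: FG; exists A => //; near=> k.
Unshelve. all: by end_near. Qed.

Lemma cluster_ultra (T : topologicalType) (z : nat -> T) (zb : T) G :
  UltraFilter G -> \oo `<=` G -> z @ G --> zb -> cluster (z @ \oo) zb.
Proof.
move=> GU oG zzb A B oA Bzb.
have [k [? ?]] := filter_ex (filterI (oG _ oA) (zzb _ Bzb)).
by exists k.
Qed.

Lemma ultra_frequently (K : set nat) : (forall N, exists2 k, (N <= k)%N & K k) ->
  exists G : set_system nat, [/\ UltraFilter G, \oo `<=` G & G K].
Proof.
move=> Kinf.
have FF : ProperFilter (within K \oo).
  apply: Build_ProperFilter_ex => A [N _ NA].
  by have [k Nk Kk] := Kinf N; exists k; exact: NA.
have [G [GU FG]] := ultraFilterLemma FF.
exists G; split=> // [A oA|]; apply: FG; last exact: withinT.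
by apply: filterS oA.
Qed.

(** If nat were not in the ideal, the complements of its members would form a proper filter, and an
    ultrafilter above it could contain no member. This plays the part of a finite subcover
    argument. *)
Lemma ultra_ideal (P : set (set nat)) :
  (forall A B, A `<=` B -> P B -> P A) -> (forall A B, P A -> P B -> P (A `|` B)) ->
  (forall N, P [set k | (k < N)%N]) ->
  (forall G, UltraFilter G -> \oo `<=` G -> exists2 A, G A & P A) -> P setT.
Proof.
move=> Psub PU Pfin PG; apply: contrapT => nP.
pose F : set_system nat := [set A | P (~` A)].
have FF : ProperFilter F.
  apply: Build_ProperFilter_ex => [A FA|].
    apply: contrapT => /forallNP A0; apply: nP; apply: Psub FA => k _; exact: A0.
  split; first by rewrite /F /= setCT; apply: Psub (Pfin 0%N).
  - by move=> A B; rewrite /F /= setCI; exact: PU.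
  - by move=> A B AB; apply: Psub; exact: subsetC.
have [G [GU FG]] := ultraFilterLemma FF.
have [|A GA PA] := PG G GU.
  move=> A [N _ NA]; apply: FG; apply: Psub (Pfin N) => k /= nAk.
  by rewrite ltnNge; apply/negP => /NA.
have : G (~` A) by apply: FG; rewrite /F /= setCK.
by move=> /(filterI GA) /filter_ex [? []].
Qed.

End ultrafilters.

Section real_sequences.
Variable R : realType.
Implicit Types (a d T beta : nat -> R).

Lemma descent_cvg0 a d (c m : R) N : 0 < c -> (forall k, (N <= k)%N -> m <= a k) ->
  (forall k, (N <= k)%N -> 0 <= d k /\ a k.+1 + c * d k ^+ 2 <= a k) ->
  d @ \oo --> (0 : R).
Proof.
move=> c0 am ad.
pose b k := a (k + N)%N.
have bcvg : cvgn b.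
  apply: nonincreasing_is_cvgn.
    apply/nonincreasing_seqP => k; have [_] := ad _ (leq_addl k N).
    have : 0 <= c * d (k + N)%N ^+ 2 by rewrite mulr_ge0 ?sqr_ge0// ltW.
    by rewrite /b addSn; lra.
  by exists m => _ [k _ <-]; apply: am; exact: leq_addl.
have b0 : b k - b k.+1 @[k --> \oo] --> (0 : R).
  rewrite -(subrr (limn b)); apply: cvgB; first exact: bcvg.
  by rewrite (cvg_shiftS b); exact: bcvg.
apply/cvgr0Pnorm_lt => e e0.
have ce0 : 0 < c * e ^+ 2 by rewrite mulr_gt0 ?exprn_gt0.
move/cvgr0Pnorm_lt : b0 => /(_ _ ce0) [M _ hM].
exists (M + N)%N => // k /= Mk.
have Nk : (N <= k)%N by apply: leq_trans Mk; exact: leq_addl.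
have := hM (k - N)%N; rewrite /= leq_subRL// addnC Mk /b addSn subnK// => /(_ isT) /ltr_normlW h.
have [d0 h2] := ad _ Nk.
rewrite ger0_norm// -ltr_sqr ?nnegrE ?(ltW e0)//.
by rewrite -(ltr_pM2l c0); lra.
Qed.

Lemma finite_length_cvg (E : innerType R) (z : nat -> E) T N : euclidean E ->
  (forall k, (N <= k)%N -> 0 <= T k /\ enorm (z k.+1 - z k) <= T k - T k.+1) ->
  exists zl : E, z @ \oo --> zl.
Proof.
move=> hE hT.
have dz i j : (N <= i)%N -> enorm (z (j + i)%N - z i) <= T i - T (j + i)%N.
  move=> Ni; elim: j => [|j IH]; first by rewrite add0n !subrr enorm0.
  have [_] := hT (j + i)%N (leq_trans Ni (leq_addl _ _)); rewrite addSn => h.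
  rewrite -(subrK (z (j + i)%N) (z _.+1)) -addrA.
  by apply: le_trans (ler_enormD _ _) _; lra.
have Tcvg : cvgn (fun k => T (k + N)%N).
  apply: nonincreasing_is_cvgn.
    apply/nonincreasing_seqP => k; have [_] := hT _ (leq_addl k N).
    by have := enorm_ge0 (z (k + N).+1 - z (k + N)%N); rewrite addSn; lra.
  by exists 0 => _ [k _ <-]; have [] := hT _ (leq_addl k N).
have [Tl TTl] : exists Tl : R, T @ \oo --> Tl.
  by case/cvg_ex: Tcvg => l; rewrite (cvg_shiftn N T) => ?; exists l.
(* The limit is found along an arbitrary ultrafilter refining [\oo]; the telescoped bound T i - Tl
   then forces the whole sequence to it. *)
have [|G [GU oG _]] := @ultra_frequently setT; first by move=> n; exists n.
have [|zl zzl] := @ultra_cvg _ _ hE _ G z (enorm (z N) + T N) GU.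
  apply: oG; exists N => // k /= Nk; have := dz N (k - N)%N (leqnn _); rewrite subnK//.
  have [? _] := hT _ Nk => h.
  by rewrite -(subrK (z N) (z k)); apply: le_trans (ler_enormD _ _) _; lra.
exists zl; apply: enorm_dist_cvg => //.
apply: (@squeeze_cvgr _ _ _ _ (cst 0) (fun k => T k - Tl)).
- exists N => // i /= Ni; rewrite enorm_ge0/=.
  have h1 : enorm (z j - z i) @[j --> G] --> enorm (zl - z i).
    by apply: cvg_enorm => //; exact: cvgB zzl (cvg_cst _).
  have h2 : T i - T j @[j --> G] --> T i - Tl.
    by apply: cvgB; [exact: cvg_cst|move=> A /TTl /oG].
  rewrite enorm_distC; apply: (cvg_ler h1 h2); apply: oG; exists i => // j /= ij.
  by have := dz i (j - i)%N Ni; rewrite subnK.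
- exact: cvg_cst.
- by rewrite -(subrr Tl); apply: cvgB => //; exact: cvg_cst.
Unshelve. all: by end_near. Qed.

Lemma increments_or_const beta (db : R) : 0 < db ->
  (forall k, beta k.+1 = beta k + db \/ beta k.+1 = beta k) ->
  (exists N, forall k, (N <= k)%N -> beta k = beta N) \/
  ((forall N, exists2 k, (N <= k)%N & beta k.+1 = beta k + db) /\
   forall B : R, \forall k \near \oo, B < beta k).
Proof.
move=> db0 hb.
have mono i j : beta i <= beta (j + i)%N.
  elim: j => // j IH; rewrite addSn; apply: le_trans IH _.
  by case: (hb (j + i)%N) => ->//; lra.
have [inf|fin] := pselect (forall N, exists2 k, (N <= k)%N & beta k.+1 = beta k + db); last first.
  left; have /existsNP [N hN] := fin; exists N => k Nk.
  rewrite -(subnK Nk); elim: (k - N)%N => // j IH.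
  rewrite addSn; case: (hb (j + N)%N) => [h|->//].
  by exfalso; apply: hN; exists (j + N)%N; rewrite ?leq_addl.
right; split=> // B.
suff [k Bk] : exists k, B < beta k.
  by exists k => // j /= kj; rewrite -(subnK kj); exact: lt_le_trans (mono _ _).
suff H n : exists k, beta 0%N + n%:R * db <= beta k.
  have [k hk] := H (Num.truncn ((B - beta 0%N) / db)).+1; exists k.
  apply: lt_le_trans hk; rewrite -ltrBlDl -ltr_pdivrMr//; exact: truncnS_gt.
elim: n => [|n [k IH]]; first by exists 0%N; rewrite mul0r addr0.
have [j kj hj] := inf k; exists j.+1; rewrite hj.
have := mono k (j - k)%N; rewrite subnK// -natr1 mulrDl mul1r; lra.
Qed.

Lemma bounded_real_seqP beta : bounded_fun (beta : nat -> R^o) <->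
  exists M : R, forall k, `|beta k| <= M.
Proof.
split=> [[M [_ /(_ (M + 1))]]|[M hM]].
  by rewrite ltrDl ltr01 => /(_ isT) h; exists (M + 1) => k; exact: h.
exists M; split; first exact: num_real.
by move=> x Mx k _ /=; apply: le_trans (hM k) (ltW Mx).
Qed.

(* psi stands for the derivative of phi; unlike [desingularizing], this notion
   keeps only the consequences of concavity that are stable under sums. *)
Definition kl_pair (eta : R) (phi psi : R -> R) := [/\ 0 < eta,
  forall s, 0 < s < eta -> 0 <= phi s, forall s, 0 < s < eta -> 0 < psi s &
  forall t s, 0 < t -> t <= s -> s < eta -> psi s * (s - t) <= phi s - phi t].

(** Since both derivatives are positive, the sum dominates each of them: an index satisfying the KL
    inequality for either pair satisfies it for the sum. *)
Lemma kl_pairD eta1 eta2 phi1 phi2 psi1 psi2 :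
  kl_pair eta1 phi1 psi1 -> kl_pair eta2 phi2 psi2 ->
  kl_pair (Num.min eta1 eta2) (fun s => phi1 s + phi2 s) (fun s => psi1 s + psi2 s).
Proof.
move=> [e1 p1 q1 c1] [e2 p2 q2 c2]; split=> [|s|s|t s t0 ts].
- by rewrite lt_min e1.
- by rewrite lt_min => /and3P[s0 se1 se2]; rewrite addr_ge0// ?p1 ?p2 ?s0.
- by rewrite lt_min => /and3P[s0 se1 se2]; rewrite addr_gt0// ?q1 ?q2 ?s0.
- rewrite lt_min => /andP[se1 se2].
  by have := c1 _ _ t0 ts se1; have := c2 _ _ t0 ts se2; lra.
Qed.

Lemma desingularizing_kl_pair (eta : \bar R) (phi : R -> R) : (0 < eta)%E ->
  desingularizing eta phi ->
  exists2 e : R, (e%:E <= eta)%E & kl_pair e phi (derive1 phi).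
Proof.
move=> eta0 [_ phi_ge0 /convex_functionP phi_cvx _ phi'].
have [e e0 ee] : exists2 e : R, 0 < e & (e%:E <= eta)%E.
  case: eta eta0 {phi_ge0 phi_cvx phi'} => [r|_|//]; last by exists 1; rewrite ?leey.
  by rewrite lte_fin => r0; exists r.
have lt_eta s : s < e -> (s%:E < eta)%E.
  by move=> se; apply: lt_le_trans ee; rewrite lte_fin.
exists e => //; split=> // [s /andP[s0 se]|s /andP[s0 se]|t s t0 ts se].
- by apply: phi_ge0; split; [exact: ltW|exact: lt_eta].
- by have [|] := phi' s; first by split=> //; exact: lt_eta.
have s0 : 0 < s by exact: lt_le_trans ts.
have [|phis _ _] := phi' s; first by split=> //; exact: lt_eta.
move: ts; rewrite le_eqVlt => /orP[/eqP <-|ts]; first by rewrite !subrr mulr0.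
have st0 : 0 < s - t by rewrite subr_gt0.
rewrite -ler_pdivlMr// derive1E.
have H : h^-1 *: (phi (h *: 1 + s) - phi s) @[h --> 0^'-] --> 'D_1 phi s.
  exact: cvg_dnbhs_at_left phis.
apply: (cvgr_to_le H); near=> h.
have h0 : h < 0 by near: h; exact: nbhs_left_lt.
have hs : t - s < h by near: h; apply: nbhs_left_gt; lra.
rewrite /= ler_pdivlMr//.
(* The weight for which s + h = l t + (1 - l) s, so that concavity compares the left difference
   quotient at [s] with the chord from [t] to [s]. *)
pose l := - h / (s - t).
have l01 : 0 <= l <= 1.
  by apply/andP; split; rewrite /l; [rewrite divr_ge0//; lra|rewrite ler_pdivrMr//; lra].
have := phi_cvx t s l; rewrite /= => /(_ _ _ l01).
have -> : l *: (t : R^o) + (1 - l) *: (s : R^o) = h *: (1 : R^o) + s :> R.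
  by rewrite /GRing.scale/= /l; field; rewrite gt_eqF.
have It : (0 <= t /\ (t%:E < eta)%E) by split; [exact: ltW|apply: lt_eta; lra].
have Is : (0 <= s /\ (s%:E < eta)%E) by split; [exact: ltW|apply: lt_eta; lra].
move=> /(_ It Is) H1.
have lst : l * (s - t) = - h by rewrite /l; field; rewrite gt_eqF.
rewrite /GRing.scale/=.
have h'0 : 0 < - h by rewrite oppr_gt0.
rewrite -(ler_pM2l h'0).
have hh : h * h^-1 = 1 by rewrite mulfV ?lt_eqF.
rewrite mulrA mulrA mulNr hh mulN1r.
rewrite -lst.
have := ler_wpM2r (ltW st0) H1; rewrite /GRing.scale/=; lra.
Unshelve. all: by end_near. Qed.

(** The KL inequality and the tangent inequality for [phi] bound d_(k+2)^2 by a constant times the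
    decrease of [phi] times d_(k+1) + d_k; the inequality of means then makes the bound linear and
    summable. *)
Lemma kl_length (s : nat -> R) d eta phi psi (c1 c2 : R) N : 0 < c1 -> 0 < c2 ->
  kl_pair eta phi psi ->
  (forall k, (N <= k)%N -> [/\ 0 <= d k, 0 < s k < eta,
     s k.+1 + c1 * d k.+1 ^+ 2 <= s k &
     1 <= psi (s k.+1) * (c2 * (d k.+1 + d k))]) ->
  exists T, forall k, (N <= k)%N -> 0 <= T k /\ d k.+2 <= T k - T k.+1.
Proof.
move=> c10 c20 [eta0 phi0 psi0 conc] H.
pose M := c2 / c1; have M0 : 0 < M by rewrite divr_gt0.
(* With P the decrease of [phi] and D = d_(k+1) + d_k, these weights give T_k - T_(k+1) + d_(k+2) =
   2 (M P + D / 4), and d_(k+2) <= M P + D / 4. *)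
exists (fun k => 2 * (M * phi (s k.+1)) + d k.+1 + d k / 2) => k Nk.
have [d0 /andP[s0 se] _ kl] := H _ Nk.
have [d1 s1e dec _] := H _ (leqW Nk); have /andP[s1 se1] := s1e.
have [d2 s2e _ _] := H _ (leqW (leqW Nk)); have /andP[s2 se2] := s2e.
split.
  by rewrite !addr_ge0 ?mulr_ge0 ?invr_ge0 ?phi0// ltW.
have s21 : s k.+2 <= s k.+1.
  by apply: le_trans dec; rewrite lerDl mulr_ge0 ?sqr_ge0// ltW.
have cc := conc _ _ s2 s21 se1; have psi1 := psi0 _ s1e.
set P := phi (s k.+1) - phi (s k.+2) in cc.
set D := d k.+1 + d k in kl.
have D0 : 0 <= D by rewrite addr_ge0.
have P0 : 0 <= P by apply: le_trans cc; rewrite mulr_ge0 ?subr_ge0// ltW.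
have h1 : psi (s k.+1) * (c1 * d k.+2 ^+ 2) <= P.
  by apply: le_trans cc; rewrite ler_pM2l//; lra.
have h2 : c1 * d k.+2 ^+ 2 <= P * (c2 * D).
  have q0 : 0 <= c1 * d k.+2 ^+ 2 by rewrite mulr_ge0 ?sqr_ge0// ltW.
  apply: (@le_trans _ _ (psi (s k.+1) * (c2 * D) * (c1 * d k.+2 ^+ 2))).
    by rewrite -[leLHS]mul1r ler_wpM2r.
  have q1 : 0 <= c2 * D by rewrite mulr_ge0// ltW.
  have := ler_wpM2r q1 h1; lra.
have h3 : d k.+2 ^+ 2 <= M * P * D.
  rewrite -(ler_pM2l c10); apply: le_trans h2 _.
  have -> : c1 * (M * P * D) = P * (c2 * D) by rewrite /M; field; rewrite gt_eqF.
  exact: lexx.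
have h4 : d k.+2 <= D / 4 + M * P.
  have R0 : 0 <= D / 4 + M * P.
    by apply: addr_ge0; [lra|rewrite mulr_ge0// ltW].
  rewrite -ler_sqr ?nnegrE//.
  by apply: le_trans h3 _; have := sqr_ge0 (D / 4 - M * P); lra.
by rewrite /P /D in h4; lra.
Qed.

End real_sequences.

(** * The value function *)

Lemma dot_pair (R : realType) (E F : innerType R) (u v : E * F) :
  dot u v = dot u.1 v.1 + dot u.2 v.2.
Proof. by []. Qed.

Lemma enorm_sq_pair (R : realType) (E F : innerType R) (u : E * F) :
  enorm u ^+ 2 = enorm u.1 ^+ 2 + enorm u.2 ^+ 2.
Proof. by rewrite !enorm_sq. Qed.

Section moduli.
Variables (R : realType) (n m l : nat) (P : problem R n m l).
Hypothesis gamma_rhov : moduli_range P.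

(** Passing to c = 1 / gamma, with c = 0 for gamma = +oo, treats both ranges by polynomial
    inequalities. The fourth one is the bound on rho_v multiplied by 1 - gamma rho_f and by c. *)
Lemma moduliP : [/\ 0 <= rhof P, rhof P <= rhov P, 0 <= invgam P,
  rhof P * invgam P <= rhov P * (invgam P - rhof P) &
  rhof P = 0 /\ invgam P = 0 \/ rhof P < invgam P].
Proof.
case: gamma_rhov => [[f0 [g0 [gf hv]]]|[-> [gE v0]]]; last first.
  have -> : invgam P = 0 by rewrite /invgam gE.
  by split=> //; [lra|left].
move: g0 gf hv; rewrite /invgam; case: (gam P) => [g| |]//.
rewrite !lte_fin/= => g0 gf; rewrite inver gt_eqF//=.
have gf1 : g * rhof P < 1 by rewrite -ltr_pdivlMr// div1r.
have d0 : 0 < 1 - g * rhof P by rewrite subr_gt0.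
rewrite ler_pdivrMr// => hv.
have fg : rhof P < g^-1 by rewrite -div1r ltr_pdivlMr// mulrC.
have h : rhof P * g^-1 <= rhov P * (g^-1 - rhof P).
  have -> : rhov P * (g^-1 - rhof P) = rhov P * (1 - g * rhof P) * g^-1.
    by field; rewrite gt_eqF.
  by rewrite ler_wpM2r// invr_ge0 ltW.
split=> //; [exact: ltW| |by rewrite invr_ge0 ltW|by right].
have gi : 0 < g^-1 by rewrite invr_gt0.
have v0 : 0 <= rhov P.
  have : 0 < rhov P * (g^-1 - rhof P).
    by apply: lt_le_trans h; rewrite mulr_gt0.
  by rewrite pmulr_lgt0 ?subr_gt0// => /ltW.
apply: le_trans hv _; have := mulr_ge0 (mulr_ge0 v0 (ltW g0)) (ltW f0); lra.
Qed.

(* The condition on rho_v says that this quadratic form is nonnegative. *)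
Lemma moduli_quad (E : innerType R) (a b : E) :
  rhof P * enorm a ^+ 2 <= invgam P * enorm (a - b) ^+ 2 + rhov P * enorm b ^+ 2.
Proof.
have [f0 fv c0 h [[-> ->]|fc]] := moduliP.
  rewrite !mul0r add0r mulr_ge0 ?sqr_ge0//; exact: le_trans fv.
set c := invgam P in c0 h fc *; set r := rhof P in f0 fv h fc *.
have cr : 0 < c - r by rewrite subr_gt0.
rewrite -subr_ge0 -(pmulr_rge0 _ cr).
have -> : (c - r) * (c * enorm (a - b) ^+ 2 + rhov P * enorm b ^+ 2 - r * enorm a ^+ 2)
   = enorm ((c - r) *: a - c *: b) ^+ 2 +
     (rhov P * (c - r) - r * c) * enorm b ^+ 2.
  by rewrite !enorm_sq !dotE (dotC b a); ring.
by rewrite addr_ge0 ?sqr_ge0// mulr_ge0 ?sqr_ge0// subr_ge0.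
Qed.

End moduli.

Section value_function.
Variables (R : realType) (n m l : nat) (P : problem R n m l).
Local Notation E := ('rV[R]_n * 'rV[R]_m)%type.
Hypothesis Y_convex : convex_set (ydom P).
Hypothesis O_convex : convex_set (odom P).
Hypothesis g_convOY : forall i, convex_function (odom P `*` ydom P) (lowg P i).
Hypothesis feas_nonempty : forall x, odom P x -> feas P x !=set0.
Hypothesis f_wconvD : weakly_convex (rhof P) (Dset P) (lowf P).
Hypothesis gamma_rhov : moduli_range P.

Lemma feas_conv x1 x2 w1 w2 (t : R) : odom P x1 -> odom P x2 ->
  feas P x1 w1 -> feas P x2 w2 -> 0 <= t <= 1 ->
  feas P (t *: x1 + (1 - t) *: x2) (t *: w1 + (1 - t) *: w2).
Proof.
move=> O1 O2 [Y1 g1] [Y2 g2] t01; have /andP[t0 t1] := t01; split.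
  by move/convex_setP : Y_convex; exact.
move=> i; have /convex_functionP := g_convOY i.
move=> /(_ (x1, w1) (x2, w2) t (conj O1 Y1) (conj O2 Y2) t01) /le_trans; apply.
have := ler_wpM2l t0 (g1 i).
have : (1 - t) * lowg P i (x2, w2) <= (1 - t) * 0 by rewrite ler_wpM2l ?subr_ge0.
lra.
Qed.

Lemma Dset_convex : convex_set (Dset P).
Proof.
apply/convex_setP => -[x1 w1] [x2 w2] t [/= O1 [Y1 g1]] [/= O2 [Y2 g2]] t01.
have [Yt gt] := feas_conv O1 O2 (conj Y1 g1) (conj Y2 g2) t01.
by split; [move/convex_setP : O_convex; exact|split].
Qed.

(* The slope of v_gamma + rho_v / 2 |.|^2 at z used by the algorithm. *)
Definition vslope (z : E) (yt : 'rV[R]_m) (xi1 : 'rV[R]_n) : E :=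
  (xi1 + rhov P *: z.1, invgam P *: (z.2 - yt) + rhov P *: z.2).

Definition vobj (z : E) (w : 'rV[R]_m) := moreau_obj P z w + rhov P / 2 * enorm z ^+ 2.

(** The partial formulas assemble joint subgradients of f and the g_i at (x, yt). Complementary
    slackness removes the values g_i (x, yt), stationarity in y removes the terms linear in w' - yt,
    and the remaining quadratic form is that of [moduli_quad]. The bound concerns pairs (w, w')
    rather than v_gamma because it also serves to prove v_gamma finite. *)
Lemma vobj_minorant (z : E) (yt : 'rV[R]_m) (eta : 'I_l -> R) (xi1 : 'rV[R]_n) :
  odom P z.1 -> feas P z.1 yt ->
  multipliers P z yt eta ->
  (exists (a : 'rV[R]_n) (b : 'I_l -> 'rV[R]_n),
    [/\ subdiff_x (lowf P) (z.1, yt) a,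
        (forall i, subdiff_x (lowg P i) (z.1, yt) (b i)) &
        xi1 = a + \sum_i eta i *: b i]) ->
  partial_formula (lowf P) (z.1, yt) ->
  (forall i, partial_formula (lowg P i) (z.1, yt)) ->
  forall (w : E) (w' : 'rV[R]_m), odom P w.1 -> feas P w.1 w' ->
    vobj z yt + dot (vslope z yt xi1) (w - z) <= vobj w w'.
Proof.
move=> Oz [Yyt gyt] [eta0 etag [a [b [c [ya yb yc yeq]]]]] [ax [bx [xa xb ->]]] pf pg.
move=> w w' Ow [Yw gw].
have Dz : Dset P (z.1, yt) by split.
have Dw : Dset P (w.1, w') by split.
have hf : rsubdiff (lowf P) (z.1, yt) (ax, a) by rewrite pf.
have hg i : rsubdiff (lowg P i) (z.1, yt) (bx i, b i) by rewrite pg.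
have /csub_hatP /(_ _ Dw) Hf := rsubdiff_csub Dset_convex f_wconvD Dz hf.
have OYconv : convex_set (odom P `*` ydom P).
  apply/convex_setP => u v t [Ou Yu] [Ov Yv] t01; split.
    by move/convex_setP : O_convex; exact.
  by move/convex_setP : Y_convex; exact.
have Hg i : lowg P i (z.1, yt) + (dot (bx i) (w.1 - z.1) + dot (b i) (w' - yt)) <= 0.
  apply: le_trans (gw i).
  have wg : weakly_convex 0 (odom P `*` ydom P) (lowg P i).
    by split=> //; apply: convex_function_eq (g_convOY i) => u; rewrite !mul0r addr0.
  have OYz : (odom P `*` ydom P) (z.1, yt) by [].
  have /csub_hatP /(_ (w.1, w') (conj Ow Yw)) := rsubdiff_csub OYconv wg OYz (hg i).
  by rewrite dot_pair/=; lra.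
have Hsum : \sum_i eta i * (dot (bx i) (w.1 - z.1) + dot (b i) (w' - yt)) <= 0.
  have : \sum_i eta i * (lowg P i (z.1, yt) +
      (dot (bx i) (w.1 - z.1) + dot (b i) (w' - yt))) <= 0.
    by apply: sumr_le0 => i _; rewrite mulr_ge0_le0.
  by under eq_bigr do rewrite mulrDr; rewrite big_split/= etag add0r.
have Hc : dot c (w' - yt) <= 0 by move/(normal_coneP _ Y_convex Yyt) : yc; exact.
have sumdot (k : nat) (d : 'I_l -> 'rV[R]_k) (e : 'rV[R]_k) :
    dot (\sum_i eta i *: d i) e = \sum_i eta i * dot (d i) e.
  rewrite (big_morph (fun u => dot u e) (fun u v => dotDl u v e) (dot0l e)).
  by apply: eq_bigr => i _; rewrite dotZl.
have Hdot : dot a (w' - yt) + invgam P * dot (yt - z.2) (w' - yt) +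
    \sum_i eta i * dot (b i) (w' - yt) + dot c (w' - yt) = 0.
  by rewrite -sumdot -dotZl -!dotDl -yeq dot0l.
have {}Hsum : \sum_i eta i * dot (bx i) (w.1 - z.1) +
    \sum_i eta i * dot (b i) (w' - yt) <= 0.
  by rewrite -big_split/=; under eq_bigr do rewrite -mulrDr.
rewrite enorm_sq_pair dot_pair/= in Hf.
have Q1 := moduli_quad gamma_rhov (w' - yt) (w.2 - z.2).
have [f0 fv _ _ _] := moduliP gamma_rhov.
have Q2 : rhof P * enorm (w.1 - z.1) ^+ 2 <= rhov P * enorm (w.1 - z.1) ^+ 2.
  by rewrite ler_wpM2r ?sqr_ge0.
have -> : vobj w w' = lowf P (w.1, w') + invgam P / 2 * enorm (yt - z.2) ^+ 2
   + invgam P * (dot (yt - z.2) (w' - yt) - dot (yt - z.2) (w.2 - z.2))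
   + invgam P / 2 * enorm (w' - yt - (w.2 - z.2)) ^+ 2
   + rhov P / 2 * (enorm z.1 ^+ 2 + 2 * dot z.1 (w.1 - z.1) + enorm (w.1 - z.1) ^+ 2)
   + rhov P / 2 * (enorm z.2 ^+ 2 + 2 * dot z.2 (w.2 - z.2) + enorm (w.2 - z.2) ^+ 2).
  rewrite -!enorm_sqD /vobj /moreau_obj enorm_sq_pair ![_ + (_ - _)]addrC !subrK.
  have -> : w' - w.2 = yt - z.2 + (w' - yt - (w.2 - z.2)).
    by rewrite opprB addrACA subrKC addKr.
  by rewrite enorm_sqD [in X in 2 * X]dotDr dotNr; field.
have -> : dot (vslope z yt (ax + \sum_i eta i *: bx i)) (w - z) =
  dot ax (w.1 - z.1) + \sum_i eta i * dot (bx i) (w.1 - z.1) +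
  rhov P * dot z.1 (w.1 - z.1) - invgam P * dot (yt - z.2) (w.2 - z.2)
  + rhov P * dot z.2 (w.2 - z.2).
  by rewrite dot_pair/= !dotDl !dotZl !dotDl !dotNl sumdot; lra.
rewrite /vobj /moreau_obj enorm_sq_pair /=.
lra.
Qed.

Definition vr (z : E) : R := fine (vgam P z).

Hypothesis minorant : exists L : E -> R,
  forall w w', odom P w.1 -> feas P w.1 w' -> L w <= moreau_obj P w w'.

Lemma vgamE w : odom P w.1 -> vgam P w = (vr w)%:E.
Proof.
move=> Ow; rewrite /vr fineK//; have [L hL] := minorant.
have [w' Fw'] := feas_nonempty Ow; rewrite fin_numE; apply/andP; split.
  apply/eqP => h; have : ((L w)%:E <= vgam P w)%E.
    by apply: le_ereal_inf_tmp => _ [v Fv <-]; rewrite lee_fin hL.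
  by rewrite h.
apply/eqP => h; have : (vgam P w <= (moreau_obj P w w')%:E)%E.
  by apply: ereal_inf_lbound; exists w'.
by rewrite h.
Qed.

Lemma vr_le w w' : odom P w.1 -> feas P w.1 w' -> vr w <= moreau_obj P w w'.
Proof.
move=> Ow Fw'; rewrite -lee_fin -vgamE//.
by apply: ereal_inf_lbound; exists w'.
Qed.

Lemma vr_ge w c : odom P w.1 -> (forall w', feas P w.1 w' -> c <= moreau_obj P w w') ->
  c <= vr w.
Proof.
move=> Ow H; rewrite -lee_fin -vgamE//.
by apply: le_ereal_inf_tmp => _ [v Fv <-]; rewrite lee_fin H.
Qed.

Lemma vr_argmin w yt : odom P w.1 -> Sgam P w yt -> vr w = moreau_obj P w yt.
Proof.
move=> Ow [Fy ymin]; apply/eqP; rewrite eq_le vr_le//=.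
by apply: vr_ge => // w' Fw'; exact: ymin.
Qed.

(** Partial minimization of a jointly convex function of (x, y, w): the negative curvature of f is
    compensated by [moduli_quad]. Near-minimizers are used, since the infimum may not be attained
    away from the iterates. *)
Lemma vr_convex : convex_function (odom P `*` setT) (sqhat (rhov P) vr).
Proof.
apply/convex_functionP => z1 z2 t -[hz1 _] [hz2 _] t01; have /andP[t0 t1] := t01.
have adh z e : odom P z.1 -> 0 < e ->
    exists2 w, feas P z.1 w & (moreau_obj P z w < vr z + e)%R.
  move=> Oz e0; apply: contrapT => H; have : vr z + e <= vr z.
    by apply: vr_ge => // w Fw; rewrite leNgt; apply/negP => h; apply: H; exists w.
  by lra.
apply/ler_addgt0Pr => e e0.
have [w1 F1 h1] := adh z1 e hz1 e0; have [w2 F2 h2] := adh z2 e hz2 e0.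
have Fw := feas_conv hz1 hz2 F1 F2 t01.
have Ot : odom P (t *: z1 + (1 - t) *: z2).1.
  by move/convex_setP : O_convex; exact.
have := vr_le Ot Fw.
have h1' := ler_wpM2l t0 (ltW h1).
have h2' : (1 - t) * moreau_obj P z2 w2 <= (1 - t) * (vr z2 + e).
  by rewrite ler_wpM2l ?subr_ge0// ltW.
have /convex_functionP := weakly_convex_hat f_wconvD.
have [Y1 g1] := F1; have [Y2 g2] := F2.
have D1 : Dset P (z1.1, w1) by split.
have D2 : Dset P (z2.1, w2) by split.
move=> /(_ _ _ _ D1 D2 t01).
rewrite /sqhat /moreau_obj !enorm_sq_conv /= in h1' h2' *.
have -> : t *: w1 + (1 - t) *: w2 - (t *: z1.2 + (1 - t) *: z2.2) =
  t *: (w1 - z1.2) + (1 - t) *: (w2 - z2.2) by rewrite !scalerBr opprD addrACA.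
rewrite enorm_sq_conv !enorm_sq_pair/=.
have -> : (t *: (z1.1, w1) + (1 - t) *: (z2.1, w2)) =
  (t *: z1.1 + (1 - t) *: z2.1, t *: w1 + (1 - t) *: w2) by [].
have -> : w1 - z1.2 - (w2 - z2.2) = (w1 - w2) - (z1.2 - z2.2).
  by rewrite !opprB addrACA [in RHS]addrACA; congr (_ + _); exact: addrC.
have tt : 0 <= t * (1 - t) by rewrite mulr_ge0 ?subr_ge0.
have Q1 := ler_wpM2l tt (moduli_quad gamma_rhov (w1 - w2) (z1.2 - z2.2)).
have [f0 fv _ _ _] := moduliP gamma_rhov.
have Q2 : t * (1 - t) * (rhof P * enorm (z1.1 - z2.1) ^+ 2) <=
    t * (1 - t) * (rhov P * enorm (z1.1 - z2.1) ^+ 2).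
  by rewrite ler_wpM2l// ler_wpM2r ?sqr_ge0.
lra.
Qed.

End value_function.

(** * The algorithm *)

Lemma locally_lipschitz_cvg (R : realType) (E : innerType R) (A : set E)
    (phi : E -> R) (T : Type) (G : set_system T) {GF : Filter G} (z : T -> E) (zb : E) :
  locally_lipschitz A phi -> A zb -> z @ G --> zb -> phi (z k) @[k --> G] --> phi zb.
Proof.
move=> Alip Azb zzb; have [N Nzb] := Alip _ Azb.
move=> [M [_ /(_ (`|M| + 1))]].
have -> : M < `|M| + 1 by have := ler_norm M; lra.
move=> /(_ isT) HM; apply/cvgrPdist_lt => e e0.
have M1 : 0 < `|M| + 1 by rewrite ltr_wpDl.
have eM : 0 < e / (`|M| + 1) by rewrite divr_gt0.
have zN : \forall k \near G, N (z k) by exact: zzb.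
move/cvgrPdist_lt : zzb => /(_ _ eM); apply: filterS2 zN => k Nk hk.
have := HM (zb, z k); rewrite /= => /(_ (conj (nbhs_singleton Nzb) Nk)).
move=> /le_lt_trans; apply.
by rewrite mulrC -ltr_pdivlMr.
Qed.

Lemma cvg_pair_pt (T : Type) (X Y : topologicalType) (G : set_system T) {GF : Filter G}
    (f : T -> X) (g : T -> Y) (a : X) (b : Y) :
  f @ G --> a -> g @ G --> b -> (f k, g k) @[k --> G] --> (a, b).
Proof.
move=> fa gb A [[B C] [/= Ba Cb] BC].
have fB : \forall k \near G, B (f k) by exact: fa.
have gC : \forall k \near G, C (g k) by exact: gb.
by apply: filterS2 fB gC => k ? ?; exact: BC.
Qed.

Section conjugates.
Variables (R : realType) (E : innerType R) (D : set E).

Lemma conjugate_ge (h : E -> \bar R) (k : E -> R) zeta w : D w -> h w = (k w)%:E ->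
  ((dot zeta w - k w)%:E <= conjugate D h zeta)%E.
Proof. by move=> Dw hk; apply: ereal_sup_ubound; exists w => //; rewrite hk EFinB. Qed.

(** Fenchel equality: a subgradient at [w] makes [w] a maximizer in the conjugate. *)
Lemma conjugateE (h : E -> \bar R) (k : E -> R) zeta w : D w ->
  (forall w', D w' -> h w' = (k w')%:E) -> csub D k w zeta ->
  conjugate D h zeta = (dot zeta w - k w)%:E.
Proof.
move=> Dw hk kz; apply/eqP; rewrite eq_le conjugate_ge ?hk// andbT.
apply: ge_ereal_sup => _ [w' Dw' <-]; rewrite hk// -EFinB lee_fin.
by have := kz _ Dw'; rewrite dotDr dotNr; lra.
Qed.

End conjugates.

Lemma enorm_pair_le (R : realType) (E F : innerType R) (u : E * F) :
  enorm u <= enorm u.1 + enorm u.2.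
Proof.
rewrite -ler_sqr ?nnegrE ?addr_ge0 ?enorm_ge0// enorm_sq_pair sqrrD.
by have := mulr_ge0 (enorm_ge0 u.1) (enorm_ge0 u.2); lra.
Qed.

Lemma enorm_quad_le (R : realType) (E : innerType R) (a b c d : E) :
  enorm ((a, b), (c, d)) <= enorm a + enorm b + (enorm c + enorm d).
Proof. by apply: le_trans (enorm_pair_le _) _; apply: lerD; exact: enorm_pair_le. Qed.

Lemma dist0_le (R : realType) (E : innerType R) (A : set E) (v : E) (r : R) : A v ->
  enorm v <= r -> (dist0 A <= r%:E)%E.
Proof.
move=> Av vr; apply: (@le_trans _ _ (enorm v)%:E); last by rewrite lee_fin.
by apply: ereal_inf_lbound; exists v.
Qed.

Lemma enorm_fst_le (R : realType) (E F : innerType R) (u : E * F) : enorm u.1 <= enorm u.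
Proof. by rewrite -ler_sqr ?nnegrE ?enorm_ge0// enorm_sq_pair lerDl sqr_ge0. Qed.

Lemma enorm_snd_le (R : realType) (E F : innerType R) (u : E * F) : enorm u.2 <= enorm u.
Proof. by rewrite -ler_sqr ?nnegrE ?enorm_ge0// enorm_sq_pair lerDr sqr_ge0. Qed.

Section run.
Variables (R : realType) (n m l : nat) (P : problem R n m l).
Local Notation E := ('rV[R]_n * 'rV[R]_m)%type.
Local Notation G0 := (sqhat (rhoF P) (objF1 P)).
Local Notation H0 := (sqhat (rhoF P) (objF2 P)).
Local Notation G1 := (sqhat (rhov P) (lowf P)).
Local Notation HV := (sqhat (rhov P) (vr P)).
Local Notation OT := (odom P `*` setT).

Hypothesis C_closed : closed (Cset P).
Hypothesis U_open : open (udom P).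
Hypothesis U_convex : convex_set (udom P).
Hypothesis C_sub_U : Cset P `<=` udom P.
Hypothesis F1_wconvU : weakly_convex (rhoF P) (udom P) (objF1 P).
Hypothesis F2_wconvU : weakly_convex (rhoF P) (udom P) (objF2 P).
Hypothesis f_wconvU : weakly_convex (rhof P) (udom P) (lowf P).
Hypothesis Y_convex : convex_set (ydom P).
Hypothesis X_convex : convex_set (xdom P).
Hypothesis g_convXY : forall i, convex_function (xdom P `*` ydom P) (lowg P i).
Hypothesis O_open : open (odom P).
Hypothesis O_convex : convex_set (odom P).
Hypothesis X_sub_O : xdom P `<=` odom P.
Hypothesis g_convOY : forall i, convex_function (odom P `*` ydom P) (lowg P i).
Hypothesis feas_nonempty : forall x, odom P x -> feas P x !=set0.
Hypothesis f_wconvD : weakly_convex (rhof P) (Dset P) (lowf P).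
Hypothesis gamma_rhov : moduli_range P.
Hypothesis F_def : forall z, (xdom P `*` ydom P) z -> objF P z = objF1 P z - objF2 P z.
Variables (alpha dbeta cbeta : R) (zm1 : E) (z : nat -> E) (beta : nat -> R)
  (yt : nat -> 'rV[R]_m) (eta : nat -> 'I_l -> R) (xi0 : nat -> E)
  (xi1 : nat -> 'rV[R]_n).
Hypothesis run : iP_DwCA P alpha dbeta cbeta zm1 z beta yt eta xi0 xi1.
Hypothesis f_partial : forall k, partial_formula (lowf P) ((z k).1, yt k).
Hypothesis g_partial : forall k i, partial_formula (lowg P i) ((z k).1, yt k).
Hypothesis F_bounded_below : has_lbound (objF P @` Cset P).
Hypothesis F1_lip : locally_lipschitz (Cset P) (objF1 P).
Hypothesis F2_lip : locally_lipschitz (Cset P) (objF2 P).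
Hypothesis f_lip : locally_lipschitz (Cset P) (lowf P).

Let hE : euclidean (E : innerType R) :=
  prod_euclidean (rV_euclidean R n) (rV_euclidean R m).

Definition zeta0 k : E := xi0 k + rhoF P *: z k.
Definition zeta1 k : E := vslope P (z k) (yt k) (xi1 k).

Lemma C_sub_OT : Cset P `<=` OT.
Proof. by move=> w [Xw _]; split=> //; exact: X_sub_O. Qed.

Lemma OT_convex : convex_set (OT : set E).
Proof.
apply/convex_setP => w w' t [Ow _] [Ow' _] t01; split=> //=.
by move/convex_setP : O_convex; exact.
Qed.

Lemma nbhs_U w : Cset P w -> nbhs w (udom P).
Proof. by move=> /C_sub_U Uw; exact: open_nbhs_nbhs. Qed.

Lemma nbhs_OT w : Cset P w -> nbhs w OT.
Proof.
move=> /C_sub_OT [Ow _]; exists (odom P, setT); last by case=> ? ? [].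
by split; [exact: open_nbhs_nbhs|exact: filterT].
Qed.

Lemma Cset_convex : convex_set (Cset P).
Proof.
apply/convex_setP => w w' t [Xw [Yw [_ gw]]] [Xw' [Yw' [_ gw']]] t01.
have Yt : ydom P (t *: w + (1 - t) *: w').2 by move/convex_setP : Y_convex; exact.
split; first by move/convex_setP : X_convex; exact.
split=> //; split=> // i; rewrite -surjective_pairing.
have XYw : (xdom P `*` ydom P) w by [].
have XYw' : (xdom P `*` ydom P) w' by [].
have /convex_functionP /(_ _ _ _ XYw XYw' t01) /le_trans := g_convXY i; apply.
have /andP[t0 t1] := t01.
have := gw i; have := gw' i; rewrite -!surjective_pairing => h1 h2.
have := ler_wpM2l t0 h2.
have : (1 - t) * lowg P i w' <= (1 - t) * 0 by rewrite ler_wpM2l ?subr_ge0.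
lra.
Qed.

(** The affine minorant at the first iterate, with the quadratic term moved to its side. *)
Lemma minorant : exists L : E -> R,
  forall w w', odom P w.1 -> feas P w.1 w' -> L w <= moreau_obj P w w'.
Proof.
have Oz0 : odom P (z 0%N).1 by have [] := C_sub_OT (algo_feasible run 0).
exists (fun w => vobj P (z 0%N) (yt 0%N) + dot (zeta1 0%N) (w - z 0%N)
   - rhov P / 2 * enorm w ^+ 2) => w w' Ow Fw'.
have [Fyt _] := algo_yt run 0.
have := vobj_minorant Y_convex O_convex g_convOY f_wconvD gamma_rhov Oz0 Fyt
  (algo_eta run 0) (algo_xi1 run 0) (f_partial 0) (g_partial 0) Ow Fw'.
by rewrite {2}/vobj /zeta1; lra.
Qed.

Lemma vgam_vr w : odom P w.1 -> vgam P w = (vr P w)%:E.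
Proof. by move=> Ow; apply: vgamE => //; exact: minorant. Qed.

Lemma vr_moreau k : vr P (z k) = moreau_obj P (z k) (yt k).
Proof.
apply: (vr_argmin feas_nonempty minorant); last exact: (algo_yt run k).
by have [] := C_sub_OT (algo_feasible run k).
Qed.

Lemma csub_HV k : csub OT HV (z k) (zeta1 k).
Proof.
move=> w [Ow _].
have Oz : odom P (z k).1 by have [] := C_sub_OT (algo_feasible run k).
have [Fyt _] := algo_yt run k.
have := vobj_minorant Y_convex O_convex g_convOY f_wconvD gamma_rhov Oz Fyt
  (algo_eta run k) (algo_xi1 run k) (f_partial k) (g_partial k) Ow.
rewrite /sqhat vr_moreau -/(vobj P (z k) (yt k)) -/(zeta1 k) => H.
rewrite -lerBlDr; apply: vr_ge => //; first exact: minorant.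
by move=> w' Fw'; have := H _ Fw'; rewrite {2}/vobj; lra.
Qed.

Lemma csub_H0 k : csub (udom P) H0 (z k) (zeta0 k).
Proof.
apply: rsubdiff_csub => //; first exact: C_sub_U (algo_feasible run k).
exact: (algo_xi0 run).
Qed.

Lemma G0_convex : convex_function (udom P) G0.
Proof. exact: weakly_convex_hat. Qed.

Lemma G1_convex : convex_function (udom P) G1.
Proof.
apply: weakly_convex_hat; apply: weakly_convexW f_wconvU.
by have [] := moduliP gamma_rhov.
Qed.

(** The constraint residual with v_gamma + rho_v / 2 |.|^2 linearized at [z0]. For a subgradient
    slope it overestimates f - v_gamma - eps on C, with equality at [z0]. *)
Definition res (z0 zeta w : E) : R := G1 w - HV z0 - dot zeta (w - z0) - eps P.

Lemma tresE k w : tres P (Vlin P (z k) (yt k) (xi1 k)) w = Num.max (res (z k) (zeta1 k) w) 0.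
Proof.
by rewrite /tres /Vlin /res /sqhat /zeta1 dot_pair /=; congr Num.max; rewrite /vr; lra.
Qed.

(** The slack [d] is there because the distance in the stopping criterion is an infimum, possibly
    not attained. *)
Definition step_data (k : nat) (d : R) (p q nu e : E) (lam : R) :=
  [/\ csub (udom P) G0 (z k.+1) p, csub (udom P) G1 (z k.+1) q,
      (forall w, Cset P w -> dot nu (w - z k.+1) <= 0),
      maxsub (beta k) (res (z k) (zeta1 k) (z k.+1)) lam &
      e = p - zeta0 k + lam *: (q - zeta1 k) + nu + alpha *: (z k.+1 - z k) /\
      enorm e <= Num.sqrt 2 / 2 * alpha * enorm (z k - zprev zm1 z k) + d].

Lemma beta_step k : beta k.+1 = beta k + dbeta \/ beta k.+1 = beta k.
Proof. by rewrite (algo_beta run k); case: ifP => _; [left|right]. Qed.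

Lemma beta_gt0 k : 0 < beta k.
Proof.
have [b0 db _ _ _] := algo_params run.
by elim: k => // k IH; case: (beta_step k) => ->//; rewrite addr_gt0.
Qed.

Lemma step_exists k d : 0 < d -> exists p q nu e lam, step_data k d p q nu e lam.
Proof.
move=> d0; have [_ _ alpha0 _ _] := algo_params run.
have C' := algo_feasible run k.+1.
set w1 := z k.+1 in C' *; set w0 := z k.
pose A w := G0 w - dot (zeta0 k) w + alpha / 2 * enorm (w - w0) ^+ 2.
pose B := res w0 (zeta1 k).
have cA : convex_function (udom P) A.
  apply: convex_functionD; last by apply: convex_quad; lra.
  apply: convex_functionD; first exact: G0_convex.
  by apply/convex_functionP => x y t _ _ _; rewrite !dotE; lra.
have cB : convex_function (udom P) B.
  have := convex_functionD G1_convex (@convex_affine _ _ (udom P) (- HV w0 - eps P) (- zeta1 k) w0).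
  by apply: convex_function_eq => w; rewrite /B /res dotNl; lra.
have b0 := ltW (beta_gt0 k).
pose phi w := A w + beta k * Num.max (B w) 0.
have phiE : phisub P alpha (beta k) w0 (xi0 k) (Vlin P w0 (yt k) (xi1 k)) = phi.
  apply/funext => w; rewrite /phisub tresE /phi /A /B /sqhat /zeta0 -/w0; lra.
have cphi : weakly_convex 0 (udom P) phi.
  split=> //; apply: convex_function_eq (convex_functionD cA (convex_maxr0 b0 cB)) => w.
  by rewrite /phi !mul0r addr0.
have := algo_step run k; rewrite /= -/w0 -/w1 phiE.
set r := Num.sqrt 2 / 2 * alpha * _ => hr.
have : (dist0 (mink_sum (rsubdiff phi w1) (normal_cone (Cset P) w1)) < (r + d)%:E)%E.
  by apply: le_lt_trans hr _; rewrite lte_fin ltrDl.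
move=> /ereal_inf_lt [_ [_ [a ha [nu hnu <-]] <-]]; rewrite lte_fin => ler.
have U1 := C_sub_U C'.
have := rsubdiff_csub U_convex cphi U1 ha; rewrite scale0r addr0 => ha'.
have {}ha' : csub (udom P) phi w1 a.
  by move=> w Uw; have := ha' _ Uw; rewrite /sqhat; lra.
have [p [q [lam [hp hq hlam aE]]]] := csub_max_rule hE U_convex (nbhs_U C') b0 cA cB ha'.
(* Here p and q are subgradients of [A] and [B]. Removing the linear parts and the gradient alpha
   (w1 - w0) of the proximal term leaves subgradients of [G0] and [G1], the quadratic remainder
   being absorbed by [csub_quad]. *)
exists (p + zeta0 k - alpha *: (w1 - w0)), (q + zeta1 k), nu, (a + nu), lam; split=> //.
- apply: (csub_quad (rho := alpha / 2)) => //; first exact: G0_convex.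
  move=> w Uw; have := hp _ Uw; rewrite /A.
  have -> : w - w0 = w1 - w0 + (w - w1) by rewrite [RHS]addrC subrKA.
  rewrite (enorm_sqD (w1 - w0)) -/w1.
  have -> : dot (p + zeta0 k - alpha *: (w1 - w0)) (w - w1) =
      dot p (w - w1) + dot (zeta0 k) (w - w1) - alpha * dot (w1 - w0) (w - w1).
    by rewrite -dotZl -dotNl -!dotDl.
  have <- : dot (zeta0 k) (w - w1) + dot (zeta0 k) w1 = dot (zeta0 k) w.
    by rewrite -dotDr subrK.
  lra.
- move=> w Uw; have := hq _ Uw; rewrite /B /res -/w1.
  have -> : w - w0 = w1 - w0 + (w - w1) by rewrite [RHS]addrC subrKA.
  by rewrite (dotDr (zeta1 k) (w1 - w0)) (dotDl q); lra.
- by move=> w Cw; move/(normal_coneP _ Cset_convex C') : hnu; exact.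
- split; last exact: ltW.
  rewrite -/w1 -/w0 aE addrK (addrAC (p + zeta0 k)) addrK.
  by rewrite [RHS]addrAC; congr (_ + _); rewrite [RHS]addrAC subrK.
Qed.

(** * Descent of the energy *)

Definition delta k := enorm (z k.+1 - z k).

(* Objective of the k-th subproblem without its proximal term, normalized to
   equal F + beta max(f - v - eps, 0) at z k. *)
Definition model k w := G0 w - dot (zeta0 k) (w - z k) - H0 (z k)
  + beta k * Num.max (res (z k) (zeta1 k) w) 0.

(** The optimality relation is tested against z k - z k.+1: the subgradient inequalities compare the
    two values of the model, the proximal gradient yields alpha d^2, and the error e costs at most
    alpha (D^2 / 4 + d^2 / 2) up to the slack. *)
Lemma step_descent k :
  model k (z k.+1) + alpha / 2 * delta k ^+ 2
  - alpha / 4 * enorm (z k - zprev zm1 z k) ^+ 2 <= model k (z k).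
Proof.
have [_ _ alpha0 _ _] := algo_params run.
rewrite /delta; set w1 := z k.+1; set w0 := z k; set D := enorm (w0 - _).
set d := enorm (w1 - w0).
have d0 : 0 <= d := enorm_ge0 _.
apply/ler_addgt0Pr => e' e'0.
have d1 : 0 < 1 + d by rewrite ltr_pwDl.
have ed : 0 < e' / (1 + d) by rewrite divr_gt0.
have [p [q [nu [e [lam [hp hq hnu hlam [eE ele]]]]]]] := step_exists k ed.
have C0 := algo_feasible run k.
rewrite -/w1 -/w0 -/D in hp hq hnu hlam eE ele.
have h1 := hp _ (C_sub_U C0); have h2 := hq _ (C_sub_U C0).
have h3 := hnu _ C0; rewrite -/w0 in h1 h2 h3.
have /andP[lam0 _] := maxsub_range (ltW (beta_gt0 k)) hlam.
have h4 := hlam (res w0 (zeta1 k) w0).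
have h5 : lam * dot (q - zeta1 k) (w0 - w1) <=
    lam * (res w0 (zeta1 k) w0 - res w0 (zeta1 k) w1).
  rewrite ler_wpM2l// /res subrr dot0r -(opprB w0 w1) dotNr dotDl dotNl; lra.
have eq1 : dot e (w0 - w1) = dot p (w0 - w1) - dot (zeta0 k) (w0 - w1)
    + lam * dot (q - zeta1 k) (w0 - w1) + dot nu (w0 - w1) - alpha * d ^+ 2.
  have dE : d ^+ 2 = - dot (w1 - w0) (w0 - w1).
    by rewrite -(opprB w1 w0) dotNr opprK /d enorm_sq.
  have gen (a b c u v y : E) (s t : R) : dot (a - b + s *: c + u + t *: v) y =
      dot a y - dot b y + s * dot c y + dot u y + t * dot v y by rewrite !dotE.
  by rewrite dE eE gen mulrN opprK.
have h6 : - (enorm e * d) <= dot e (w0 - w1).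
  rewrite /d enorm_distC lerNl -dotNl; apply: le_trans (dot_le_enorm _ _) _.
  by rewrite enormN.
have h7 : enorm e * d <= alpha * (D ^+ 2 / 4 + d ^+ 2 / 2) + e'.
  apply: le_trans (ler_wpM2r d0 ele) _; rewrite mulrDl.
  apply: lerD; last first.
    by rewrite mulrAC ler_pdivrMr// ler_wpM2l ?(ltW e'0)//; lra.
  have s2 : Num.sqrt 2 ^+ 2 = 2 :> R by rewrite sqr_sqrtr.
  have : 0 <= (D / 2 - Num.sqrt 2 / 2 * d) ^+ 2 by rewrite sqr_ge0.
  have -> : (D / 2 - Num.sqrt 2 / 2 * d) ^+ 2 =
     D ^+ 2 / 4 + Num.sqrt 2 ^+ 2 * d ^+ 2 / 4 - Num.sqrt 2 / 2 * D * d by field.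
  by rewrite s2 => /(mulr_ge0 (ltW alpha0)); lra.
rewrite /model -/w0 -/w1 subrr dot0r -(opprB w0 w1) dotNr; lra.
Qed.

Definition energy k := model k (z k.+1) + alpha / 4 * delta k ^+ 2.

Lemma energy_ge m0 : (forall w, Cset P w -> m0 <= objF P w) -> forall k, m0 <= energy k.
Proof.
move=> Fm k; have [_ _ alpha0 _ _] := algo_params run.
have C' := algo_feasible run k.+1.
have := Fm _ C'; rewrite F_def; last by have [? []] := C'.
have := csub_H0 k (C_sub_U C').
have : 0 <= beta k * Num.max (res (z k) (zeta1 k) (z k.+1)) 0.
  by rewrite mulr_ge0 ?le_max ?lexx ?orbT// ltW// beta_gt0.
have : 0 <= alpha / 4 * delta k ^+ 2 by rewrite mulr_ge0 ?sqr_ge0//; lra.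
rewrite /energy /model /sqhat; lra.
Qed.

(** Linearizing again at the new iterate raises both linear minorants there, hence lowers the model,
    as long as the penalty is unchanged. *)
Lemma energy_decr k : beta k.+1 = beta k ->
  energy k.+1 + alpha / 4 * delta k.+1 ^+ 2 <= energy k.
Proof.
move=> bE; have := step_descent k.+1; rewrite /= -/(delta k) => h1.
suff : model k.+1 (z k.+1) <= model k (z k.+1) by rewrite /energy; lra.
have C' := algo_feasible run k.+1.
have h2 := csub_H0 k (C_sub_U C').
have h3 := csub_HV k (C_sub_OT C').
have : res (z k.+1) (zeta1 k.+1) (z k.+1) <= res (z k) (zeta1 k) (z k.+1).
  by rewrite /res subrr dot0r; lra.
move=> h4; have : beta k * Num.max (res (z k.+1) (zeta1 k.+1) (z k.+1)) 0 <=
    beta k * Num.max (res (z k) (zeta1 k) (z k.+1)) 0.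
  rewrite ler_wpM2l ?(ltW (beta_gt0 k))// ge_max !le_max h4 lexx orbT//.
by rewrite /model bE subrr dot0r; lra.
Qed.

Lemma delta_cvg0 N : (forall k, (N <= k)%N -> beta k = beta N) ->
  delta @ \oo --> (0 : R).
Proof.
move=> bN; have [_ _ alpha0 _ _] := algo_params run.
have [m0 Fm] : exists m0, forall w, Cset P w -> m0 <= objF P w.
  by have [m0 hm] := F_bounded_below; exists m0 => w Cw; apply: hm; exists w.
rewrite -cvg_shiftS.
apply: (@descent_cvg0 _ energy _ (alpha / 4) m0 N) => [|k _|k Nk]; first by lra.
  exact: energy_ge.
split; first exact: enorm_ge0.
by apply: energy_decr; rewrite !bN// leqW.
Qed.

(** If the update test fails although beta * delta < cbeta, it fails because of 1 / t, which is the
    claimed bound. A zero step gives cbeta * (+oo), so the failed test then forces t = 0. *)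
Lemma beta_const_res k : beta k.+1 = beta k -> beta k * delta k < cbeta ->
  Num.max (res (z k) (zeta1 k) (z k.+1)) 0 <= delta k / cbeta.
Proof.
have [_ db0 _ cb0 _] := algo_params run.
rewrite (algo_beta run k) /=; case: ifPn => [_ ?|]; first by lra.
rewrite -leNgt tresE -/(delta k); set t := Num.max _ _ => + _ bd.
have t0 : 0 <= t by rewrite /t le_max lexx orbT.
have d0 : 0 <= delta k := enorm_ge0 _.
rewrite ler_pdivlMr//.
have [->|tn] := eqVneq t 0; first by rewrite mul0r.
have {}t0 : 0 < t by rewrite lt_neqAle eq_sym tn.
rewrite !inver (negbTE tn) -EFin_max; case: eqP => [_|/eqP dn].
  by rewrite mulry gtr0_sg// mul1e leye_eq.
have {}d0 : 0 < delta k by rewrite lt_neqAle eq_sym dn.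
rewrite -EFinM lee_fin ler_pdivrMr// mulrC.
case: (leP (beta k) t^-1) => _; first by rewrite ler_pdivlMr// mulrC.
by lra.
Qed.

(** An increment means that both terms of the maximum are below cbeta / delta; in particular 1 / t
    is finite, so the residual is positive. *)
Lemma beta_incr_res k : beta k.+1 = beta k + dbeta ->
  beta k * delta k < cbeta /\ 0 < res (z k) (zeta1 k) (z k.+1).
Proof.
have [_ db0 _ cb0 _] := algo_params run.
rewrite (algo_beta run k) /=; case: ifPn => [|_ ?]; last by lra.
rewrite tresE -/(delta k); set r := res _ _ _; set t := Num.max _ _ => + _.
have d0 : 0 <= delta k := enorm_ge0 _.
have t0 : 0 <= t by rewrite /t le_max lexx orbT.
have [tz|tn] := eqVneq t 0.
  by rewrite tz !inver eqxx /maxe ltey ltNge leey.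
have {}t0 : 0 < t by rewrite lt_neqAle eq_sym tn.
have r0 : 0 < r by move: t0; rewrite /t lt_max ltxx orbF.
rewrite !inver (negbTE tn) -EFin_max; case: eqP => [->|/eqP dn].
  by rewrite mulr0.
have {}d0 : 0 < delta k by rewrite lt_neqAle eq_sym dn.
rewrite -EFinM lte_fin ltr_pdivlMr// => h; split=> //.
by apply: le_lt_trans h; rewrite ler_wpM2r ?le_max ?lexx// ltW.
Qed.

Lemma sqhat_cvg (T : Type) (G : set_system T) {GF : Filter G} (rho : R) (phi : E -> R)
    (u : T -> E) (ub : E) : u @ G --> ub -> phi (u k) @[k --> G] --> phi ub ->
  sqhat rho phi (u k) @[k --> G] --> sqhat rho phi ub.
Proof.
move=> uub phiub; apply: cvgD => //; apply: cvgM; first exact: cvg_cst.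
exact: cvg_enorm_sq.
Qed.

Lemma HV_convex : convex_function OT HV.
Proof. by apply: vr_convex => //; exact: minorant. Qed.

(** * Limits of the iterates and slopes along an ultrafilter *)

Section along_ultrafilter.
Variables (G : set_system nat) (zb : E).
Hypotheses (GU : UltraFilter G) (oG : \oo `<=` G).
Hypotheses (zzb : z @ G --> zb) (dG : delta @ G --> (0 : R)).

Lemma zb_in_C : Cset P zb.
Proof.
apply: C_closed => A Azb; have [k Ak] : exists k, A (z k) := @filter_ex _ G _ _ (zzb Azb).
by exists (z k); split=> //; exact: (algo_feasible run k).
Qed.

Lemma zS_cvg : z k.+1 @[k --> G] --> zb.
Proof.
apply: (enorm_dist_cvg hE).
have : delta k + enorm (z k - zb) @[k --> G] --> (0 + 0 : R).
  by apply: cvgD => //; exact: cvg_enorm_dist.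
rewrite addr0; apply: squeeze_cvgr (cvg_cst 0); apply: nearW => k.
by rewrite enorm_ge0/= -(subrK (z k) (z k.+1)) -addrA ler_enormD.
Qed.

Lemma G0_cvg : G0 (z k.+1) @[k --> G] --> G0 zb.
Proof.
by apply: sqhat_cvg; [exact: zS_cvg|exact: locally_lipschitz_cvg F1_lip zb_in_C zS_cvg].
Qed.

Lemma G1_cvg : G1 (z k.+1) @[k --> G] --> G1 zb.
Proof.
by apply: sqhat_cvg; [exact: zS_cvg|exact: locally_lipschitz_cvg f_lip zb_in_C zS_cvg].
Qed.

Lemma H0_cvg : H0 (z k) @[k --> G] --> H0 zb.
Proof.
by apply: sqhat_cvg; [exact: zzb|exact: locally_lipschitz_cvg F2_lip zb_in_C zzb].
Qed.

Lemma HV_cvg : HV (z k) @[k --> G] --> HV zb.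
Proof.
have [zetab hz] := csub_ex hE OT_convex HV_convex (nbhs_OT zb_in_C).
apply: (csub_continuous hE GU (nbhs_OT zb_in_C) zzb hz (zeta := zeta1)).
apply: nearW => k; split; last exact: csub_HV.
exact: C_sub_OT (algo_feasible run k).
Qed.

Lemma zeta0_cvg : exists zeta0b : E, zeta0 @ G --> zeta0b /\ csub (udom P) H0 zb zeta0b.
Proof.
apply: (csub_cvg hE GU (nbhs_U zb_in_C) zzb H0_cvg).
by apply: nearW => k; exact: csub_H0.
Qed.

Lemma zeta1_cvg : exists zeta1b : E, zeta1 @ G --> zeta1b /\ csub OT HV zb zeta1b.
Proof.
apply: (csub_cvg hE GU (nbhs_OT zb_in_C) zzb HV_cvg).
by apply: nearW => k; exact: csub_HV.
Qed.

Lemma zdiff_cvg0 : z k.+1 - z k @[k --> G] --> (0 : E).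
Proof. by rewrite -(subrr zb); exact: cvgB zS_cvg zzb. Qed.

Lemma res_cvg (zeta1b : E) : zeta1 @ G --> zeta1b ->
  res (z k) (zeta1 k) (z k.+1) @[k --> G] --> G1 zb - HV zb - eps P.
Proof.
move=> z1; rewrite -[X in _ --> X - eps P]subr0 -(dot0r zeta1b).
apply: cvgB; last exact: cvg_cst.
apply: cvgB; first exact: cvgB G1_cvg HV_cvg.
by apply: cvg_dot => //; exact: zdiff_cvg0.
Qed.

End along_ultrafilter.

Lemma z_enorm_bounded : bounded_fun z -> exists B, forall k, enorm (z k) <= B.
Proof.
move=> [M [_ /(_ (M + 1))]]; rewrite ltrDl ltr01 => /(_ isT) hM.
have [C C0 hC] := enorm_le_norm hE.
exists (C * (M + 1)) => k; apply: le_trans (hC _) _.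
by rewrite ler_pM2l//; exact: hM.
Qed.

Lemma step_seq : exists (p q nu e : nat -> E) (lam : nat -> R),
  forall k, step_data k k.+1%:R^-1 (p k) (q k) (nu k) (e k) (lam k).
Proof.
have H k : exists f : E * E * E * E * R,
    step_data k k.+1%:R^-1 f.1.1.1.1 f.1.1.1.2 f.1.1.2 f.1.2 f.2.
  have k0 : 0 < k.+1%:R^-1 :> R by rewrite invr_gt0 ltr0n.
  have [p [q [nu [e [lam h]]]]] := step_exists k k0.
  by exists (p, q, nu, e, lam).
have [f hf] := choice H.
by exists (fun k => (f k).1.1.1.1), (fun k => (f k).1.1.1.2), (fun k => (f k).1.1.2),
  (fun k => (f k).1.2), (fun k => (f k).2).
Qed.

(** * Limit points when the penalty is eventually constant *)

Section bounded_penalty.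
Variable N : nat.
Hypothesis beta_const : forall k, (N <= k)%N -> beta k = beta N.

(** Feasibility in the limit comes from the update rule alone: with constant beta and vanishing
    steps, beta * delta < cbeta eventually, so only a small residual can prevent an increment. *)
Lemma max_res_near : \forall k \near \oo,
  0 <= Num.max (res (z k) (zeta1 k) (z k.+1)) 0 <= delta k / cbeta.
Proof.
have [_ _ _ cb0 _] := algo_params run.
have bc : 0 < cbeta / beta N by rewrite divr_gt0// beta_gt0.
have := delta_cvg0 beta_const; move/cvgr0Pnorm_lt => /(_ _ bc) H.
near=> k.
have Nk : (N <= k)%N by near: k; exact: nbhs_infty_ge.
rewrite le_max lexx orbT/=; apply: beta_const_res.
  by rewrite !beta_const// leqW.
rewrite beta_const// mulrC -ltr_pdivlMr ?beta_gt0//.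
have : `|delta k| < cbeta / beta N by near: k.
by rewrite ger0_norm// enorm_ge0.
Unshelve. all: by end_near. Qed.

Lemma limit_stationary G zb : UltraFilter G -> \oo `<=` G -> z @ G --> zb ->
  exists (pb qb nub zeta0b zeta1b : E) (lb : R),
  [/\ csub (udom P) G0 zb pb, csub (udom P) G1 zb qb,
      (forall w, Cset P w -> dot nub (w - zb) <= 0),
      zeta0 @ G --> zeta0b /\ csub (udom P) H0 zb zeta0b &
      zeta1 @ G --> zeta1b /\ csub OT HV zb zeta1b] /\
  [/\ 0 = pb - zeta0b + lb *: (qb - zeta1b) + nub, 0 <= lb <= beta N,
      G1 zb - HV zb - eps P <= 0 & lb * (G1 zb - HV zb - eps P) = 0].
Proof.
move=> GU oG zzb; have [_ _ alpha0 cb0 _] := algo_params run.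
have dG : delta @ G --> (0 : R) by move=> A /(delta_cvg0 beta_const) /oG.
have [z0b [z0c hz0]] := zeta0_cvg GU zzb.
have [z1b [z1c hz1]] := zeta1_cvg GU zzb.
have [p [q [nu [e [lam hs]]]]] := step_seq.
have [pb [pc hpb]] : exists pb : E, p @ G --> pb /\ csub (udom P) G0 zb pb.
  apply: (csub_cvg hE GU (nbhs_U (zb_in_C GU zzb)) (zS_cvg GU zzb dG) (G0_cvg GU zzb dG)).
  by apply: nearW => k; have [] := hs k.
have [qb [qc hqb]] : exists qb : E, q @ G --> qb /\ csub (udom P) G1 zb qb.
  apply: (csub_cvg hE GU (nbhs_U (zb_in_C GU zzb)) (zS_cvg GU zzb dG) (G1_cvg GU zzb dG)).
  by apply: nearW => k; have [] := hs k.
have lamr k : 0 <= lam k <= beta k.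
  by have [_ _ _ hl _] := hs k; apply: maxsub_range hl; rewrite ltW// beta_gt0.
have NG : \forall k \near G, (N <= k)%N by apply: oG; exists N.
have [lb lc] : exists lb : R, lam @ G --> lb.
  apply: (ultra_cvgR (B := beta N) GU); apply: filterS NG => k Nk.
  by have /andP[l0 lb] := lamr k; rewrite ger0_norm// -(beta_const Nk).
have ec : e @ G --> (0 : E).
  apply: (enorm_dist_cvg hE); apply: cvg_trans (cvg_app _ oG) _.
  have D0 : enorm (z k - zprev zm1 z k) @[k --> \oo] --> (0 : R).
    by rewrite -cvg_shiftS; exact: (delta_cvg0 beta_const).
  have : Num.sqrt 2 / 2 * alpha * enorm (z k - zprev zm1 z k) + k.+1%:R^-1
      @[k --> \oo] --> Num.sqrt 2 / 2 * alpha * 0 + 0.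
    by apply: cvgD; [apply: cvgM D0; exact: cvg_cst|exact: cvg_harmonic].
  rewrite mulr0 addr0; apply: squeeze_cvgr (cvg_cst 0); apply: nearW => k.
  by rewrite enorm_ge0/= subr0; have [_ _ _ _ []] := hs k.
(* Solving the relation for [nu] gives its limit without a bound on normal vectors. *)
have nuE k : nu k = e k - (p k - zeta0 k + lam k *: (q k - zeta1 k)) - alpha *: (z k.+1 - z k).
  by have [_ _ _ _ [-> _]] := hs k; rewrite addrAC addrK addrC addKr.
have nuc : nu @ G --> 0 - (pb - z0b + lb *: (qb - z1b)) - alpha *: (0 : E).
  rewrite (funext nuE); apply: cvgB; last first.
    by apply: cvgZr; exact: (zdiff_cvg0 GU zzb dG).
  apply: cvgB => //; apply: cvgD; first exact: cvgB.
  by apply: cvgZ => //; exact: cvgB.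
rewrite scaler0 subr0 sub0r in nuc.
set sb := G1 zb - HV zb - eps P.
have sc : res (z k) (zeta1 k) (z k.+1) @[k --> G] --> sb := res_cvg GU zzb dG z1c.
have lb0 : 0 <= lb.
  by apply: (cvg_ler (cvg_cst 0) lc); apply: nearW => k; have /andP[] := lamr k.
have lbN : lb <= beta N.
  apply: (cvg_ler lc (cvg_cst (beta N))); apply: filterS NG => k Nk.
  by have /andP[_] := lamr k; rewrite (beta_const Nk).
have sb0 : sb <= 0.
  have dc : delta k / cbeta @[k --> G] --> 0 / cbeta by apply: cvgM => //; exact: cvg_cst.
  rewrite -[leRHS](mul0r cbeta^-1); apply: (cvg_ler sc dc).
  apply: filterS (oG _ max_res_near) => k /andP[_]; apply: le_trans.
  by rewrite le_max lexx.
(* Testing the subgradient [lam] at 0 gives lam * res >= 0; together with lb >= 0 and sb <= 0 this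
   is complementarity in the limit. *)
have lsb : 0 <= lb * sb.
  apply: (cvg_ler (cvg_cst 0) (cvgM lc sc)); apply: nearW => k.
  have [_ _ _ hl _] := hs k; have := hl 0; rewrite maxxx mulr0.
  have : 0 <= beta k * Num.max (res (z k) (zeta1 k) (z k.+1)) 0.
    by rewrite mulr_ge0 ?le_max ?lexx ?orbT// ltW// beta_gt0.
  rewrite /=; lra.
exists pb, qb, (- (pb - z0b + lb *: (qb - z1b))), z0b, z1b, lb; split; split=> //.
- move=> w Cw.
  have c1 : dot (nu k) (w - z k.+1) @[k --> G] -->
      dot (- (pb - z0b + lb *: (qb - z1b))) (w - zb).
    by apply: (cvg_dot hE) => //; exact: (cvgB (cvg_cst _) (zS_cvg GU zzb dG)).
  apply: (cvg_ler c1 (cvg_cst 0)); apply: nearW => k.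
  by have [_ _ hn _ _] := hs k; exact: hn.
- by rewrite subrr.
- by rewrite lb0.
- by apply/eqP; rewrite eq_le lsb andbT mulr_ge0_le0.
Qed.

End bounded_penalty.
(** The multiples of [zb] coming from the quadratic terms cancel between p and zeta0 and between q
    and zeta1, so the limit relation is already the KKT inclusion. *)
Lemma KKT_cluster N zb : (forall k, (N <= k)%N -> beta k = beta N) ->
  cluster (z @ \oo) zb -> KKT_point P zb.
Proof.
move=> bN /ultra_cluster [G [GU oG zzb]].
have [pb [qb [nub [z0b [z1b [lb [[hp hq hnu [_ h0] [_ h1]] [eq0 /andP[lb0 _] sb0 lsb]]]]]]]] :=
  limit_stationary bN GU oG zzb.
have Czb := zb_in_C GU zzb.
have Ozb : odom P zb.1 by have [] := C_sub_OT Czb.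
have resE : ((lowf P zb)%:E - vgam P zb - (eps P)%:E)%E = (G1 zb - HV zb - eps P)%:E.
  by rewrite vgam_vr// -!EFinB /sqhat; congr (_%:E); lra.
have to_rsub D rho (h : E -> R) v : nbhs zb D -> csub D (sqhat rho h) zb v ->
    rsubdiff h zb (v - rho *: zb).
  by move=> Dzb hv; apply: (csub_rsubdiff hE Dzb (rho := rho)); rewrite subrK.
split=> //; exists lb; split=> //.
- exists (pb - rhoF P *: zb), (z0b - rhoF P *: zb), (qb - rhov P *: zb),
    (z1b - rhov P *: zb), nub; split.
  + by split; [exact: to_rsub (nbhs_U Czb) hp|exact: to_rsub (nbhs_U Czb) h0].
  + exact: to_rsub (nbhs_U Czb) hq.
  + have [_ hv] := to_rsub _ _ _ _ (nbhs_OT Czb) h1.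
    split=> [|e' e'0]; first by rewrite vgam_vr.
    have := hv _ e'0; apply: filterS2 (nbhs_OT Czb) => w [Ow _] /=.
    by rewrite !vgam_vr.
  + exact/(normal_coneP _ Cset_convex Czb).
  + have sub2 (x y r : E) : x - r - (y - r) = x - y by rewrite opprB subrKA.
    by rewrite -[X in X + nub]addrA -scalerBr !sub2.
- by rewrite resE lee_fin.
- by rewrite resE -EFinM lsb.
Qed.

(** * Boundedness of the penalty *)

Lemma beta_bounded : 0 < eps P -> bounded_fun z ->
  (forall x, xdom P x -> convex_function (ydom P) (fun y => lowf P (x, y))) ->
  gam P = +oo%E \/
  (gam P <> +oo%E /\
   forall xbar, cluster ((fun k => (z k).1) @ \oo) xbar ->
     strictly_convex (fun y : 'rV[R]_m =>
       ((lowf P (xbar, y))%:E + set_indic (Cset P) (xbar, y))%E)) ->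
  bounded_fun (beta : nat -> R^o).
Proof.
move=> eps0 zbd f_convY gcase; have [_ db0 alpha0 cb0 _] := algo_params run.
apply/bounded_real_seqP.
case: (increments_or_const db0 beta_step) => [[N bN]|[binc binf]].
  exists (\sum_(i < N.+1) beta i) => k.
  have bi_ge0 i : 0 <= beta i by rewrite ltW// beta_gt0.
  rewrite ger0_norm//; have [kN|/ltnW Nk] := ltnP k N.+1.
    by rewrite (bigD1 (Ordinal kN))//= lerDl sumr_ge0.
  by rewrite bN ?(ltnW Nk)// (bigD1 (ord_max : 'I_N.+1))//= lerDl sumr_ge0.
exfalso.
(* The ultrafilter lives on the increments, where the residual is positive, hence lam = beta, and
   where delta < cbeta / beta tends to 0. *)
have [G [GU oG Ginc]] := ultra_frequently binc.
have [B zB] := z_enorm_bounded zbd.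
have [zb zzb] : exists zb : E, z @ G --> zb.
  by apply: (ultra_cvg hE (B := B) GU); apply: nearW => k; exact: zB.
have binv : (beta k)^-1 @[k --> G] --> (0 : R).
  apply/cvgr0Pnorm_lt => e e0; apply: filterS (oG _ (binf e^-1)) => k /= hk.
  rewrite gtr0_norm ?invr_gt0 ?beta_gt0// -[ltRHS]invrK.
  by rewrite ltf_pV2 ?posrE ?invr_gt0// beta_gt0.
have incr : \forall k \near G, beta k * delta k < cbeta /\ 0 < res (z k) (zeta1 k) (z k.+1).
  by apply: filterS Ginc => k; exact: beta_incr_res.
have dG : delta @ G --> (0 : R).
  have : cbeta * (beta k)^-1 @[k --> G] --> cbeta * 0.
    by apply: cvgM => //; exact: cvg_cst.
  rewrite mulr0; apply: squeeze_cvgr (cvg_cst 0); apply: filterS incr => k [h _].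
  rewrite enorm_ge0/= ler_pdivlMr ?beta_gt0// mulrC; exact: ltW.
have Czb := zb_in_C GU zzb.
have [z0b [z0c _]] := zeta0_cvg GU zzb.
have [z1b [z1c hz1]] := zeta1_cvg GU zzb.
have [p [q [nu [e [lam hs]]]]] := step_seq.
have [pb [pc _]] : exists pb : E, p @ G --> pb /\ csub (udom P) G0 zb pb.
  apply: (csub_cvg hE GU (nbhs_U Czb) (zS_cvg GU zzb dG) (G0_cvg GU zzb dG)).
  by apply: nearW => k; have [] := hs k.
have [qb [qc hqb]] : exists qb : E, q @ G --> qb /\ csub (udom P) G1 zb qb.
  apply: (csub_cvg hE GU (nbhs_U Czb) (zS_cvg GU zzb dG) (G1_cvg GU zzb dG)).
  by apply: nearW => k; have [] := hs k.
have [eb ec] : exists eb : E, e @ G --> eb.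
  apply: (ultra_cvg hE (B := Num.sqrt 2 / 2 * alpha * (B + B + enorm zm1) + 1) GU).
  apply: nearW => k; have [_ _ _ _ [_ he]] := hs k; apply: le_trans he _.
  apply: lerD; last by rewrite invf_le1 ?ler1n ?ltr0n.
  apply: ler_wpM2l; first by rewrite !mulr_ge0 ?invr_ge0 ?sqrtr_ge0// ltW.
  apply: le_trans (ler_enormB _ _) _; have := zB k; have := enorm_ge0 zm1.
  have := zB 0%N; have := enorm_ge0 (z 0%N).
  by case: k => [|k] /=; [|have := zB k; have := zB k.+1]; lra.
(* After division by beta, only nu / beta and q - zeta1 survive in the relation, so z1b - qb is
   normal to C at [zb]. *)
have hlim w : Cset P w -> dot (z1b - qb) (w - zb) <= 0.
  move=> Cw.
  have c0 : (beta k)^-1 *: (e k - (p k - zeta0 k) - alpha *: (z k.+1 - z k)) - (q k - zeta1 k)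
     @[k --> G] --> (0 : R) *: (eb - (pb - z0b) - alpha *: (0 : E)) - (qb - z1b).
    apply: cvgB; last exact: cvgB.
    apply: cvgZ => //; apply: cvgB; first by apply: cvgB => //; exact: cvgB.
    by apply: cvgZr; exact: (zdiff_cvg0 GU zzb dG).
  rewrite scale0r sub0r opprB in c0.
  have c1 : dot ((beta k)^-1 *: (e k - (p k - zeta0 k) - alpha *: (z k.+1 - z k))
      - (q k - zeta1 k)) (w - z k.+1) @[k --> G] --> dot (z1b - qb) (w - zb).
    by apply: (cvg_dot hE) => //; exact: (cvgB (cvg_cst w) (zS_cvg GU zzb dG)).
  apply: (cvg_ler c1 (cvg_cst 0)); apply: filterS incr => k [_ rk].
  have bk := beta_gt0 k.
  have [_ _ hn hl [eE _]] := hs k.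
  have lE : lam k = beta k by apply: maxsub_pos hl => //; exact: ltW.
  have -> : (beta k)^-1 *: (e k - (p k - zeta0 k) - alpha *: (z k.+1 - z k)) - (q k - zeta1 k)
      = (beta k)^-1 *: nu k.
    rewrite eE lE; set W := p k - zeta0 k; rewrite addrAC addrK -(addrA W) addrAC.
    rewrite subrr add0r scalerDr scalerA mulVf ?gt_eqF// scale1r.
    by rewrite addrAC subrr add0r.
  by rewrite dotZl pmulr_rle0 ?invr_gt0//; exact: hn.
have hG1 w : Cset P w -> G1 zb + dot z1b (w - zb) <= G1 w.
  move=> Cw; have := hqb _ (C_sub_U Cw); have := hlim _ Cw.
  by rewrite dotDl dotNl; lra.
have sb0 : 0 <= G1 zb - HV zb - eps P.
  apply: (cvg_ler (cvg_cst 0) (res_cvg GU zzb dG z1c)).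
  by apply: filterS incr => k [_ /ltW].
have [Xzb [Yzb [_ gzb]]] := Czb; have Ozb := X_sub_O Xzb.
(* The limit of (y - yt) / gamma; on the fiber over zb.1 it is a subgradient of f at zb.2, by
   [min1]. *)
pose c := z1b.2 - rhov P *: zb.2.
have fib y : feas P zb.1 y -> Cset P (zb.1, y).
  by move=> Fy; have [Yy _] := Fy; split.
have feas_cvx : convex_set (feas P zb.1).
  apply/convex_setP => y y' t Fy Fy' t01.
  have [_ [_ H]] : Cset P (t *: (zb.1, y) + (1 - t) *: (zb.1, y')).
    by move/convex_setP : Cset_convex => H; apply: H => //; exact: fib.
  by move: H; rewrite /= -scalerDl subrKC scale1r.
have f_cvx : convex_function (feas P zb.1) (fun y => lowf P (zb.1, y)).
  by apply: convex_function_sub (f_convY _ Xzb) => y [].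
have Fzb : feas P zb.1 zb.2 by split.
have min1 : csub (feas P zb.1) (fun y => lowf P (zb.1, y)) zb.2 c.
  apply: (csub_quad (rho := rhov P / 2)) => // y Fy.
  have := hG1 _ (fib _ Fy).
  rewrite /sqhat dot_pair !enorm_sq_pair /= subrr dot0r -surjective_pairing.
  have -> : enorm y ^+ 2 = enorm zb.2 ^+ 2 + 2 * dot zb.2 (y - zb.2) + enorm (y - zb.2) ^+ 2.
    by rewrite -enorm_sqD subrKC.
  by rewrite /c dotDl dotNl dotZl; lra.
suff : lowf P zb <= vr P zb by move: sb0; rewrite /sqhat; lra.
have cc : invgam P *: ((z k).2 - yt k) @[k --> G] --> c.
  have -> : (fun k => invgam P *: ((z k).2 - yt k)) = (fun k => (zeta1 k).2 - rhov P *: (z k).2).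
    by apply/funext => k; rewrite /zeta1 /vslope /= addrK.
  apply: cvgB; first exact: (cvg_comp _ _ z1c cvg_snd).
  by apply: cvgZr; exact: (cvg_comp _ _ zzb cvg_snd).
have [f0 _ _ _ gcases] := moduliP gamma_rhov.
(* For gamma = +oo the slope [c] vanishes, so zb.2 minimizes f over its fiber and f (zb) <= v_gamma
   (zb) at once. *)
have [ig|ig] : invgam P = 0 \/ 0 < invgam P.
  by case: gcases => [[_ ->]|/(le_lt_trans f0)]; [left|right].
  have c0' : c = 0.
    have cc0 : invgam P *: ((z k).2 - yt k) @[k --> G] --> (0 : 'rV[R]_m).
      by rewrite ig; under eq_fun do rewrite scale0r; exact: cvg_cst.
    by apply: cvg_unique cc cc0.
  apply: vr_ge => //; first exact: minorant.
  move=> y Fy; have := min1 _ Fy; rewrite c0' dot0l addr0 -surjective_pairing.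
  by rewrite /moreau_obj ig !mul0r addr0.
have gfin : gam P <> +oo%E by move=> h; move: ig; rewrite /invgam h /= ltxx.
have {gcase}strict : strictly_convex (fun y : 'rV[R]_m =>
    ((lowf P (zb.1, y))%:E + set_indic (Cset P) (zb.1, y))%E).
  case: gcase => [//|[_]]; apply; apply: (cluster_ultra GU oG).
  exact: (cvg_comp _ _ zzb cvg_fst).
pose ytb := zb.2 - (invgam P)^-1 *: c.
have ytc : yt @ G --> ytb.
  have -> : yt = (fun k => (z k).2 - (invgam P)^-1 *: (invgam P *: ((z k).2 - yt k))).
    by apply/funext => k; rewrite scalerA mulVf ?gt_eqF// scale1r opprB subrKC.
  apply: cvgB; first exact: (cvg_comp _ _ zzb cvg_snd).
  exact: cvgZr.
have Cytb : Cset P (zb.1, ytb).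
  apply: C_closed => A Azb.
  have zyc : ((z k).1, yt k) @[k --> G] --> (zb.1, ytb).
    by apply: cvg_pair_pt => //; exact: (cvg_comp _ _ zzb cvg_fst).
  have [k Ak] : exists k, A ((z k).1, yt k) := @filter_ex _ G _ _ (zyc _ Azb).
  exists ((z k).1, yt k); split=> //.
  have [Xk _] := algo_feasible run k; have [Fk _] := algo_yt run k.
  by have [Yk _] := Fk; split.
have Fytb : feas P zb.1 ytb by have [_ [_ ?]] := Cytb.
have vrE : vr P zb = moreau_obj P zb ytb.
  have v1 : vr P (z k) @[k --> G] --> vr P zb.
    have : HV (z k) - rhov P / 2 * enorm (z k) ^+ 2 @[k --> G] -->
        HV zb - rhov P / 2 * enorm zb ^+ 2.
      apply: cvgB; first exact: HV_cvg.
      by apply: cvgM; [exact: cvg_cst|exact: cvg_enorm_sq].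
    by rewrite /sqhat addrK; under eq_fun do rewrite addrK.
  have v2 : vr P (z k) @[k --> G] --> moreau_obj P zb ytb.
    under eq_fun do rewrite vr_moreau.
    apply: cvgD.
      have zyc : ((z k).1, yt k) @[k --> G] --> (zb.1, ytb).
        by apply: cvg_pair_pt => //; exact: (cvg_comp _ _ zzb cvg_fst).
      exact: locally_lipschitz_cvg f_lip Cytb zyc.
    apply: cvgM; first exact: cvg_cst.
    apply: (cvg_enorm_sq (rV_euclidean R m)).
    by apply: cvgB => //; exact: (cvg_comp _ _ zzb cvg_snd).
  exact: (cvg_unique _ v1 v2).
have cE : c = invgam P *: (zb.2 - ytb).
  by rewrite /ytb opprB subrKC scalerA mulfV ?gt_eqF// scale1r.
(* By [vrE], the limit [ytb] of the yt minimizes the Moreau objective at [zb]; its optimality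
   condition has the same slope [c] as the one at zb.2. *)
have min2 : csub (feas P zb.1) (fun y => lowf P (zb.1, y)) ytb c.
  apply: (csub_quad (rho := invgam P / 2)) => // y Fy.
  have : vr P zb <= moreau_obj P zb y by apply: vr_le => //; exact: minorant.
  rewrite vrE /moreau_obj.
  have -> : y - zb.2 = ytb - zb.2 + (y - ytb) by rewrite [RHS]addrC subrKA.
  rewrite (enorm_sqD (ytb - zb.2)) cE dotZl -(opprB ytb zb.2) (dotNl (ytb - zb.2)); lra.
(* Two points with a common subgradient: at their midpoint f is at least the mean of its values,
   which strict convexity forbids. *)
have ytbE : ytb = zb.2.
  apply: contrapT => /eqP yne.
  have h12 : 0 < (2^-1 : R) < 1 by apply/andP; lra.
  have fin y : feas P zb.1 y ->
      ((lowf P (zb.1, y))%:E + set_indic (Cset P) (zb.1, y))%E = (lowf P (zb.1, y))%:E.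
    move=> Fy; rewrite /set_indic; case: asboolP => [_|[]]; first by rewrite adde0.
    exact: fib.
  pose y' := 2^-1 *: ytb + (1 - 2^-1) *: zb.2.
  have Fy' : feas P zb.1 y'.
    by move/convex_setP : feas_cvx => H; apply: (H _ _ _ Fytb Fzb); apply/andP; lra.
  have := strict _ _ _ yne h12; rewrite -/y' !fin// => /(_ (ltry _) (ltry _)).
  rewrite -!EFinM -EFinD lte_fin.
  have := min1 _ Fy'; have := min2 _ Fy'.
  have -> : dot c (y' - ytb) = 2^-1 * (dot c zb.2 - dot c ytb).
    by rewrite /y' !dotE; lra.
  have -> : dot c (y' - zb.2) = 2^-1 * (dot c ytb - dot c zb.2).
    by rewrite /y' !dotE; lra.
  lra.
rewrite vrE ytbE /moreau_obj subrr enorm0 expr0n/= mulr0 addr0.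
by rewrite -surjective_pairing.
Qed.

(** * The merit function along the iterates *)

Definition merit_pt k : (E * E) * (E * E) := ((z k.+1, z k), (zeta0 k, zeta1 k)).

(* The merit function with both conjugates replaced by their Fenchel lower
   bounds at y. *)
Definition merit_lb (b : R) (y w z0 a0 a1 : E) : R :=
  G0 w - dot a0 w + (dot a0 y - H0 y) +
  b * Num.max (G1 w - dot a1 w + (dot a1 y - HV y - eps P)) 0
  + alpha / 4 * enorm (w - z0) ^+ 2.

Lemma h1_finite (w : E) : OT w ->
  (vgam P w + (rhov P / 2 * enorm w ^+ 2 + eps P)%:E)%E = (HV w + eps P)%:E.
Proof. by move=> [Ow _]; rewrite vgam_vr// -EFinD /sqhat addrA. Qed.

Lemma merit_ge (b : R) (y w z0 a0 a1 : E) : 0 <= b -> Cset P y -> Cset P w ->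
  ((merit_lb b y w z0 a0 a1)%:E <= merit P alpha b ((w, z0), (a0, a1)))%E.
Proof.
move=> b0 Cy Cw; rewrite /merit /set_indic asboolT// adde0.
apply: (@le_trans _ _ ((G0 w - dot a0 w)%:E + (dot a0 y - H0 y)%:E + b%:E *
   maxe ((G1 w - dot a1 w)%:E + (dot a1 y - HV y - eps P)%:E) 0
   + (alpha / 4 * enorm (w - z0) ^+ 2)%:E)%E).
  by rewrite -!EFinD -EFin_max -EFinM -!EFinD.
apply: leeD => //; apply: leeD.
  apply: leeD => //; apply: (conjugate_ge (k := H0)) => //; exact: C_sub_U.
apply: lee_wpmul2l; first by rewrite lee_fin.
rewrite ge_max !le_max lexx orbT andbT; apply/orP; left; apply: leeD => //.
rewrite -addrA -opprD; apply: (conjugate_ge (k := fun w => HV w + eps P)).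
  exact: C_sub_OT.
by apply: h1_finite; exact: C_sub_OT.
Qed.

Lemma meritE (b : R) (y w z0 a0 a1 : E) : Cset P y -> Cset P w ->
  csub (udom P) H0 y a0 -> csub OT HV y a1 ->
  merit P alpha b ((w, z0), (a0, a1)) = (merit_lb b y w z0 a0 a1)%:E.
Proof.
move=> Cy Cw ha0 ha1; rewrite /merit /set_indic asboolT// adde0.
rewrite (conjugateE (k := H0) (C_sub_U Cy))//.
rewrite (conjugateE (k := fun w => HV w + eps P) (C_sub_OT Cy)).
- have -> : dot a1 y - (HV y + eps P) = dot a1 y - HV y - eps P by ring.
  by rewrite -!EFinD -EFin_max -EFinM -!EFinD.
- exact: h1_finite.
- by move=> w' Ow'; have := ha1 _ Ow'; lra.
Qed.

(** [merit_lb] lies below the merit function and touches it at the point considered, so it suffices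
    to minorize [merit_lb]. The last two components are the slopes in zeta0 and zeta1, since y is a
    subgradient of both conjugates. *)
Lemma merit_subdiff (b lam : R) (y w a0 a1 p q nu e : E) :
  0 <= b -> Cset P y -> Cset P w ->
  csub (udom P) H0 y a0 -> csub OT HV y a1 ->
  csub (udom P) G0 w p -> csub (udom P) G1 w q ->
  (forall w', Cset P w' -> dot nu (w' - w) <= 0) ->
  maxsub b (res y a1 w) lam ->
  e = p - a0 + lam *: (q - a1) + nu + alpha *: (w - y) ->
  subdiff (merit P alpha b) ((w, y), (a0, a1))
    ((e - (alpha / 2) *: (w - y), - ((alpha / 2) *: (w - y))),
     (y - w, lam *: (y - w))).
Proof.
move=> b0 Cy Cw ha0 ha1 hp hq hnu hlam eE.
have [_ _ alpha0 _ _] := algo_params run.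
have /andP[lam0 _] := maxsub_range b0 hlam.
have mE := meritE b y Cy Cw ha0 ha1.
split=> [|e' e'0]; first by rewrite mE.
have hEE : euclidean (((E * E) * (E * E))%type : innerType R).
  by apply: prod_euclidean; exact: prod_euclidean hE hE.
(* The products <zeta, z> are not convex; their cross terms are at most (1 + lam) |D|^2, which on
   this ball is below e' |D|. *)
have ee : 0 < e' / (1 + lam) by rewrite divr_gt0// ltr_pwDl.
apply: filterS (near_enorm hEE ((w, y), (a0, a1)) ee) => -[[w' z'] [a0' a1']].
rewrite mE; set D := _ - _; rewrite ltr_pdivlMr ?ltr_pwDl// => hD.
have [Cw'|nCw'] := pselect (Cset P w'); last first.
  suff -> : merit P alpha b ((w', z'), (a0', a1')) = +oo%E by rewrite leey.
  (* Outside C the indicator gives +oo, provided that no other term is -oo. *)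
  have c0 : conjugate (udom P) (fun w : E => (H0 w)%:E) a0' != -oo%E.
    have := conjugate_ge (h := fun w : E => (H0 w)%:E) (k := H0) a0' (C_sub_U Cy) erefl.
    by apply: contraTneq => ->.
  rewrite /merit /set_indic asboolF// addey ?adde_eq_ninfty ?negb_or//.
  rewrite !addye// gt_eqF// (@lt_le_trans _ _ 0%E) ?ltNyr//.
  by rewrite mule_ge0 ?lee_fin// le_max lexx orbT.
apply: le_trans (merit_ge _ _ _ b0 Cy Cw'); rewrite -EFinD lee_fin.
set dw := w' - w; set dz := z' - y; set d0 := a0' - a0; set d1 := a1' - a1.
have DE : D = ((dw, dz), (d0, d1)) by [].
have n_ge0 := enorm_ge0 D.
have n0 : enorm dw <= enorm D.
  by apply: le_trans (enorm_fst_le (D.1)) (enorm_fst_le D).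
have n1 : enorm d0 <= enorm D.
  by apply: le_trans (enorm_fst_le (D.2)) (enorm_snd_le D).
have n2 : enorm d1 <= enorm D.
  by apply: le_trans (enorm_snd_le (D.2)) (enorm_snd_le D).
have cross (u : E) : enorm u <= enorm D -> dot u dw <= enorm D ^+ 2.
  move=> hu; apply: le_trans (dot_le_enorm _ _) _; rewrite expr2.
  by apply: ler_pM => //; exact: enorm_ge0.
have x0 := cross _ n1; have x1 := ler_wpM2l lam0 (cross _ n2).
have hN : enorm D ^+ 2 * (1 + lam) <= e' * enorm D.
  by rewrite expr2 -mulrA mulrC ler_wpM2r// ltW.
have bil (a a' u u' t : E) : dot a' u' - dot a' t =
    dot a u - dot a t + dot a (u' - u) + dot (a' - a) (u - t) + dot (a' - a) (u' - u).
  by rewrite !dotE; ring.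
have b0E := bil a0 a0' w w' y; have b1E := bil a1 a1' w w' y.
rewrite -/dw -/d0 -/d1 in b0E b1E.
have hp' := hp _ (C_sub_U Cw'); have hq' := hq _ (C_sub_U Cw'); have hnu' := hnu _ Cw'.
rewrite -/dw in hp' hq' hnu'.
have sq : enorm (w - y) ^+ 2 + 2 * dot (w - y) dw - 2 * dot (w - y) dz <= enorm (w' - z') ^+ 2.
  have -> : w' - z' = (w - y) + (dw - dz).
    by rewrite /dw /dz opprB addrACA subrKC addKr.
  rewrite (enorm_sqD (w - y)) (dotDr _ dw) (dotNr _ dz).
  by have := sqr_ge0 (enorm (dw - dz)); lra.
have hs := hlam (G1 w' - dot a1' w' + (dot a1' y - HV y - eps P)).
have resE : res y a1 w = G1 w - dot a1 w + (dot a1 y - HV y - eps P).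
  by rewrite /res dotDr dotNr; lra.
have hl : lam * (dot q dw - dot a1 dw - dot d1 (w - y) - dot d1 dw) <=
    lam * (G1 w' - dot a1' w' + (dot a1' y - HV y - eps P) - res y a1 w).
  by rewrite ler_wpM2l// resE; lra.
have eDE : dot e dw = dot p dw - dot a0 dw + lam * (dot q dw - dot a1 dw) + dot nu dw
    + alpha * dot (w - y) dw.
  have gen (a b' c c' u v x : E) (s t : R) : dot (a - b' + s *: (c - c') + u + t *: v) x =
      dot a x - dot b' x + s * (dot c x - dot c' x) + dot u x + t * dot v x by rewrite !dotE.
  by rewrite eE gen.
have vD : dot ((e - (alpha / 2) *: (w - y), - ((alpha / 2) *: (w - y))), (y - w, lam *: (y - w))) D
  = dot e dw - alpha / 2 * dot (w - y) dw - alpha / 2 * dot (w - y) dz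
    - dot d0 (w - y) - lam * dot d1 (w - y).
  have gen (a u v x0' x1' x2' x3' : E) (s t : R) :
      dot (a - s *: u) x0' + dot (- (s *: u)) x1' + (dot (- v) x2' + dot (t *: (- v)) x3') =
      dot a x0' - s * dot u x0' - s * dot u x1' - dot x2' v - t * dot x3' v.
    by rewrite !dotE (dotC v x2') (dotC v x3'); ring.
  transitivity (dot (e - (alpha / 2) *: (w - y)) dw + dot (- ((alpha / 2) *: (w - y))) dz
      + (dot (y - w) d0 + dot (lam *: (y - w)) d1)); first by [].
  by rewrite -(opprB w y) gen.
have hsq : alpha / 4 * (enorm (w - y) ^+ 2 + 2 * dot (w - y) dw - 2 * dot (w - y) dz) <=
    alpha / 4 * enorm (w' - z') ^+ 2.
  by apply: ler_wpM2l sq; lra.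
rewrite vD eDE /merit_lb -resE; lra.
Qed.

Lemma merit_dist k : (dist0 (subdiff (merit P alpha (beta k)) (merit_pt k)) <=
  ((2 * alpha + 1 + beta k) * (delta k + enorm (z k - zprev zm1 z k)))%:E)%E.
Proof.
have [_ _ alpha0 _ _] := algo_params run.
apply/lee_addgt0Pr => r r0.
have [p [q [nu [e [lam [hp hq hnu hlam [eE ele]]]]]]] := step_exists k r0.
have b0 := ltW (beta_gt0 k).
rewrite -EFinD; apply: dist0_le (merit_subdiff b0 (algo_feasible run k)
  (algo_feasible run k.+1) (csub_H0 k) (csub_HV k) hp hq hnu hlam eE) _.
have /andP[lam0 lamb] := maxsub_range b0 hlam.
have d0 : 0 <= delta k := enorm_ge0 _.
have D0 : 0 <= enorm (z k - zprev zm1 z k) := enorm_ge0 _.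
apply: le_trans (enorm_quad_le _ _ _ _) _.
rewrite enormN !enormZ (enorm_distC (z k)) -/(delta k) (ger0_norm lam0) ger0_norm; last by lra.
have : enorm (e - (alpha / 2) *: (z k.+1 - z k)) <= enorm e + alpha / 2 * delta k.
  by apply: le_trans (ler_enormB _ _) _; rewrite enormZ ger0_norm//; lra.
have : lam * delta k <= beta k * delta k by rewrite ler_wpM2r.
have : Num.sqrt 2 / 2 * alpha * enorm (z k - zprev zm1 z k) <= alpha * enorm (z k - zprev zm1 z k).
  rewrite ler_wpM2r// -[leRHS]mul1r ler_wpM2r ?(ltW alpha0)// ler_pdivrMr// mul1r.
  by rewrite -ler_sqr ?nnegrE ?sqrtr_ge0// sqr_sqrtr//; lra.
have : 0 <= alpha * delta k by rewrite mulr_ge0// ltW.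
have : 0 <= alpha * enorm (z k - zprev zm1 z k) by rewrite mulr_ge0// ltW.
have : 0 <= beta k * enorm (z k - zprev zm1 z k) by rewrite mulr_ge0.
lra.
Qed.

Lemma maxsub_intro (b s lam : R) : s <= 0 -> 0 <= lam <= b -> lam * s = 0 -> maxsub b s lam.
Proof.
move=> s0 /andP[l0 lb] ls s'; rewrite (max_idPr s0) mulr0 add0r mulrBr ls subr0.
have [s'0|s'0] := leP s' 0; first by rewrite mulr0 mulr_ge0_le0.
by rewrite ler_wpM2r// ltW.
Qed.

Lemma merit_energy N k : (forall k, (N <= k)%N -> beta k = beta N) -> (N <= k)%N ->
  merit P alpha (beta N) (merit_pt k) = (energy k)%:E.
Proof.
move=> bN Nk; rewrite -(bN _ Nk) (meritE _ _ (algo_feasible run k) (algo_feasible run k.+1)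
  (csub_H0 k) (csub_HV k)); congr (_%:E).
rewrite /merit_lb /energy /model /res (dotDr (zeta0 k)) (dotDr (zeta1 k)) !dotNr.
have -> : G1 (z k.+1) - HV (z k) - (dot (zeta1 k) (z k.+1) - dot (zeta1 k) (z k)) - eps P =
  G1 (z k.+1) - dot (zeta1 k) (z k.+1) + (dot (zeta1 k) (z k) - HV (z k) - eps P) by ring.
by rewrite /delta; ring.
Qed.

(** The KL inequality is available only at points with a nonempty subdifferential and compares with
    the value there. Both are checked at limits of [merit_pt]: the limit relation provides a
    subgradient, and the value is the limit of the energy because the penalty term vanishes. *)
Lemma limit_merit N G (zb : E) : (forall k, (N <= k)%N -> beta k = beta N) ->
  UltraFilter G -> \oo `<=` G -> z @ G --> zb ->
  exists ub : (E * E) * (E * E), exists c : R,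
    [/\ merit_pt @ G --> ub, merit P alpha (beta N) ub = c%:E,
        energy @ G --> c & subdiff (merit P alpha (beta N)) ub !=set0].
Proof.
move=> bN GU oG zzb; have [_ _ alpha0 cb0 _] := algo_params run.
have [pb [qb [nub [z0b [z1b [lb [[hp hq hnu [z0c h0] [z1c h1]] [eq0 lb0 sb0 lsb]]]]]]]] :=
  limit_stationary bN GU oG zzb.
have Czb := zb_in_C GU zzb; have bN0 := ltW (beta_gt0 N).
have dG : delta @ G --> (0 : R) by move=> A /(delta_cvg0 bN) /oG.
have NG : \forall k \near G, (N <= k)%N by apply: oG; exists N.
have resE : res zb z1b zb = G1 zb - HV zb - eps P by rewrite /res subrr dot0r subr0.
exists ((zb, zb), (z0b, z1b)), (G0 zb - H0 zb); split.
- by apply: cvg_pair_pt; apply: cvg_pair_pt => //; exact: (zS_cvg GU zzb dG).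
- rewrite (meritE _ _ Czb Czb h0 h1) /merit_lb subrr enorm0 expr0n/= mulr0 addr0.
  have -> : G1 zb - dot z1b zb + (dot z1b zb - HV zb - eps P) = G1 zb - HV zb - eps P.
    by ring.
  by rewrite (max_idPr sb0) mulr0; congr (_%:E); ring.
- have c1 : G0 (z k.+1) - dot (zeta0 k) (z k.+1 - z k) - H0 (z k) @[k --> G] -->
      G0 zb - dot z0b 0 - H0 zb.
    apply: cvgB; last exact: (H0_cvg GU zzb).
    apply: cvgB; first exact: (G0_cvg GU zzb dG).
    by apply: cvg_dot => //; exact: (zdiff_cvg0 GU zzb dG).
  have c2 : beta k * Num.max (res (z k) (zeta1 k) (z k.+1)) 0 @[k --> G] --> (0 : R).
    have c3 : beta N * (delta k / cbeta) @[k --> G] --> beta N * (0 / cbeta).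
      by apply: cvgM; [exact: cvg_cst|apply: cvgM => //; exact: cvg_cst].
    rewrite mul0r mulr0 in c3; apply: (squeeze_cvgr _ (cvg_cst 0) c3).
    apply: filterS2 NG (oG _ (max_res_near bN)) => k Nk /andP[m0 m1].
    by rewrite (bN _ Nk) mulr_ge0//= ler_wpM2l.
  have c4 : alpha / 4 * delta k ^+ 2 @[k --> G] --> alpha / 4 * 0 ^+ 2.
    by apply: cvgM; [exact: cvg_cst|apply: cvgM].
  have -> : G0 zb - H0 zb = G0 zb - dot z0b 0 - H0 zb + 0 + alpha / 4 * 0 ^+ 2.
    by rewrite dot0r subr0 addr0 expr0n mulr0 addr0.
  exact: (cvgD (cvgD c1 c2) c4).
- exists ((0 - (alpha / 2) *: (zb - zb), - ((alpha / 2) *: (zb - zb))),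
    (zb - zb, lb *: (zb - zb))).
  apply: (merit_subdiff (p := pb) (q := qb) (nu := nub)) => //.
    by rewrite resE; exact: maxsub_intro.
  by rewrite subrr scaler0 addr0.
Qed.

(* The steps control z but not the slopes zeta0 and zeta1, so the KL inequality
   cannot be propagated from a single limit point: it is made uniform over all
   of them by showing that the sets of indices where it holds for large k with
   some desingularizing function form an ideal containing nat. *)
Lemma z_converges N : (forall k, (N <= k)%N -> beta k = beta N) -> bounded_fun z ->
  KL_function (merit P alpha (beta N)) -> exists zl : E, z @ \oo --> zl.
Proof.
move=> bN zbd [_ _ KL]; have [_ _ alpha0 cb0 _] := algo_params run.
have decr k : (N <= k)%N -> energy k.+1 + alpha / 4 * delta k.+1 ^+ 2 <= energy k.
  by move=> Nk; apply: energy_decr; rewrite !bN// leqW.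
have sq0 k : 0 <= alpha / 4 * delta k ^+ 2 by rewrite mulr_ge0 ?sqr_ge0//; lra.
have [a ac] : exists a : R, energy @ \oo --> a.
  suff : cvgn (fun k => energy (k + N)%N).
    by case/cvg_ex => a; rewrite (cvg_shiftn N energy) => ?; exists a.
  apply: nonincreasing_is_cvgn.
    apply/nonincreasing_seqP => k; rewrite addSn.
    by have := decr _ (leq_addl k N); have := sq0 (k + N).+1; lra.
  have [m0 hm] := F_bounded_below; exists m0 => _ [k _ <-].
  by apply: energy_ge => w Cw; apply: hm; exists w.
have mono i j : (N <= i)%N -> energy (j + i)%N <= energy i.
  move=> Ni; elim: j => [|j IH]; first by rewrite add0n.
  apply: le_trans IH; rewrite addSn.
  by have := decr _ (leq_trans Ni (leq_addl j i)); have := sq0 (j + i).+1; lra.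
have a_le k : (N <= k)%N -> a <= energy k.
  move=> Nk; apply: (cvg_ler ac (cvg_cst (energy k))); exists k => // j /= kj.
  by rewrite -(subnK kj); exact: mono.
(* If the energy reaches its limit it stays constant, and the later steps are 0. Otherwise it
   remains strictly above, as the KL inequality requires. *)
have [[k1 [Nk1 ek1]]|ne] := pselect (exists k1, (N <= k1)%N /\ energy k1 = a).
  apply: (@finite_length_cvg _ _ z (fun=> 0) k1.+1 hE) => k k1k; split=> //.
  have Nk : (N <= k.-1)%N by case: k k1k => // k; rewrite ltnS; exact: leq_trans.
  have := decr _ Nk; rewrite prednK ?(leq_trans _ k1k)// => h1.
  have h2 : energy k.-1 <= a.
    rewrite -ek1; have k1k' : (k1 <= k.-1)%N by case: k k1k {Nk h1}.
    by rewrite -(subnK k1k'); exact: mono.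
  have Nk' : (N <= k)%N by apply: leq_trans Nk (leq_pred _).
  have h3 := a_le _ Nk'; have h4 := sq0 k.
  have : alpha / 4 * delta k ^+ 2 == 0 by rewrite eq_le h4 andbT; lra.
  rewrite mulf_eq0 gt_eqF/=; last by lra.
  by rewrite sqrf_eq0 /delta => /eqP ->; rewrite subrr.
pose s k := energy k - a.
have s_gt0 k : (N <= k)%N -> 0 < s k.
  move=> Nk; rewrite subr_gt0 lt_neqAle a_le// andbT; apply/eqP => h; apply: ne.
  by exists k.
pose c2 := 2 * alpha + 1 + beta N.
have c20 : 0 < c2 by rewrite /c2 addr_gt0 ?beta_gt0//; lra.
pose D k := enorm (z k - zprev zm1 z k).
have r0 k : 0 <= c2 * (delta k + D k).
  by rewrite mulr_ge0 ?(ltW c20)// addr_ge0 ?enorm_ge0.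
pose kl (A : set nat) := exists M et phi psi, kl_pair et phi psi /\
  forall k, (M <= k)%N -> A k -> s k < et -> 1 <= psi (s k) * (c2 * (delta k + D k)).
have : kl setT.
  apply: ultra_ideal.
  - move=> A B AB [M [et [phi [psi [h H]]]]]; exists M, et, phi, psi; split=> // k Mk /AB.
    exact: H.
  - move=> A B [M [et [phi [psi [h H]]]]] [M' [et' [phi' [psi' [h' H']]]]].
    exists (maxn N (maxn M M')), (Num.min et et'),
      (fun s => phi s + phi' s), (fun s => psi s + psi' s).
    split; first exact: kl_pairD.
    move=> k; rewrite !geq_max => /and3P[Nk Mk M'k] AB; rewrite lt_min => /andP[se se'].
    have [_ _ p1 _] := h; have [_ _ p2 _] := h'; have s0 := s_gt0 _ Nk.
    have := p1 (s k); have := p2 (s k); rewrite s0 se se' => /(_ isT) q2 /(_ isT) q1.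
    rewrite mulrDl; case: AB => [/(H _ Mk)|/(H' _ M'k)] => /(_ _)/wrap[//|] h1.
      by apply: le_trans h1 _; rewrite lerDl mulr_ge0// ltW.
    by apply: le_trans h1 _; rewrite lerDr mulr_ge0// ltW.
  (* An initial segment has no index beyond its threshold, so any pair works. *)
  - move=> n'; exists n', 1, id, (fun=> 1); split=> [|k + kn]; last by rewrite leqNgt kn.
    by split=> // [s' /andP[/ltW]|t s'] //; rewrite mul1r.
  - move=> G GU oG; have [B zB] := z_enorm_bounded zbd.
    have [zb zzb] : exists zb : E, z @ G --> zb.
      by apply: (ultra_cvg hE (B := B) GU); apply: nearW => k; exact: zB.
    have [ub [c [uc mE ec sub]]] := limit_merit bN GU oG zzb.
    have cE : c = a by apply: cvg_unique ec _ => //; move=> A /ac /oG.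
    rewrite {}cE in mE ec.
    have [et [Z [phi [et0 nZ des hkl]]]] := KL _ sub.
    have [e ele klp] := desingularizing_kl_pair et0 des.
    (* The indices at which [merit_pt] is in the KL neighborhood of its limit along [G]. *)
    exists [set k | Z (merit_pt k)]; first exact: uc.
    exists N, e, phi, (derive1 phi); split=> // k Nk Zk se.
    have s0 := s_gt0 _ Nk.
    have := hkl _ Zk; rewrite mE (merit_energy bN Nk) lte_fin -subr_gt0 => /(_ s0).
    have lt2 : ((energy k)%:E < a%:E + et)%E.
      apply: (@lt_le_trans _ _ (a%:E + e%:E)%E); last exact: leeD2l.
      by rewrite -EFinD lte_fin; move: se; rewrite /s; lra.
    move=> /(_ lt2); rewrite -EFinB /= -/(s k) => h1.
    rewrite -lee_fin; apply: le_trans h1 _; rewrite EFinM.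
    have [_ _ psi0 _] := klp.
    apply: lee_wpmul2l; first by rewrite lee_fin ltW// psi0// s0.
    by have := merit_dist k; rewrite (bN _ Nk).
move=> [M [et [phi [psi [klp H]]]]]; have [et0 _ _ _] := klp.
have [M' _ hM'] : \forall k \near \oo, s k < et.
  have sc : s @ \oo --> (0 : R) by rewrite -(subrr a); apply: cvgB => //; exact: cvg_cst.
  move/cvgr0Pnorm_lt : sc => /(_ _ et0); apply: filterS => k.
  exact/le_lt_trans/ler_norm.
pose N2 := maxn N (maxn M M').
have c10 : 0 < alpha / 4 by lra.
have [|T hT] := @kl_length _ s delta et phi psi (alpha / 4) c2 N2 c10 c20 klp.
  move=> k; rewrite !geq_max => /and3P[Nk Mk M'k]; split.
  - exact: enorm_ge0.
  - by rewrite s_gt0//=; exact: hM'.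
  - by have := decr _ Nk; rewrite /s; lra.
  - have := H k.+1 (leqW Mk) I; rewrite /D /= -/(delta k); apply.
    by apply: hM'; exact: leqW.
(* Shifted by two because [kl_length] bounds the step of index k + 2. *)
have [|zl zc] := @finite_length_cvg _ _ (fun k => z k.+2) T N2 hE; first exact: hT.
exists zl => A Azl; have [M2 _ hM2] := zc _ Azl.
by exists M2.+2 => // -[|[|k]] //= Mk; exact: hM2.
Qed.

Lemma beta_eventually_const : bounded_fun (beta : nat -> R^o) ->
  exists N, forall k, (N <= k)%N -> beta k = beta N.
Proof.
have [_ db0 _ _ _] := algo_params run.
move=> /bounded_real_seqP[M bM].
case: (increments_or_const db0 beta_step) => // -[_ /(_ M) [k _ /(_ k (leqnn k))]].
by rewrite /= ltNge (le_trans (ler_norm _) (bM k)).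
Qed.

End run.

Theorem theorem18 (R : realType) (n m l : nat) (P : problem R n m l)
  (* standing assumptions *)
  (C_closed : closed (Cset P))
  (S_nonempty : forall x, xdom P x -> Slow P x !=set0)
  (U_open : open (udom P)) (U_convex : convex_set (udom P))
  (C_sub_U : Cset P `<=` udom P)
  (F1_wconvU : weakly_convex (rhoF P) (udom P) (objF1 P))
  (F2_wconvU : weakly_convex (rhoF P) (udom P) (objF2 P))
  (f_wconvU : weakly_convex (rhof P) (udom P) (lowf P))
  (* (A1) *)
  (Y_closed : closed (ydom P)) (Y_convex : convex_set (ydom P))
  (f_convY : forall x, xdom P x ->
     convex_function (ydom P) (fun y => lowf P (x, y)))
  (g_convY : forall x i, xdom P x ->
     convex_function (ydom P) (fun y => lowg P i (x, y)))
  (* (A2) *)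
  (X_convex : convex_set (xdom P))
  (g_convXY : forall i, convex_function (xdom P `*` ydom P) (lowg P i))
  (f_wconvC : weakly_convex (rhof P) (Cset P) (lowf P))
  (* (A3) *)
  (O_open : open (odom P)) (O_convex : convex_set (odom P))
  (X_sub_O : xdom P `<=` odom P)
  (g_convOY : forall i, convex_function (odom P `*` ydom P) (lowg P i))
  (feas_nonempty : forall x, odom P x -> feas P x !=set0)
  (f_wconvD : weakly_convex (rhof P) (Dset P) (lowf P))
  (gamma_rhov : moduli_range P)
  (* (A4) *)
  (F_def : forall z, (xdom P `*` ydom P) z ->
     objF P z = objF1 P z - objF2 P z)
  (F1_wconv : weakly_convex (rhoF P) (xdom P `*` ydom P) (objF1 P))
  (F2_wconv : weakly_convex (rhoF P) (xdom P `*` ydom P) (objF2 P))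
  (* the algorithm *)
  (alpha dbeta cbeta : R) (zm1 : 'rV[R]_n * 'rV[R]_m)
  (z : nat -> 'rV[R]_n * 'rV[R]_m) (beta : nat -> R)
  (yt : nat -> 'rV[R]_m) (eta : nat -> 'I_l -> R)
  (xi0 : nat -> 'rV[R]_n * 'rV[R]_m) (xi1 : nat -> 'rV[R]_n)
  (run : iP_DwCA P alpha dbeta cbeta zm1 z beta yt eta xi0 xi1)
  (f_partial : forall k, partial_formula (lowf P) ((z k).1, yt k))
  (g_partial : forall k i, partial_formula (lowg P i) ((z k).1, yt k))
  (* (A5) *)
  (M_nonempty : forall k, multipliers P (z k) (yt k) !=set0)
  (F_bounded_below : has_lbound (objF P @` Cset P))
  (F1_lip : locally_lipschitz (Cset P) (objF1 P))
  (F2_lip : locally_lipschitz (Cset P) (objF2 P))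
  (f_lip : locally_lipschitz (Cset P) (lowf P))
  (z_bounded : bounded_fun z) :
  [/\ (* (1) *)
      (bounded_fun (beta : nat -> R^o) ->
         forall zbar, cluster (z @ \oo) zbar -> KKT_point P zbar),
      (* (2) *)
      (bounded_fun (beta : nat -> R^o) ->
         (forall b : R, 0 < b -> KL_function (merit P alpha b)) ->
         exists zlim : 'rV[R]_n * 'rV[R]_m, z @ \oo --> zlim) &
      (* (3) *)
      (0 < eps P ->
         gam P = +oo%E \/
         (gam P <> +oo%E /\
          forall xbar, cluster ((fun k => (z k).1) @ \oo) xbar ->
            strictly_convex (fun y : 'rV[R]_m =>
              ((lowf P (xbar, y))%:E + set_indic (Cset P) (xbar, y))%E)) ->
         bounded_fun (beta : nat -> R^o))].
Proof.
split.
- move=> bbd zbar zcl.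
  have [N bN] : exists N, forall k, (N <= k)%N -> beta k = beta N.
    by eapply beta_eventually_const; eassumption.
  by eapply KKT_cluster; eassumption.
- move=> bbd KL.
  have [N bN] : exists N, forall k, (N <= k)%N -> beta k = beta N.
    by eapply beta_eventually_const; eassumption.
  have bN0 : 0 < beta N by eapply beta_gt0; eassumption.
  by have KLN := KL _ bN0; eapply z_converges; eassumption.
- by move=> eps0 gcase; eapply beta_bounded; eassumption.
Qed.
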